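(* Assume that $Q_t,R_t$ ($t\in\mathbb{N}$) are positive definite, that $(C,A)$ is observable, and that $A$ is invertible. Let $\mathbf{K}_0\in\mathbb{R}^{N\times Mm}$, let $\eta>0$ be a step size with $\eta\le\min\{c_3,c_4\}$ ($c_3,c_4$ as in the context), and let $\{\mathbf{K}_k\}$ be the gain sequence generated by the stochastic gradient descent method (Algorithm 1, described in the context) from $\mathbf{K}_0$ with step size $\eta$ and $L$ samples. Then there is a sample size $L_0(\epsilon,\delta)=O\big(\tfrac{1}{\epsilon^2}\ln(\tfrac1\delta)\big)$ (as $\epsilon,\delta\to0$, with constant depending only on the problem data, $b$, $\mathbf{K}_0$ and $\eta$) such that, if $L\ge L_0(\epsilon,\delta)$, then with probability at least $1-\delta$, as long as $f(\mathbf{K}_k)-f(\mathbf{K}^* )\ge\epsilon$ (that is, for every $k$ with $f(\mathbf{K}_j)-f(\mathbf{K}^* )\ge\epsilon$ for $j=0,\dots,k$), $$f(\mathbf{K}_k)-f(\mathbf{K}^* )\le(1-\alpha)^k\big(f(\mathbf{K}_0)-f(\mathbf{K}^* )\big),\qquad\alpha=\frac{\eta}{8c_1}.$$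
   Context: Let $M,N,m$ be positive integers, $A\in\mathbb{R}^{N\times N}$, $C\in\mathbb{R}^{m\times N}$, $\mathbb{T}=\{0,\dots,M-1\}$. $\|\cdot\|$ is the spectral norm; $\sigma_{\min}^{X},\sigma_{\max}^{X}$ are the minimal and maximal singular values of $X$. The system is $x_{t+1}=Ax_t+\omega_t$, $y_t=Cx_t+v_t$, $t\in\mathbb{N}$ ($0\in\mathbb N$), where $x_0\sim\mathcal N(\bar x_0,\Sigma_{x_0})$, $\{\omega_t\}$ and $\{v_t\}$ are Gaussian with zero mean, $\mathbb{E}[\omega_t\omega_t^T]=Q_t$, $\mathbb{E}[v_tv_t^T]=R_t$, and $x_0,\omega_t,v_t$ are mutually independent. For a gain $\mathbf{K}=(K_0,\dots,K_{M-1})$, $K_t\in\mathbb{R}^{N\times m}$, the estimates are generated by $\hat x_0=\bar x_0$, $\hat x_{t+1}=A\hat x_t+K_tCA(x_t-\hat x_t)+K_tC\omega_t+K_tv_{t+1}$, i.e. $\hat x_{t+1}=A\hat x_t+K_t(y_{t+1}-CA\hat x_t)$. Put $P_0=\mathbb{E}[(x_0-\hat x_0)(x_0-\hat x_0)^T]$, $\Sigma=\sum_{n=1}^{N}(CA^n)^TCA^n$ and $$f(\mathbf{K})=\mathbb{E}\Big[\mathrm{tr}\Big(\sum_{t=0}^{M-1}(x_{t+1}-\hat x_{t+1})(x_{t+1}-\hat x_{t+1})^T\Sigma\Big)\Big];$$ $\mathbf{K}^*$ is the minimizer of $f$ over $\mathbb{R}^{N\times Mm}$. Algorithm 1. Generate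 once $L$ mutually independent sample trajectories of observations $\{y_{t}(l)\}_{t=1}^{M+N}$, $l=1,\dots,L$, of the system. For a gain $\mathbf{K}$ set $\hat x_0(l)=\bar x_0$, $\hat x_{t+1}(l)=A\hat x_t(l)+K_t(y_{t+1}(l)-CA\hat x_t(l))$, $\hat y_{t}^n(l)=CA^n\hat x_t(l)$, $e_{i+1}^n(l)=y_{i+n+1}(l)-\hat y_{i+1}^n(l)$, and $$\hat\nabla_tf(\mathbf{K})=\frac1L\sum_{i=t}^{M-1}\sum_{l=1}^{L}\sum_{n=1}^{N}\nabla_t\big[e_{i+1}^n(l)^Te_{i+1}^n(l)\big],\quad t\in\mathbb{T},$$ where $\nabla_t$ is the gradient with respect to $K_t$ with the samples held fixed; $\hat\nabla f=(\hat\nabla_0f,\dots,\hat\nabla_{M-1}f)$. The iteration is $\mathbf{K}_{k+1}=\mathbf{K}_k-\eta\hat\nabla f(\mathbf{K}_k)$, with the same $L$ trajectories used at all iterations. Constants: $\underline\sigma=\min_{t\in\mathbb{T}}\sigma_{\min}^{R_{t+1}}$, $\bar\sigma=\max_{t\in\mathbb{T}}\sigma_{\max}^{CQ_tC^T+R_{t+1}}$, $q=\min_{t\in\mathbb{T}}\sigma_{\min}^{A^{-1}Q_tA^{-T}}$; $$\mathcal{A}(\mathbf{K})=\frac{f(\mathbf{K})}{\sigma_{\min}^{\Sigma}}+\|P_0\|,\qquad \mathcal{B}(\mathbf{K})=\frac{f(\mathbf{K})}{q}+N\sigma_{\max}^{\Sigma},$$ $$c_1=\frac{\mathcal{B}(\mathbf{K}^*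 )}{4\underline\sigma(\sigma_{\min}^{\Sigma})^2},\qquad c_2(\mathbf{K})=\frac{\sigma_{\min}^{\Sigma}}{4(\bar\sigma+\|CA\|^2\mathcal{A}(\mathbf{K}))},$$ $$\mathcal{C}(\mathbf{K})=\frac{\sqrt{M\,c_2(\mathbf{K})^{-1}(f(\mathbf{K})-f(\mathbf{K}^* ))}+\mathcal{A}(\mathbf{K})\|CA\|\|A\|}{\underline\sigma}+\sum_{t=0}^{M-1}\frac{\|CQ_t\|}{\underline\sigma};$$ $\rho_{\max}=\max\{\|A\|+\|CA\|\mathcal{C}(\mathbf{K}_0),1+b\}$ with $b>0$ a small constant; $$c_3=\frac{\min\{1,\sigma_{\min}^{\Sigma}\}}{2\mathcal{B}(\mathbf{K}_0)\sqrt{M\,c_2(\mathbf{K}_0)^{-1}(f(\mathbf{K}_0)-f(\mathbf{K}^* ))}\;\frac{\rho_{\max}^{2M}-1}{\rho_{\max}^2-1}(2\rho_{\max}+1)\|\Sigma\|\max\{\|CA\|,1\}},$$ $$c_4=\frac{1}{4(\bar\sigma+\|CA\|^2\mathcal{A}(\mathbf{K}_0))(\frac12+\mathcal{B}(\mathbf{K}_0))}.$$ *)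

(* Defs.v *)
From HB Require Import structures.
From mathcomp Require Import all_boot all_order all_algebra.
From mathcomp Require Import all_classical all_reals all_analysis.

Set Implicit Arguments.
Unset Strict Implicit.
Unset Printing Implicit Defensive.

Import Order.TTheory GRing.Theory Num.Theory.
Import numFieldNormedType.Exports.

Local Open Scope classical_set_scope.
Local Open Scope ring_scope.

(* Singular values of X are the nonnegative square roots of the eigenvalues
   of X^T X. When X is p x q with p < q this set contains 0, which is harmless
   for sigma_max; sigma_min is only defined for square matrices. *)
Definition singular_values (R : realType) (p q : nat) (X : 'M[R]_(p, q)) : set R :=
  [set s | 0 <= s /\ eigenvalue (X^T *m X) (s ^+ 2)].

Definition sigma_max (R : realType) (p q : nat) (X : 'M[R]_(p, q)) : R :=
  sup (singular_values X).

Definition sigma_min (R : realType) (n : nat) (X : 'M[R]_n) : R :=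
  inf (singular_values X).

(* The norm used throughout; not the library's `|X|, which is entrywise. *)
Definition spectral_norm (R : realType) (p q : nat) (X : 'M[R]_(p, q)) : R :=
  sigma_max X.

Definition posdef (R : realType) (n : nat) (X : 'M[R]_n) : Prop :=
  X^T = X /\ forall u : 'cV[R]_n, u != 0 -> 0 < (u^T *m X *m u) 0 0.

Definition possemidef (R : realType) (n : nat) (X : 'M[R]_n) : Prop :=
  X^T = X /\ forall u : 'cV[R]_n, 0 <= (u^T *m X *m u) 0 0.

(* Kalman rank condition on (C; C A; ...; C A^(N-1)). *)
Definition observable (R : realType) (N m : nat) (C : 'M[R]_(m, N))
    (A : 'M[R]_N) : Prop :=
  \rank (\mxcol_(i < N) (C *m A ^+ i)) = N.

(* The sigma-algebra generated by a family of real-valued functions. *)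
Definition generated_sigma (R : realType) (T J : Type) (X : J -> T -> R) :
    set (set T) :=
  <<s [set E | exists j (B : set R), measurable B /\ E = X j @^-1` B] >>.

Definition mutually_independent d (T : measurableType d) (R : realType)
    (P : probability T R) (I : eqType) (F : I -> set (set T)) : Prop :=
  forall (s : seq I) (E : I -> set T), uniq s ->
    (forall i, i \in s -> F i (E i)) ->
    P (\big[setI/setT]_(i <- s) E i) = (\prod_(i <- s) P (E i))%E.

(* The one-dimensional law N(mu, v), a Dirac mass when v = 0 (normal_prob
   takes the standard deviation and is not a Dirac mass at 0). *)
Definition gaussian_law (R : realType) (mu v : R) (B : set R) : \bar R :=
  if v == 0 then \d_mu B else normal_prob mu (Num.sqrt v) B.

(* X ~ N(mu, S), possibly degenerate: every linear form of X is Gaussian with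
   the corresponding mean and variance. *)
Definition gaussian_vector d (T : measurableType d) (R : realType)
    (P : probability T R) (n : nat) (X : T -> 'cV[R]_n)
    (mu : 'cV[R]_n) (S : 'M[R]_n) : Prop :=
  [/\ possemidef S,
      forall i, measurable_fun [set: T] (fun w => X w i 0) &
      forall (a : 'cV[R]_n) (B : set R), measurable B ->
        P ((fun w => (a^T *m X w) 0 0) @^-1` B) =
        gaussian_law ((a^T *m mu) 0 0) ((a^T *m S *m a) 0 0) B].

(* Deterministic data of x_{t+1} = A x_t + w_t, y_t = C x_t + v_t. *)
Record linear_system (R : realType) (N m : nat) := LinearSystem {
  sysA : 'M[R]_N;
  sysC : 'M[R]_(m, N);
  init_mean : 'cV[R]_N;
  init_cov : 'M[R]_N;
  procQ : nat -> 'M[R]_N;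
  measR : nat -> 'M[R]_m }.

Record noise (R : realType) (T : Type) (N m : nat) := Noise {
  init_state : T -> 'cV[R]_N;
  proc_noise : nat -> T -> 'cV[R]_N;
  meas_noise : nat -> T -> 'cV[R]_m }.

Definition vector_sigma (R : realType) (T : Type) (n : nat)
    (X : T -> 'cV[R]_n) : set (set T) :=
  generated_sigma (fun (i : 'I_n) w => X w i 0).

(* None indexes x_0, Some (inl t) indexes w_t and Some (inr t) indexes v_t. *)
Definition noise_sigma (R : realType) (T : Type) (N m : nat)
    (z : noise R T N m) (i : option (nat + nat)) : set (set T) :=
  match i with
  | None => vector_sigma (init_state z)
  | Some (inl t) => vector_sigma (proc_noise z t)
  | Some (inr t) => vector_sigma (meas_noise z t)
  end.

Definition realizes d (T : measurableType d) (R : realType)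
    (P : probability T R) (N m : nat) (S : linear_system R N m)
    (z : noise R T N m) : Prop :=
  [/\ gaussian_vector P (init_state z) (init_mean S) (init_cov S),
      forall t, gaussian_vector P (proc_noise z t) 0 (procQ S t),
      forall t, gaussian_vector P (meas_noise z t) 0 (measR S t) &
      mutually_independent P (noise_sigma z)].

Fixpoint state (R : realType) (T : Type) (N m : nat) (S : linear_system R N m)
    (z : noise R T N m) (t : nat) (w : T) : 'cV[R]_N :=
  match t with
  | 0%N => init_state z w
  | t'.+1 => sysA S *m state S z t' w + proc_noise z t' w
  end.

Definition observation (R : realType) (T : Type) (N m : nat)
    (S : linear_system R N m) (z : noise R T N m) (t : nat) (w : T) : 'cV[R]_m :=
  sysC S *m state S z t w + meas_noise z t w.

(* The sigma-algebra of the observation trajectory y_1, ..., y_{M+N}. *)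
Definition trajectory_sigma (R : realType) (T : Type) (M N m : nat)
    (S : linear_system R N m) (z : noise R T N m) : set (set T) :=
  generated_sigma (fun (p : 'I_(M + N) * 'I_m) w =>
    observation S z p.1.+1 w p.2 0).

(* K = (K_0, ..., K_{M-1}). *)
Definition gain (R : realType) (M N m : nat) := 'I_M -> 'M[R]_(N, m).

(* K_t for a natural number t; the value 0 for t >= M is never relevant, since
   only the estimates xhat_0, ..., xhat_M are used. *)
Definition gain_at (R : realType) (M N m : nat) (K : gain R M N m) (t : nat) :
    'M[R]_(N, m) :=
  if insub t is Some i then K i else 0.

Fixpoint estimate (R : realType) (M N m : nat) (S : linear_system R N m)
    (K : gain R M N m) (y : nat -> 'cV[R]_m) (t : nat) : 'cV[R]_N :=
  match t with
  | 0%N => init_mean S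
  | t'.+1 =>
      let xh := estimate S K y t' in
      sysA S *m xh + gain_at K t' *m (y t'.+1 - sysC S *m sysA S *m xh)
  end.

Definition est_error (R : realType) (T : Type) (M N m : nat)
    (S : linear_system R N m) (z : noise R T N m) (K : gain R M N m)
    (t : nat) (w : T) : 'cV[R]_N :=
  state S z t w - estimate S K (fun s => observation S z s w) t.

Definition Sigma (R : realType) (N m : nat) (S : linear_system R N m) : 'M[R]_N :=
  \sum_(1 <= n < N.+1)
    (sysC S *m sysA S ^+ n)^T *m (sysC S *m sysA S ^+ n).

Definition cost d (T : measurableType d) (R : realType) (P : probability T R)
    (M N m : nat) (S : linear_system R N m) (z : noise R T N m)
    (K : gain R M N m) : R :=
  fine ('E_P[fun w => \tr (\sum_(0 <= t < M)
    est_error S z K t.+1 w *m (est_error S z K t.+1 w)^T *m Sigma S)])%E.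

(* Since xhat_0 = init_mean S, P_0 = E[(x_0 - xhat_0)(x_0 - xhat_0)^T]. *)
Definition init_error_cov d (T : measurableType d) (R : realType)
    (P : probability T R) (N m : nat) (S : linear_system R N m)
    (z : noise R T N m) : 'M[R]_N :=
  \matrix_(i, j) fine ('E_P[fun w =>
    ((init_state z w - init_mean S) *m (init_state z w - init_mean S)^T) i j])%E.

Definition is_minimizer (X : Type) (R : realType) (f : X -> R) (x : X) : Prop :=
  forall x', f x <= f x'.

(* Perturbation of the t-th block of K by D. *)
Definition shift_gain (R : realType) (M N m : nat) (K : gain R M N m)
    (t : 'I_M) (D : 'M[R]_(N, m)) : gain R M N m :=
  fun s => if s == t then K s + D else K s.

(* Gradient with respect to K_t: the matrix of partial derivatives with respect
   to the entries of K_t. *)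
Definition block_gradient (R : realType) (M N m : nat) (t : 'I_M)
    (g : gain R M N m -> R) (K : gain R M N m) : 'M[R]_(N, m) :=
  \matrix_(i, j) derive1 (fun h : R => g (shift_gain K t (h *: delta_mx i j))) 0.

(* e_{i+1}^n = y_{i+n+1} - C A^n xhat_{i+1}. *)
Definition pred_error (R : realType) (M N m : nat) (S : linear_system R N m)
    (y : nat -> 'cV[R]_m) (i n : nat) (K : gain R M N m) : 'cV[R]_m :=
  y (i + n + 1)%N - sysC S *m sysA S ^+ n *m estimate S K y i.+1.

Definition grad_estimate (R : realType) (M N m L : nat)
    (S : linear_system R N m) (y : 'I_L -> nat -> 'cV[R]_m)
    (K : gain R M N m) (t : 'I_M) : 'M[R]_(N, m) :=
  L%:R^-1 *: \sum_(t <= i < M) \sum_(l < L) \sum_(1 <= n < N.+1)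
    block_gradient t
      (fun K' => ((pred_error S (y l) i n K')^T *m pred_error S (y l) i n K') 0 0) K.

Fixpoint sgd (R : realType) (M N m L : nat) (S : linear_system R N m)
    (y : 'I_L -> nat -> 'cV[R]_m) (eta : R) (K0 : gain R M N m) (k : nat) :
    gain R M N m :=
  match k with
  | 0%N => K0
  | k'.+1 => let K := sgd S y eta K0 k' in
             fun t => K t - eta *: grad_estimate S y K t
  end.

(* min and max over 0 <= t < M, for M > 0: the default F 0 is one of the values. *)
Definition min_upto (R : realType) (M : nat) (F : nat -> R) : R :=
  \big[Num.min/F 0%N]_(0 <= t < M) F t.
Definition max_upto (R : realType) (M : nat) (F : nat -> R) : R :=
  \big[Num.max/F 0%N]_(0 <= t < M) F t.

Definition sigma_low (R : realType) (M N m : nat) (S : linear_system R N m) : R :=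
  min_upto M (fun t => sigma_min (measR S t.+1)).

Definition sigma_up (R : realType) (M N m : nat) (S : linear_system R N m) : R :=
  max_upto M (fun t =>
    sigma_max (sysC S *m procQ S t *m (sysC S)^T + measR S t.+1)).

Definition q_low (R : realType) (M N m : nat) (S : linear_system R N m) : R :=
  min_upto M (fun t =>
    sigma_min (invmx (sysA S) *m procQ S t *m (invmx (sysA S))^T)).

(* In the constants below f is the cost, P0 the initial error covariance, Ks the
   minimizing gain and K0 the initial gain. *)
Definition constA (R : realType) (M N m : nat) (S : linear_system R N m)
    (f : gain R M N m -> R) (P0 : 'M[R]_N) (K : gain R M N m) : R :=
  f K / sigma_min (Sigma S) + spectral_norm P0.

Definition constB (R : realType) (M N m : nat) (S : linear_system R N m)
    (f : gain R M N m -> R) (K : gain R M N m) : R :=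
  f K / q_low M S + N%:R * sigma_max (Sigma S).

Definition c1 (R : realType) (M N m : nat) (S : linear_system R N m)
    (f : gain R M N m -> R) (Ks : gain R M N m) : R :=
  constB S f Ks / (4 * sigma_low M S * sigma_min (Sigma S) ^+ 2).

Definition c2 (R : realType) (M N m : nat) (S : linear_system R N m)
    (f : gain R M N m -> R) (P0 : 'M[R]_N) (K : gain R M N m) : R :=
  sigma_min (Sigma S) /
    (4 * (sigma_up M S
          + spectral_norm (sysC S *m sysA S) ^+ 2 * constA S f P0 K)).

Definition constC (R : realType) (M N m : nat) (S : linear_system R N m)
    (f : gain R M N m -> R) (P0 : 'M[R]_N) (Ks K : gain R M N m) : R :=
  (Num.sqrt (M%:R * (c2 S f P0 K)^-1 * (f K - f Ks))
   + constA S f P0 K * spectral_norm (sysC S *m sysA S) * spectral_norm (sysA S))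
    / sigma_low M S
  + \sum_(0 <= t < M) spectral_norm (sysC S *m procQ S t) / sigma_low M S.

Definition rho_max (R : realType) (M N m : nat) (S : linear_system R N m)
    (f : gain R M N m -> R) (P0 : 'M[R]_N) (Ks K0 : gain R M N m) (b : R) : R :=
  Num.max (spectral_norm (sysA S)
           + spectral_norm (sysC S *m sysA S) * constC S f P0 Ks K0)
          (1 + b).

(* Extended-real valued: the denominator vanishes when f K0 = f Ks, and then
   c3 = +oo (the inverse of 0 in \bar R is +oo). *)
Definition c3 (R : realType) (M N m : nat) (S : linear_system R N m)
    (f : gain R M N m -> R) (P0 : 'M[R]_N) (Ks K0 : gain R M N m) (b : R) : \bar R :=
  let rho := rho_max S f P0 Ks K0 b in
  ((Num.min 1 (sigma_min (Sigma S)))%:E /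
   (2 * constB S f K0
    * Num.sqrt (M%:R * (c2 S f P0 K0)^-1 * (f K0 - f Ks))
    * ((rho ^+ (2 * M) - 1) / (rho ^+ 2 - 1))
    * (2 * rho + 1) * spectral_norm (Sigma S)
    * Num.max (spectral_norm (sysC S *m sysA S)) 1)%R%:E)%E.

Definition c4 (R : realType) (M N m : nat) (S : linear_system R N m)
    (f : gain R M N m -> R) (P0 : 'M[R]_N) (K0 : gain R M N m) : R :=
  (4 * (sigma_up M S
        + spectral_norm (sysC S *m sysA S) ^+ 2 * constA S f P0 K0)
     * (2^-1 + constB S f K0))^-1.

(* "G holds with probability at least p", for G not assumed measurable. *)
Definition with_prob_at_least d (T : measurableType d) (R : realType)
    (P : probability T R) (p : R) (G : set T) : Prop :=
  exists E : set T, [/\ measurable E, E `<=` G & (p%:E <= P E)%E].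

(* Main.v *)
(* Write f(K) = sum_t tr(E_{t+1} Sigma), where E_t is the error covariance given
   by the Riccati recursion with gain K.  With X the adjoint (backward) recursion
   and H_t the residual K_t (innovation covariance) - (cross covariance), the
   gradient is 2 X_{t+1} H_t, and f(K') - f(K) is an exact expression, quadratic
   in K' - K, pairing the multipliers of K' with the residuals of K.  For K' a
   minimizer this gives gradient domination with constant c1; for K' a gradient
   step of size eta <= min(c3, c4) from the sublevel set of K_0 it shows that the
   gap contracts by 1 - eta/(8 c1), provided that the error in the gradient is
   small compared with sqrt(epsilon).

   The innovations form of the filter shows that the sample gradient is, for
   fixed K, a fixed linear function of the empirical second moments of the
   observations y_1, ..., y_{M+N}, and that the same function applied to the
   true moments is the true gradient.  The sampling error is therefore uniform
   over the bounded set of gains in the sublevel set, and one Chernoff bound for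
   these finitely many moments, which have exponential tails, controls all the
   iterations simultaneously. *)
Require Import Defs.
From HB Require Import structures.
From mathcomp Require Import all_boot all_order all_algebra finmap.
From mathcomp Require Import all_classical all_reals all_analysis.
From mathcomp Require Import measurable_realfun.
From mathcomp Require Import ring lra.

Set Implicit Arguments.
Unset Strict Implicit.
Unset Printing Implicit Defensive.

Import Order.TTheory GRing.Theory Num.Theory.
Import numFieldNormedType.Exports.

Local Open Scope classical_set_scope.
Local Open Scope ring_scope.

(** * Matrix inequalities and singular values *)

(** The sample size is fixed before any probability space is given, so every constant must come from
    [S], [b], [K0] and [eta] alone. This is possible because [cost] equals [riccati_cost], a
    function of [S] only, and because all tail constants are uniform over the realizations of [S].
    The exact cost difference carries the multipliers of the other gain. For gradient domination
    that gain is a minimizer, hence the constant B of the minimizer in [c1]. For a descent step it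
    is the next iterate, whose multipliers are not those of the gradient: [c3] keeps their change
    below half of min(1, sigma_min Sigma), and [c4] then controls the quadratic term. The iterates
    depend on the very samples that produce the next gradient, so a bound for one fixed gain says
    nothing about them. The exceptional event is therefore defined by the empirical moments alone,
    which also makes it measurable, whatever the event of the statement is. The matrix estimates
    rest on Cauchy-Schwarz for semidefinite forms instead of a spectral decomposition. *)

Definition fip (R : realType) p q (X Z : 'M[R]_(p, q)) : R := \tr (X^T *m Z).
Notation fn2 X := (fip X X).

Section FrobeniusProduct.
Variable R : realType.
Implicit Types p q r : nat.

Lemma fipE p q (X Z : 'M[R]_(p, q)) : fip X Z = \sum_j \sum_i X i j * Z i j.
Proof.
by apply: eq_bigr => j _; rewrite mxE; apply: eq_bigr => i _; rewrite mxE.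
Qed.

Lemma fip_cV n (u v : 'cV[R]_n) : fip u v = (u^T *m v) 0 0.
Proof. by rewrite /fip /mxtrace big_ord1. Qed.

Lemma fipC p q (X Z : 'M[R]_(p, q)) : fip X Z = fip Z X.
Proof. by rewrite /fip -mxtrace_tr trmx_mul trmxK. Qed.

Lemma fipDr p q (X Z V : 'M[R]_(p, q)) : fip X (Z + V) = fip X Z + fip X V.
Proof. by rewrite /fip mulmxDr mxtraceD. Qed.

Lemma fipDl p q (X Z V : 'M[R]_(p, q)) : fip (X + Z) V = fip X V + fip Z V.
Proof. by rewrite !(fipC _ V) fipDr. Qed.

Lemma fipZr p q a (X Z : 'M[R]_(p, q)) : fip X (a *: Z) = a * fip X Z.
Proof. by rewrite /fip -scalemxAr mxtraceZ. Qed.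

Lemma fipZl p q a (X Z : 'M[R]_(p, q)) : fip (a *: X) Z = a * fip X Z.
Proof. by rewrite fipC fipZr fipC. Qed.

Lemma fipNr p q (X Z : 'M[R]_(p, q)) : fip X (- Z) = - fip X Z.
Proof. by rewrite -scaleN1r fipZr mulN1r. Qed.

Lemma fipNl p q (X Z : 'M[R]_(p, q)) : fip (- X) Z = - fip X Z.
Proof. by rewrite fipC fipNr fipC. Qed.

Lemma fipBr p q (X Z V : 'M[R]_(p, q)) : fip X (Z - V) = fip X Z - fip X V.
Proof. by rewrite fipDr fipNr. Qed.

Lemma fipBl p q (X Z V : 'M[R]_(p, q)) : fip (X - Z) V = fip X V - fip Z V.
Proof. by rewrite fipDl fipNl. Qed.

Lemma fip0r p q (X : 'M[R]_(p, q)) : fip X 0 = 0.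
Proof. by rewrite /fip mulmx0 mxtrace0. Qed.

Lemma fip_tr p q (X Z : 'M[R]_(p, q)) : fip X^T Z^T = fip X Z.
Proof. by rewrite /fip mxtrace_mulC -mxtrace_tr trmx_mul !trmxK. Qed.

Lemma fip_mull p q r (A : 'M[R]_(r, p)) (X : 'M[R]_(p, q)) (Z : 'M[R]_(r, q)) :
  fip (A *m X) Z = fip X (A^T *m Z).
Proof. by rewrite /fip trmx_mul mulmxA. Qed.

Lemma fn2E p q (X : 'M[R]_(p, q)) : fn2 X = \sum_j \sum_i X i j ^+ 2.
Proof. by rewrite fipE. Qed.

Lemma fn2_ge0 p q (X : 'M[R]_(p, q)) : 0 <= fn2 X.
Proof.
by rewrite fn2E; apply: sumr_ge0 => j _; apply: sumr_ge0 => i _; apply: sqr_ge0.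
Qed.

Lemma fn2_eq0 p q (X : 'M[R]_(p, q)) : fn2 X = 0 -> X = 0.
Proof.
rewrite fn2E => /eqP; rewrite psumr_eq0 => [/allP X0|j _]; last first.
  by apply: sumr_ge0 => i _; apply: sqr_ge0.
apply/matrixP => i j; rewrite mxE.
have /implyP/(_ isT) := X0 j (mem_index_enum _).
rewrite psumr_eq0 => [/allP/(_ i (mem_index_enum _))/implyP/(_ isT)|? _].
  by rewrite sqrf_eq0 => /eqP.
exact: sqr_ge0.
Qed.

Lemma fn2_gt0 p q (X : 'M[R]_(p, q)) : X != 0 -> 0 < fn2 X.
Proof.
by move=> X0; rewrite lt_def fn2_ge0 andbT; apply: contra X0 => /eqP/fn2_eq0 ->.
Qed.

Lemma discr_le (a b c : R) : 0 <= c ->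
  (forall t, 0 <= a + 2 * b * t + c * t ^+ 2) -> b ^+ 2 <= a * c.
Proof.
move=> c0 H; have [c_eq0|cn0] := eqVneq c 0.
  have [->|bn0] := eqVneq b 0; first by rewrite expr0n /= c_eq0 mulr0.
  (* With [c = 0] the affine function takes the value -1 at this point, against [H]. *)
  have := H (- (a + 1) / (2 * b)); rewrite c_eq0 mul0r addr0.
  rewrite mulrC -mulrA mulVf ?mulf_neq0 ?pnatr_eq0// mulr1; lra.
have cp : 0 < c by rewrite lt_def cn0.
have := H (- b / c).
have -> : a + 2 * b * (- b / c) + c * (- b / c) ^+ 2 = (a * c - b ^+ 2) / c.
  by field.
by rewrite pmulr_lge0 ?invr_gt0// subr_ge0.
Qed.

Lemma fip_CS p q (X Z : 'M[R]_(p, q)) : fip X Z ^+ 2 <= fn2 X * fn2 Z.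
Proof.
apply: discr_le; first exact: fn2_ge0.
move=> t; have := fn2_ge0 (X + t *: Z).
rewrite !fipDl !fipDr !fipZl !fipZr (fipC Z X).
by congr (0 <= _); ring.
Qed.

Lemma fip_le_sqrt p q (X Z : 'M[R]_(p, q)) :
  fip X Z <= Num.sqrt (fn2 X) * Num.sqrt (fn2 Z).
Proof.
rewrite -sqrtrM ?fn2_ge0//; apply: le_trans (ler_norm _) _.
by rewrite -sqrtr_sqr ler_wsqrtr// fip_CS.
Qed.

Lemma fn2_tr p q (X : 'M[R]_(p, q)) : fn2 X^T = fn2 X.
Proof. exact: fip_tr. Qed.

Lemma fip_col p q (X Z : 'M[R]_(p, q)) : fip X Z = \sum_j fip (col j X) (col j Z).
Proof.
rewrite fipE; apply: eq_bigr => j _; rewrite fipE big_ord1.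
by apply: eq_bigr => i _; rewrite !mxE.
Qed.

Lemma fn2M p q r (X : 'M[R]_(p, q)) (Z : 'M[R]_(q, r)) :
  fn2 (X *m Z) <= fn2 X * fn2 Z.
Proof.
rewrite (fn2E (_ *m _)) -(fn2_tr X) (fip_col X^T) (fip_col Z) mulr_sumr.
apply: ler_sum => j _; rewrite mulr_suml; apply: ler_sum => i _.
apply: le_trans (fip_CS _ _); rewrite le_eqVlt; apply/orP; left; apply/eqP; congr (_ ^+ 2).
by rewrite fip_cV !mxE; apply: eq_bigr => k _; rewrite !mxE.
Qed.

End FrobeniusProduct.

(* [opb X c]: the operator norm of X is at most c. *)
Definition opb (R : realType) p q (X : 'M[R]_(p, q)) (c : R) : Prop :=
  forall u : 'cV[R]_q, fn2 (X *m u) <= c ^+ 2 * fn2 u.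
Definition lge (R : realType) n (X : 'M[R]_n) (c : R) : Prop :=
  forall u : 'cV[R]_n, c * fn2 u <= fip u (X *m u).
Definition lle (R : realType) n (X : 'M[R]_n) (c : R) : Prop :=
  forall u : 'cV[R]_n, fip u (X *m u) <= c * fn2 u.

Section OperatorBounds.
Variable R : realType.
Implicit Types p q r n : nat.

Lemma col_mulmx p q r (X : 'M[R]_(p, q)) (Z : 'M[R]_(q, r)) j :
  col j (X *m Z) = X *m col j Z.
Proof. by rewrite !colE mulmxA. Qed.

Lemma opb_mx p q r (X : 'M[R]_(p, q)) c (Z : 'M[R]_(q, r)) :
  opb X c -> fn2 (X *m Z) <= c ^+ 2 * fn2 Z.
Proof.
move=> Xc; rewrite fip_col (fip_col Z) mulr_sumr.
by apply: ler_sum => j _; rewrite col_mulmx.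
Qed.

Lemma lge_mx n r (X : 'M[R]_n) c (Z : 'M[R]_(n, r)) :
  lge X c -> c * fn2 Z <= fip Z (X *m Z).
Proof.
move=> Xc; rewrite fip_col (fip_col Z (X *m Z)) mulr_sumr.
by apply: ler_sum => j _; rewrite col_mulmx.
Qed.

Lemma lle_mx n r (X : 'M[R]_n) c (Z : 'M[R]_(n, r)) :
  lle X c -> fip Z (X *m Z) <= c * fn2 Z.
Proof.
move=> Xc; rewrite fip_col (fip_col Z Z) mulr_sumr.
by apply: ler_sum => j _; rewrite col_mulmx.
Qed.

Lemma opb_fn2 p q (X : 'M[R]_(p, q)) : opb X (Num.sqrt (fn2 X)).
Proof. by move=> u; rewrite sqr_sqrtr ?fn2_ge0// fn2M. Qed.

Lemma opb_le p q (X : 'M[R]_(p, q)) c d : 0 <= c -> c <= d -> opb X c -> opb X d.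
Proof.
move=> c0 cd Xc u; apply: le_trans (Xc u) _.
by rewrite ler_wpM2r ?fn2_ge0// ler_pXn2r// nnegrE ?(le_trans c0).
Qed.

Lemma opb_sqrt p q (X : 'M[R]_(p, q)) c (u : 'cV[R]_q) : 0 <= c -> opb X c ->
  Num.sqrt (fn2 (X *m u)) <= c * Num.sqrt (fn2 u).
Proof.
move=> c0 Xc; rewrite -[X in _ <= X * _](ger0_norm c0) -sqrtr_sqr -sqrtrM ?sqr_ge0//.
exact/ler_wsqrtr/Xc.
Qed.

Lemma opb_of_sqrt p q (X : 'M[R]_(p, q)) c : 0 <= c ->
  (forall u : 'cV[R]_q, Num.sqrt (fn2 (X *m u)) <= c * Num.sqrt (fn2 u)) ->
  opb X c.
Proof.
move=> c0 H u; rewrite -[leLHS]sqr_sqrtr ?fn2_ge0// -[fn2 u]sqr_sqrtr ?fn2_ge0//.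
by rewrite -exprMn ler_pXn2r// nnegrE ?mulr_ge0 ?sqrtr_ge0.
Qed.

Lemma sqrt_fn2D p q (X Z : 'M[R]_(p, q)) :
  Num.sqrt (fn2 (X + Z)) <= Num.sqrt (fn2 X) + Num.sqrt (fn2 Z).
Proof.
rewrite -[leRHS]ger0_norm ?addr_ge0 ?sqrtr_ge0// -sqrtr_sqr ler_wsqrtr//.
rewrite sqrrD !sqr_sqrtr ?fn2_ge0// !fipDl !fipDr (fipC Z X).
by have := fip_le_sqrt X Z; lra.
Qed.

Lemma opbD p q (X Z : 'M[R]_(p, q)) c d : 0 <= c -> 0 <= d ->
  opb X c -> opb Z d -> opb (X + Z) (c + d).
Proof.
move=> c0 d0 Xc Zd; apply: opb_of_sqrt; first exact: addr_ge0.
move=> u; rewrite mulmxDl mulrDl; apply: le_trans (sqrt_fn2D _ _) _.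
by apply: lerD; exact: opb_sqrt.
Qed.

Lemma opbN p q (X : 'M[R]_(p, q)) c : opb X c -> opb (- X) c.
Proof. by move=> Xc u; rewrite mulNmx fipNl fipNr opprK. Qed.

Lemma opbZ p q a (X : 'M[R]_(p, q)) c : 0 <= a -> opb X c -> opb (a *: X) (a * c).
Proof.
move=> a0 Xc u; rewrite -scalemxAl fipZl fipZr mulrA -expr2.
by rewrite exprMn -(mulrA _ (c ^+ 2)) ler_wpM2l ?sqr_ge0.
Qed.

Lemma opbM p q r (X : 'M[R]_(p, q)) (Z : 'M[R]_(q, r)) c d :
  opb X c -> opb Z d -> opb (X *m Z) (c * d).
Proof.
move=> Xc Zd u; rewrite -mulmxA; apply: le_trans (Xc _) _.
by rewrite exprMn -(mulrA _ (d ^+ 2)) ler_wpM2l ?sqr_ge0.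
Qed.

(** With a = |X^T u|^2, Cauchy-Schwarz gives a^2 = <u, X X^T u>^2 <= |u|^2 c^2 a, and one factor [a]
    cancels. *)
Lemma opb_tr p q (X : 'M[R]_(p, q)) c : opb X c -> opb X^T c.
Proof.
move=> Xc u; have := fip_CS u (X *m (X^T *m u)).
rewrite fipC fip_mull; set a := fn2 _ => H.
have [->|a0] := eqVneq a 0; first by rewrite mulr_ge0 ?sqr_ge0 ?fn2_ge0.
have ap : 0 < a by rewrite lt_def a0 fn2_ge0.
rewrite -(ler_pM2r ap) -expr2; apply: le_trans H _.
by rewrite mulrAC mulrC ler_wpM2r ?fn2_ge0.
Qed.

Lemma fip_opb n r (X : 'M[R]_n) c (U V : 'M[R]_(n, r)) : 0 <= c -> opb X c ->
  fip U (X *m V) <= c * (Num.sqrt (fn2 U) * Num.sqrt (fn2 V)).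
Proof.
move=> c0 Xc; apply: le_trans (fip_le_sqrt _ _) _.
rewrite mulrCA ler_wpM2l ?sqrtr_ge0//.
rewrite -[X in _ <= X * _](ger0_norm c0) -sqrtr_sqr -sqrtrM ?sqr_ge0//.
exact/ler_wsqrtr/opb_mx.
Qed.

Lemma psdE n (X : 'M[R]_n) : possemidef X <-> X^T = X /\ lge X 0.
Proof.
split=> -[sX H]; split=> // u; first by rewrite mul0r fip_cV mulmxA.
by have := H u; rewrite mul0r fip_cV mulmxA.
Qed.

Lemma psd_lge0 n (X : 'M[R]_n) : possemidef X -> lge X 0.
Proof. by move=> /psdE[]. Qed.

Lemma psd_sym n (X : 'M[R]_n) : possemidef X -> X^T = X.
Proof. by case. Qed.

Lemma posdef_psd n (X : 'M[R]_n) : posdef X -> possemidef X.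
Proof.
move=> [sX H]; split=> // u; have [->|u0] := eqVneq u 0.
  by rewrite mulmx0 mxE.
exact/ltW/H.
Qed.

Lemma psdD n (X Z : 'M[R]_n) : possemidef X -> possemidef Z -> possemidef (X + Z).
Proof.
move=> /psdE[sX X0] /psdE[sZ Z0]; apply/psdE; split=> [|u].
  by rewrite linearD /= sX sZ.
by rewrite mulmxDl fipDr; have := X0 u; have := Z0 u; rewrite !mul0r; lra.
Qed.

Lemma psd0 n : possemidef (0 : 'M[R]_n).
Proof. by split=> [|u]; rewrite ?trmx0// mulmx0 mul0mx mxE. Qed.

Lemma psd_congr n p (X : 'M[R]_n) (Z : 'M[R]_(p, n)) :
  possemidef X -> possemidef (Z *m X *m Z^T).
Proof.
move=> /psdE[sX X0]; apply/psdE; split=> [|u].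
  by rewrite !trmx_mul trmxK sX mulmxA.
by rewrite -!mulmxA fipC fip_mull fipC mul0r; have := X0 (Z^T *m u); rewrite mul0r.
Qed.

Lemma psd_CS n r (X : 'M[R]_n) (U V : 'M[R]_(n, r)) : possemidef X ->
  fip U (X *m V) ^+ 2 <= fip U (X *m U) * fip V (X *m V).
Proof.
move=> /psdE[sX X0]; apply: discr_le.
  by have := lge_mx V X0; rewrite mul0r.
move=> t; have := lge_mx (U + t *: V) X0; rewrite mul0r.
rewrite mulmxDr -scalemxAr !fipDl !fipDr !fipZl !fipZr.
by rewrite (fipC V (X *m U)) fip_mull sX; congr (0 <= _); ring.
Qed.

(** Cauchy-Schwarz for the form of [X] at v = X u and u gives |v|^4 <= <v, X v> <u, X u> <= c^2
    |v|^2 |u|^2. *)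
Lemma psd_opb n (X : 'M[R]_n) c : possemidef X -> lle X c -> opb X c.
Proof.
move=> pX Xc u; set v := X *m u.
have := psd_CS v u pX; rewrite -/v => H.
have [v0|vn0] := eqVneq (fn2 v) 0.
  by rewrite v0 mulr_ge0 ?sqr_ge0 ?fn2_ge0.
have vp : 0 < fn2 v by rewrite lt_def vn0 fn2_ge0.
have := psd_lge0 pX v; rewrite mul0r => H0; have := psd_lge0 pX u; rewrite mul0r -/v => H1.
have H2 := Xc v; have H3 := Xc u; rewrite -/v in H3.
have H4 : fn2 v ^+ 2 <= c * fn2 v * (c * fn2 u).
  by apply: le_trans H _; apply: ler_pM.
rewrite -(ler_pM2r vp) -expr2 (le_trans H4)//.
by rewrite le_eqVlt; apply/orP; left; apply/eqP; ring.
Qed.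

Lemma opb_lle n (X : 'M[R]_n) c : 0 <= c -> opb X c -> lle X c.
Proof.
move=> c0 Xc u; apply: le_trans (fip_opb _ _ c0 Xc) _.
by rewrite -expr2 sqr_sqrtr ?fn2_ge0.
Qed.

Lemma lge_inv n r (X : 'M[R]_n) c (U : 'M[R]_(n, r)) : 0 <= c -> lge X c ->
  c ^+ 2 * fn2 U <= fn2 (X *m U).
Proof.
move=> c0 Xc; rewrite fip_col (fip_col (X *m U)) mulr_sumr.
apply: ler_sum => j _; rewrite col_mulmx; set u := col j U.
have [->|un0] := eqVneq (fn2 u) 0; first by rewrite mulr0 fn2_ge0.
have up : 0 < fn2 u by rewrite lt_def un0 fn2_ge0.
rewrite -(ler_pM2l up); apply: le_trans (fip_CS _ _).
rewrite [leLHS](_ : _ = (c * fn2 u) ^+ 2); last by ring.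
by rewrite ler_pXn2r ?nnegrE ?(le_trans _ (Xc u)) ?mulr_ge0 ?fn2_ge0.
Qed.

(** The 2 by 2 minors give X_ij^2 <= X_ii X_jj; summed over i and j, the squared Frobenius norm is
    at most (tr X)^2. *)
Lemma trace_le_psd n (X : 'M[R]_n) : possemidef X -> lle X (\tr X).
Proof.
move=> pX; have pXd i : 0 <= X i i.
  have := psd_lge0 pX (delta_mx i 0); rewrite mul0r fip_cV trmx_delta.
  by rewrite -colE -rowE !mxE.
have pXij i j : X i j ^+ 2 <= X i i * X j j.
  have := psd_CS (delta_mx i 0 : 'cV_n) (delta_mx j 0) pX.
  by rewrite !fip_cV !trmx_delta -!colE -!rowE !mxE.
have tr0 : 0 <= \tr X by apply: sumr_ge0 => i _.
apply: opb_lle => // u; apply: le_trans (opb_fn2 X u) _.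
rewrite ler_wpM2r ?fn2_ge0// sqr_sqrtr ?fn2_ge0// fn2E expr2 [in leRHS]/mxtrace.
rewrite big_distrlr /= ; apply: ler_sum => j _; apply: ler_sum => i _.
by rewrite mulrC pXij.
Qed.

(* Subtracting the rank-one matrix X e_i e_i^T X / X_ii from X keeps it
   positive semidefinite and clears one more diagonal entry. *)
Lemma psd_tr_ge0 n (X Z : 'M[R]_n) : possemidef X -> possemidef Z ->
  0 <= \tr (X *m Z).
Proof.
move=> + pZ; have [k] := ubnP #|[set i | X i i != 0]%SET|.
elim: k X => // k IH X /ltnSE leXk pX.
have [i Xi0|X0] := pickP (fun i => X i i != 0); last first.
  suff -> : X = 0 by rewrite mul0mx mxtrace0.
  apply/matrixP => i j; rewrite mxE; apply/eqP; rewrite -sqrf_eq0 eq_le sqr_ge0 andbT.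
  have := psd_CS (delta_mx i 0 : 'cV_n) (delta_mx j 0) pX.
  rewrite !fip_cV !trmx_delta -!colE -!rowE !mxE.
  by move/negbT: (X0 i); rewrite negbK => /eqP ->; rewrite mul0r.
have Xii : 0 < X i i.
  rewrite lt_def Xi0 /=.
  have := psd_lge0 pX (delta_mx i 0); rewrite mul0r fip_cV trmx_delta.
  by rewrite -colE -rowE !mxE.
set v := col i X; pose X' := X - (X i i)^-1 *: (v *m v^T).
have uv (u : 'cV[R]_n) : fip u (v *m v^T *m u) = fip u v ^+ 2.
  by rewrite -mulmxA -{1}[v]trmxK -fip_mull fipE !big_ord1 -expr2 fipC fip_cV.
have uX (u : 'cV[R]_n) : fip u v ^+ 2 <= fip u (X *m u) * X i i.
  have := psd_CS u (delta_mx i 0) pX.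
  by rewrite [fip (delta_mx _ _) _]fip_cV !trmx_delta -!colE -!rowE !mxE.
have pX' : possemidef X'.
  apply/psdE; split.
    by rewrite linearB /= linearZ /= trmx_mul trmxK psd_sym.
  move=> u; rewrite mul0r mulmxBl fipBr -scalemxAl fipZr uv.
  by rewrite subr_ge0 mulrC ler_pdivrMr.
have -> : X = X' + (X i i)^-1 *: (v *m v^T) by rewrite subrK.
rewrite mulmxDl mxtraceD addr_ge0//; last first.
  rewrite -scalemxAl mxtraceZ mulr_ge0 ?invr_ge0 ?(ltW Xii)// -mulmxA mxtrace_mulC.
  by have := psd_lge0 pZ v; rewrite mul0r /fip mulmxA.
have X'jj j : X' j j = X j j - (X i i)^-1 * X j i ^+ 2.
  by rewrite !mxE big_ord1 !mxE expr2.
apply: (IH X') => //; apply: leq_trans leXk; apply: proper_card; apply/properP; split.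
  apply/fintype.subsetP => j; rewrite !inE; apply: contra => /eqP Xj.
  have := psd_CS (delta_mx j 0 : 'cV_n) (delta_mx i 0) pX.
  rewrite !fip_cV !trmx_delta -!colE -!rowE ![(row _ _) _ _]mxE ![(col _ _) _ _]mxE Xj mul0r => Xji.
  have /eqP Xji0 : X j i ^+ 2 == 0 by rewrite eq_le sqr_ge0 andbT.
  by rewrite X'jj Xj Xji0 mulr0 subr0.
exists i; first by rewrite inE.
by rewrite inE negbK X'jj expr2 mulKf// subrr.
Qed.

End OperatorBounds.

(** * Singular values as bounds of quadratic forms *)

Section SingularValues.
Variable R : realType.
Implicit Types p q n : nat.

(** Invertibility gives |u|^2 <= g |Z u|^2, and Cauchy-Schwarz for the form of [Z] gives |Z u|^2 <=
    b <u, Z u>. This uniform lower bound takes the place of compactness in [rayleigh_min]. *)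
Lemma unit_psd_lge n (Z : 'M[R]_n) : possemidef Z -> Z \in unitmx ->
  exists2 c, 0 < c & lge Z c.
Proof.
move=> pZ uZ; pose b := Num.sqrt (fn2 Z) + 1; pose g := fn2 (invmx Z) + 1.
have b0 : 0 < b by rewrite ltr_wpDl ?sqrtr_ge0.
have g0 : 0 < g by rewrite ltr_wpDl ?fn2_ge0.
have Zb : opb Z b by apply: opb_le (opb_fn2 Z); rewrite ?sqrtr_ge0 ?lerDl.
exists (g * b)^-1; first by rewrite invr_gt0 mulr_gt0.
move=> u; have Hu : fn2 u <= g * fn2 (Z *m u).
  rewrite -{1 2}[u](mulKmx uZ) (le_trans (fn2M _ _))//.
  by rewrite ler_wpM2r ?fn2_ge0// lerDl.
set v := Z *m u in Hu *; rewrite mulrC ler_pdivrMr ?mulr_gt0//.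
apply: le_trans Hu _; rewrite [leRHS]mulrCA ler_pM2l//.
have := psd_CS v u pZ; rewrite -/v => H.
have [->|vn0] := eqVneq (fn2 v) 0.
  by rewrite mulr_ge0 ?(ltW b0)//; have := psd_lge0 pZ u; rewrite mul0r.
have vp : 0 < fn2 v by rewrite lt_def vn0 fn2_ge0.
rewrite -(ler_pM2r vp) -expr2; apply: le_trans H _.
have H2 : fip v (Z *m v) <= b * fn2 v by exact: opb_lle (ltW b0) Zb v.
have H3 := psd_lge0 pZ u; rewrite mul0r -/v in H3.
by rewrite -mulrA mulrC; apply: ler_wpM2l.
Qed.

Lemma posdef_lge n (Z : 'M[R]_n) : posdef Z -> exists2 c, 0 < c & lge Z c.
Proof.
move=> dZ; apply: unit_psd_lge; first exact: posdef_psd.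
rewrite -row_free_unit -kermx_eq0; apply/eqP/row_matrixP => i; rewrite row0.
apply/eqP/negPn/negP => v0; have [sZ /(_ (row i (kermx Z))^T)] := dZ.
rewrite trmxK -row_mul mulmx_ker row0 mul0mx mxE ltxx => H; apply: notF; apply: H.
by apply: contra v0; rewrite -{2}[row _ _]trmxK => /eqP ->; rewrite trmx0.
Qed.

(** [l] is the infimum of the form on the unit sphere. Were [Z - l] invertible, it would, being
    semidefinite, be bounded below by some [e > 0], and [l + e] would be a lower bound as well; so
    [l] is an eigenvalue. *)
Lemma rayleigh_min n (Z : 'M[R]_n) : (0 < n)%N -> Z^T = Z ->
  exists2 l, eigenvalue Z l & lge Z l.
Proof.
case: n Z => // n Z _ sZ.
pose S := [set fip u (Z *m u) | u in [set u : 'cV[R]_n.+1 | fn2 u = 1]].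
have S0 : S !=set0.
  exists (fip (delta_mx 0 0 : 'cV_n.+1) (Z *m delta_mx 0 0)).
  by exists (delta_mx 0 0) => //=; rewrite fip_cV trmx_delta mul_delta_mx mxE.
pose c := Num.sqrt (fn2 Z).
have Zc (u : 'cV[R]_n.+1) : - c * fn2 u <= fip u (Z *m u).
  have := fip_opb (- u) u (sqrtr_ge0 _) (opb_fn2 Z).
  rewrite !fipNl fipNr opprK -expr2 sqr_sqrtr ?fn2_ge0// -/c; lra.
have lS : has_lbound S.
  by exists (- c) => _ [u /= u1 <-]; have := Zc u; rewrite u1 mulr1.
set l := inf S.
have Zl : lge Z l.
  move=> u; have [->|u0] := eqVneq u 0; first by rewrite mulmx0 fip0r mulr0.
  have up := fn2_gt0 u0; have up' : 0 < Num.sqrt (fn2 u) by rewrite sqrtr_gt0.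
  pose v := (Num.sqrt (fn2 u))^-1 *: u.
  have : l <= fip v (Z *m v).
    apply: (ge_inf lS); exists v => //=; rewrite fipZl fipZr mulrA -expr2 exprVn.
    by rewrite sqr_sqrtr ?ltW// mulVf ?gt_eqF.
  rewrite -scalemxAr fipZl fipZr mulrA -expr2 exprVn sqr_sqrtr ?(ltW up)//.
  by rewrite ler_pdivlMl// mulrC.
exists l => //; pose Z' := Z - l%:M.
have Z'E (u : 'cV[R]_n.+1) : fip u (Z' *m u) = fip u (Z *m u) - l * fn2 u.
  by rewrite mulmxBl fipBr mul_scalar_mx fipZr.
have pZ' : possemidef Z'.
  apply/psdE; split; first by rewrite linearB /= tr_scalar_mx sZ.
  by move=> u; rewrite mul0r Z'E subr_ge0.
rewrite /eigenvalue /eigenspace -/Z' kermx_eq0 row_free_unit.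
apply/negP => uZ; have [e e0 He] := unit_psd_lge pZ' uZ.
have : l + e <= l.
  apply: lb_le_inf => // _ [u /= u1 <-].
  by have := He u; rewrite Z'E u1 !mulr1; lra.
by rewrite gerDl leNgt e0.
Qed.

Lemma eigenvalue_cV n (Z : 'M[R]_n) l : Z^T = Z -> eigenvalue Z l ->
  exists2 u : 'cV[R]_n, u != 0 & Z *m u = l *: u.
Proof.
move=> sZ /eigenvalueP[v vZ v0]; exists v^T.
  by rewrite -(inj_eq trmx_inj) trmxK trmx0.
by rewrite -[Z]sZ -trmx_mul vZ linearZ.
Qed.

Lemma eigenvalueN n (Z : 'M[R]_n) l : eigenvalue (- Z) l -> eigenvalue Z (- l).
Proof.
move=> /eigenvalueP[v vZ v0]; apply/eigenvalueP; exists v => //.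
by rewrite scaleNr -vZ mulmxN opprK.
Qed.

Lemma rayleigh_max n (Z : 'M[R]_n) : (0 < n)%N -> Z^T = Z ->
  exists2 l, eigenvalue Z l & lle Z l.
Proof.
move=> n0 sZ; have [|l /eigenvalueN lZ Zl] := @rayleigh_min n (- Z) n0.
  by rewrite linearN /= sZ.
by exists (- l) => // u; have := Zl u; rewrite mulNmx fipNr; lra.
Qed.

(** If [l] is the largest eigenvalue of X^T X, then its root is a singular value and bounds all the
    others, so the supremum is a true one and dominates the root. *)
Lemma sigma_max_opb p q (X : 'M[R]_(p, q)) : (0 < q)%N -> opb X (sigma_max X).
Proof.
move=> q0; have sX : (X^T *m X)^T = X^T *m X by rewrite trmx_mul trmxK.
have [l lZ Zl] := rayleigh_max q0 sX.
have XE (u : 'cV[R]_q) : fip u (X^T *m X *m u) = fn2 (X *m u).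
  by rewrite -mulmxA -fip_mull.
have l0 : 0 <= l.
  have [u u0 Zu] := eigenvalue_cV sX lZ.
  have := fn2_ge0 (X *m u); rewrite -XE Zu fipZr.
  by rewrite pmulr_lge0// fn2_gt0.
have ub s : singular_values X s -> s <= Num.sqrt l.
  move=> [s0 /(eigenvalue_cV sX)[u u0 Zu]].
  have := Zl u; rewrite Zu fipZr ler_pM2r ?fn2_gt0// => sl.
  by rewrite -[s]ger0_norm// -sqrtr_sqr ler_wsqrtr.
have sl : singular_values X (Num.sqrt l).
  by split; [exact: sqrtr_ge0|rewrite sqr_sqrtr].
have le_l : Num.sqrt l <= sigma_max X by apply: ub_le_sup => //; exists (Num.sqrt l).
move=> u; rewrite -XE; apply: le_trans (Zl u) _.
rewrite ler_wpM2r ?fn2_ge0// -[leLHS](sqr_sqrtr l0).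
by rewrite ler_pXn2r// nnegrE ?(le_trans _ le_l) ?sqrtr_ge0.
Qed.

Lemma sigma_max_ge0 p q (X : 'M[R]_(p, q)) : 0 <= sigma_max X.
Proof.
(* Without a true supremum [sup] takes the default value 0. *)
have [sX|/sup_out] := pselect (has_sup (singular_values X)); last first.
  by rewrite /sigma_max => ->.
have [[s Xs] bX] := sX; have [s0 _] := Xs.
by apply: le_trans s0 (ub_le_sup bX _).
Qed.

(** For a semidefinite [X] the least eigenvalue is itself a singular value, so the infimum lies
    below it. *)
Lemma sigma_min_lge n (X : 'M[R]_n) : (0 < n)%N -> possemidef X ->
  lge X (sigma_min X).
Proof.
move=> n0 pX; have [l lX Xl] := rayleigh_min n0 (psd_sym pX).
have l0 : 0 <= l.
  have [u u0 Xu] := eigenvalue_cV (psd_sym pX) lX.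
  have := psd_lge0 pX u; rewrite mul0r Xu fipZr.
  by rewrite pmulr_lge0// fn2_gt0.
have sl : singular_values X l.
  split=> //; have /eigenvalueP[v vX v0] := lX; apply/eigenvalueP; exists v => //.
  by rewrite psd_sym// mulmxA vX -scalemxAl vX scalerA.
have le_l : sigma_min X <= l by apply: ge_inf => //; exists 0 => s [].
by move=> u; apply: le_trans (Xl u); rewrite ler_wpM2r ?fn2_ge0.
Qed.

Lemma sigma_min_gt0 n (X : 'M[R]_n) : (0 < n)%N -> posdef X -> 0 < sigma_min X.
Proof.
move=> n0 dX; have pX := posdef_psd dX; have [c c0 Xc] := posdef_lge dX.
apply: (lt_le_trans c0); apply: lb_le_inf.
  have [l lX Xl] := rayleigh_min n0 (psd_sym pX); exists l; split.
    have [u u0 Xu] := eigenvalue_cV (psd_sym pX) lX.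
    have := psd_lge0 pX u; rewrite mul0r Xu fipZr.
    by rewrite pmulr_lge0// fn2_gt0.
  have /eigenvalueP[v vX v0] := lX; apply/eigenvalueP; exists v => //.
  by rewrite psd_sym// mulmxA vX -scalemxAl vX scalerA.
move=> s [s0 sX].
have [|u u0 Xu] := eigenvalue_cV _ sX; first by rewrite trmx_mul trmxK.
have := lge_inv u (ltW c0) Xc.
have -> : fn2 (X *m u) = s ^+ 2 * fn2 u by rewrite fip_mull mulmxA Xu fipZr.
by rewrite ler_pM2r ?fn2_gt0// ler_pXn2r// nnegrE ltW.
Qed.

End SingularValues.

(** * The Riccati recursion and its adjoint *)

Section Riccati.
Variables (R : realType) (M N m : nat) (S : linear_system R N m).
Local Notation A := (sysA S).
Local Notation C := (sysC S).
Local Notation Q := (procQ S).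
Local Notation V := (measR S).
Implicit Types K : gain R M N m.

Definition closed_loop K t : 'M[R]_N := A - gain_at K t *m (C *m A).

(** The Joseph form of the covariance update: it holds for every gain, not only the Kalman gain, and
    is visibly semidefinite. *)
Fixpoint err_cov K t : 'M[R]_N :=
  match t with
  | 0%N => init_cov S
  | t'.+1 => (1%:M - gain_at K t' *m C) *m (A *m err_cov K t' *m A^T + Q t')
               *m (1%:M - gain_at K t' *m C)^T
             + gain_at K t' *m V t'.+1 *m (gain_at K t')^T
  end.

Definition pred_cov K t : 'M[R]_N := A *m err_cov K t *m A^T + Q t.
Definition innov_cov K t : 'M[R]_m := C *m pred_cov K t *m C^T + V t.+1.
(** Its vanishing is the equation of the Kalman gain. *)
Definition residual K t : 'M[R]_(N, m) :=
  gain_at K t *m innov_cov K t - pred_cov K t *m C^T.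

Definition riccati_cost K : R :=
  \sum_(0 <= t < M) \tr (err_cov K t.+1 *m Sigma S).

(** [k] is the number of steps left to the horizon, which makes the backward recursion
    structural. *)
Fixpoint adjoint K k t : 'M[R]_N :=
  match k with
  | 0%N => Sigma S
  | k'.+1 => Sigma S + (closed_loop K t)^T *m adjoint K k' t.+1 *m closed_loop K t
  end.

(* The multiplier of the constraint defining [err_cov K t]. *)
Definition multiplier K t := adjoint K (M - t) t.

Lemma mxaddE p q (X Z : 'M[R]_(p, q)) i j : (X + Z) i j = X i j + Z i j.
Proof. by rewrite mxE. Qed.
Lemma mxoppE p q (X : 'M[R]_(p, q)) i j : (- X) i j = - X i j.
Proof. by rewrite mxE. Qed.

Lemma err_covS K t : err_cov K t.+1 =
  (1%:M - gain_at K t *m C) *m pred_cov K t *m (1%:M - gain_at K t *m C)^T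
  + gain_at K t *m V t.+1 *m (gain_at K t)^T.
Proof. by []. Qed.

Lemma adjointS K k t : adjoint K k.+1 t =
  Sigma S + (closed_loop K t)^T *m adjoint K k t.+1 *m closed_loop K t.
Proof. by []. Qed.

Ltac mxabel := apply/matrixP => ? ?; rewrite !(mxaddE, mxoppE); ring.

Lemma trmxD p q (X Z : 'M[R]_(p, q)) : (X + Z)^T = X^T + Z^T.
Proof. exact: linearD. Qed.
Lemma trmxN p q (X : 'M[R]_(p, q)) : (- X)^T = - X^T.
Proof. exact: linearN. Qed.

Hypothesis sP0 : (init_cov S)^T = init_cov S.
Hypothesis sQ : forall t, (Q t)^T = Q t.
Hypothesis sV : forall t, (V t)^T = V t.

Lemma err_cov_sym K t : (err_cov K t)^T = err_cov K t.
Proof.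
elim: t => [//|t IH] /=.
by rewrite !(trmxD, trmxN, trmx_mul, trmxK, sQ, sV, IH) !mulmxA.
Qed.

Lemma pred_cov_sym K t : (pred_cov K t)^T = pred_cov K t.
Proof. by rewrite !(trmxD, trmx_mul, trmxK, sQ, err_cov_sym) !mulmxA. Qed.

Lemma innov_cov_sym K t : (innov_cov K t)^T = innov_cov K t.
Proof. by rewrite /innov_cov !(pred_cov_sym, sV, trmxK, trmx_mul, trmxD) !mulmxA. Qed.

Lemma Sigma_sym : (Sigma S)^T = Sigma S.
Proof.
rewrite /Sigma raddf_sum; apply: eq_bigr => i _.
by rewrite /= trmx_mul trmxK.
Qed.

Lemma adjoint_sym K k t : (adjoint K k t)^T = adjoint K k t.
Proof.
elim: k t => [|k IH] t /=; first exact: Sigma_sym.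
by move: (closed_loop K t) => H; rewrite !(IH, Sigma_sym, trmxK, trmx_mul, trmxD) !mulmxA.
Qed.

Lemma multiplier_sym K t : (multiplier K t)^T = multiplier K t.
Proof. exact: adjoint_sym. Qed.

Lemma multiplier_last K : multiplier K M = Sigma S.
Proof. by rewrite /multiplier subnn. Qed.

Lemma multiplier_rec K t : (t < M)%N -> multiplier K t =
  Sigma S + (closed_loop K t)^T *m multiplier K t.+1 *m closed_loop K t.
Proof. by move=> tM; rewrite /multiplier -(subnSK tM). Qed.

Lemma err_cov_rec K t : err_cov K t.+1 =
  closed_loop K t *m err_cov K t *m (closed_loop K t)^T +
  ((1%:M - gain_at K t *m C) *m Q t *m (1%:M - gain_at K t *m C)^T
   + gain_at K t *m V t.+1 *m (gain_at K t)^T).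
Proof.
have HF : closed_loop K t = (1%:M - gain_at K t *m C) *m A.
  by rewrite /closed_loop mulmxBl mul1mx mulmxA.
rewrite HF /=; move: (1%:M - _) => F.
by rewrite trmx_mul mulmxDr mulmxDl addrA !mulmxA.
Qed.

Lemma err_cov_expand K t : err_cov K t.+1 =
  pred_cov K t - gain_at K t *m C *m pred_cov K t
  - pred_cov K t *m C^T *m (gain_at K t)^T
  + gain_at K t *m innov_cov K t *m (gain_at K t)^T.
Proof.
rewrite /= -/(pred_cov K t) /innov_cov; set X := pred_cov K t.
rewrite !(trmxD, trmxN, trmx_mul, trmx1) !(mulmxDl, mulmxDr, mulNmx, mulmxN).
rewrite !(mul1mx, mulmx1) !mulmxA; mxabel.
Qed.

(** For a fixed prior covariance the update is a quadratic polynomial in the gain, so its expansion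
    at the gain of [K] is exact; the change of the prior covariance is carried by the closed loop of
    [K']. *)
Lemma err_cov_diff K K' t : let D := gain_at K' t - gain_at K t in
  err_cov K' t.+1 - err_cov K t.+1 =
  closed_loop K' t *m (err_cov K' t - err_cov K t) *m (closed_loop K' t)^T +
  (D *m (residual K t)^T + residual K t *m D^T + D *m innov_cov K t *m D^T).
Proof.
move=> D.
have -> : err_cov K' t.+1 = closed_loop K' t *m (err_cov K' t - err_cov K t)
     *m (closed_loop K' t)^T +
   (pred_cov K t - gain_at K' t *m C *m pred_cov K t
  - pred_cov K t *m C^T *m (gain_at K' t)^T
  + gain_at K' t *m innov_cov K t *m (gain_at K' t)^T).
  rewrite err_cov_expand /innov_cov /pred_cov /closed_loop.
  rewrite !(trmxD, trmxN, trmx_mul, trmx1) !(mulmxDl, mulmxDr, mulNmx, mulmxN).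
  rewrite !mulmxA; mxabel.
rewrite err_cov_expand /D /residual; set X := pred_cov K t; set W := innov_cov K t.
have sX : X^T = X by exact: pred_cov_sym.
have sW : W^T = W by exact: innov_cov_sym.
rewrite !(sX, sW, trmxK, trmx_mul, trmxN, trmxD) !(mulmxDl, mulmxDr, mulNmx, mulmxN).
rewrite !mulmxA; mxabel.
Qed.

(** Summation by parts of the traces of multiplier times [D], between the forward recursion for [D]
    and the backward one for the multipliers. The cost starts at time 1, so [Sigma S] is removed
    from the weight of [D 0]. *)
Lemma multiplier_telescope K (D B : nat -> 'M[R]_N) :
  (forall t, D t.+1 = closed_loop K t *m D t *m (closed_loop K t)^T + B t) ->
  \sum_(0 <= t < M) \tr (D t.+1 *m Sigma S) =
  \sum_(0 <= t < M) \tr (multiplier K t.+1 *m B t)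
  + \tr ((multiplier K 0 - Sigma S) *m D 0%N).
Proof.
move=> DB; have [M0|M0] := posnP M.
  rewrite {1 2}M0 !big_nil /multiplier M0 subnn /= subrr mul0mx mxtrace0; lra.
have step t : (t < M)%N -> \tr (multiplier K t.+1 *m B t) =
  (\tr (multiplier K t.+1 *m D t.+1) - \tr (multiplier K t *m D t))
  + \tr (D t *m Sigma S).
  move=> tM; rewrite DB (multiplier_rec K tM).
  move: (closed_loop K t) (multiplier K t.+1) (D t) => H Y Z.
  have -> : \tr ((Sigma S + H^T *m Y *m H) *m Z) =
      \tr (Z *m Sigma S) + \tr (Y *m (H *m Z *m H^T)).
    rewrite mulmxDl mxtraceD (mxtrace_mulC (Sigma S)) -!mulmxA.
    by rewrite (mxtrace_mulC H^T) !mulmxA.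
  by rewrite mulmxDr mxtraceD; ring.
rewrite [in RHS](eq_big_nat _ _ (F2 := fun t =>
  (\tr (multiplier K t.+1 *m D t.+1) - \tr (multiplier K t *m D t))
  + \tr (D t *m Sigma S))); last by move=> t /andP[_ /step].
rewrite big_split /= telescope_sumr// multiplier_last mulmxBl mxtraceD.
rewrite -(prednK M0) big_nat_recr//= [in RHS]big_nat_recl//= prednK//.
rewrite (mxtrace_mulC (Sigma S)) linearN /= (mxtrace_mulC (Sigma S)); ring.
Qed.

(** The covariance difference obeys a recursion driven by the closed loop of [K'], so the
    multipliers are those of [K'], while residuals and innovation covariances are those of [K]. Both
    covariances start at [init_cov S], so no boundary term remains. *)
Lemma cost_diff K K' : riccati_cost K' - riccati_cost K =
  \sum_(0 <= t < M)
    (2 * fip (multiplier K' t.+1 *m residual K t) (gain_at K' t - gain_at K t)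
     + fip (gain_at K' t - gain_at K t)
         (multiplier K' t.+1 *m (gain_at K' t - gain_at K t) *m innov_cov K t)).
Proof.
rewrite /riccati_cost -sumrB.
under eq_bigr do rewrite -raddfB -mulmxBl /=.
rewrite (multiplier_telescope (fun t => err_cov_diff K K' t)) subrr mulmx0 mxtrace0.
rewrite addr0; apply: eq_bigr => t _; set D := _ - _; set Y := multiplier _ _.
set E := residual _ _; set W := innov_cov _ _.
have sY : Y^T = Y by exact: multiplier_sym.
have H1 : \tr (Y *m (E *m D^T)) = fip (Y *m E) D.
  by rewrite fipC /fip mulmxA mxtrace_mulC.
have H2 : \tr (Y *m (D *m E^T)) = fip (Y *m E) D.
  by rewrite -mxtrace_tr !trmx_mul trmxK sY mxtrace_mulC H1.
have H3 : \tr (Y *m (D *m W *m D^T)) = fip D (Y *m D *m W).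
  by rewrite /fip mulmxA mxtrace_mulC !mulmxA.
by rewrite mulmxDr mxtraceD (mulmxDr Y (D *m _)) mxtraceD H1 H2 H3; ring.
Qed.

End Riccati.
Arguments err_cov : simpl never.
Arguments adjoint : simpl never.

Lemma min_upto_le (R : realType) (M t : nat) (F : nat -> R) :
  (t < M)%N -> min_upto M F <= F t.
Proof. by move=> tM; rewrite /min_upto big_mkord (bigmin_le _ (Ordinal tM) (fun i : 'I_M => F i)). Qed.

Lemma min_upto_gt0 (R : realType) (M : nat) (F : nat -> R) :
  (forall t, 0 < F t) -> 0 < min_upto M F.
Proof.
move=> F0; rewrite /min_upto; elim/big_ind: _ => // x y x0 y0.
by rewrite lt_min x0.
Qed.

Lemma max_upto_ge (R : realType) (M t : nat) (F : nat -> R) :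
  (t < M)%N -> F t <= max_upto M F.
Proof. by move=> tM; rewrite /max_upto big_mkord (le_bigmax _ (fun i : 'I_M => F i) (Ordinal tM)). Qed.

Lemma trace_le_lle (R : realType) n (X : 'M[R]_n) c : lle X c -> \tr X <= n%:R * c.
Proof.
move=> Xc; rewrite /mxtrace.
apply: (@le_trans _ _ (\sum_(i < n) c)).
  apply: ler_sum => i _; have := Xc (delta_mx i 0).
  by rewrite !fip_cV !trmx_delta mul_delta_mx -colE -rowE !mxE !eqxx mulr1.
by rewrite sumr_const card_ord mulr_natl.
Qed.

Lemma lge_scalar (R : realType) n (X : 'M[R]_n) c : X^T = X -> lge X c ->
  possemidef (X - c%:M).
Proof.
move=> sX Xc; apply/psdE; split; first by rewrite linearB /= tr_scalar_mx sX.
by move=> u; rewrite mul0r mulmxBl fipBr mul_scalar_mx fipZr subr_ge0.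
Qed.

Lemma psd_trace_lge (R : realType) n (X Z : 'M[R]_n) c :
  possemidef X -> Z^T = Z -> lge Z c -> c * \tr X <= \tr (X *m Z).
Proof.
move=> pX sZ Zc; have := psd_tr_ge0 pX (lge_scalar sZ Zc).
by rewrite mulmxBr mul_mx_scalar raddfB /= mxtraceZ subr_ge0.
Qed.

Lemma psd_trace_ge0 (R : realType) n (X : 'M[R]_n) : possemidef X -> 0 <= \tr X.
Proof.
move=> /psd_lge0 pX; apply: sumr_ge0 => i _; have := pX (delta_mx i 0).
by rewrite !fip_cV !trmx_delta mul_delta_mx -colE -rowE !mxE mul0r.
Qed.

Lemma lgeD (R : realType) n (X Z : 'M[R]_n) c d :
  lge X c -> lge Z d -> lge (X + Z) (c + d).
Proof. by move=> Xc Zd u; rewrite mulmxDl fipDr mulrDl lerD. Qed.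

Lemma lleD (R : realType) n (X Z : 'M[R]_n) c d :
  lle X c -> lle Z d -> lle (X + Z) (c + d).
Proof. by move=> Xc Zd u; rewrite mulmxDl fipDr mulrDl lerD. Qed.

Lemma lle_le (R : realType) n (X : 'M[R]_n) c d : c <= d -> lle X c -> lle X d.
Proof.
by move=> cd Xc u; apply: le_trans (Xc u) _; rewrite ler_wpM2r ?fn2_ge0.
Qed.

Lemma lge_le (R : realType) n (X : 'M[R]_n) c d : d <= c -> lge X c -> lge X d.
Proof.
by move=> cd Xc u; apply: le_trans (Xc u); rewrite ler_wpM2r ?fn2_ge0.
Qed.

Lemma lle_congr (R : realType) n p (X : 'M[R]_n) (Z : 'M[R]_(p, n)) c d :
  0 <= d -> lle X d -> opb Z c -> lle (Z *m X *m Z^T) (c ^+ 2 * d).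
Proof.
move=> d0 Xd Zc u; rewrite -!mulmxA fipC fip_mull fipC.
apply: le_trans (Xd _) _; rewrite [leRHS]mulrAC [leRHS]mulrC ler_wpM2l//.
exact: opb_tr.
Qed.

Lemma posdef_congr (R : realType) n (X Z : 'M[R]_n) :
  posdef X -> Z \in unitmx -> posdef (Z *m X *m Z^T).
Proof.
move=> [sX dX] uZ; split; first by rewrite !trmx_mul trmxK sX mulmxA.
move=> u u0; have : Z^T *m u != 0.
  apply: contra u0 => /eqP Zu; have uZT : Z^T \in unitmx by rewrite unitmx_tr.
  by rewrite -(mulKmx uZT u) Zu mulmx0.
by move=> /dX; rewrite trmx_mul trmxK !mulmxA.
Qed.

Lemma fip_psd_lge (R : realType) n p (Y : 'M[R]_n) (W : 'M[R]_p) (D : 'M[R]_(n, p)) a :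
  possemidef Y -> W^T = W -> lge W a -> a * fip D (Y *m D) <= fip D (Y *m D *m W).
Proof.
move=> pY sW Wa; have pD : possemidef (D^T *m Y *m D).
  by have := psd_congr D^T pY; rewrite trmxK.
by have := psd_trace_lge pD sW Wa; rewrite /fip !mulmxA.
Qed.

(** The right-hand side is the form of [Y] at a D + E. *)
Lemma psd_young (R : realType) n p (Y : 'M[R]_n) (D E : 'M[R]_(n, p)) a :
  possemidef Y ->
  0 <= a * (a * fip D (Y *m D) + 2 * fip (Y *m E) D) + fip E (Y *m E).
Proof.
move=> pY; have := lge_mx (a *: D + E) (psd_lge0 pY); rewrite mul0r.
rewrite mulmxDr -scalemxAr !fipDl !fipDr !fipZl !fipZr.
have -> : fip E (Y *m D) = fip (Y *m E) D by rewrite fip_mull psd_sym.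
rewrite (fipC D (Y *m E)) => /le_trans; apply.
by rewrite le_eqVlt; apply/orP; left; apply/eqP; ring.
Qed.

Lemma fip_psd_lle (R : realType) n p (Y : 'M[R]_n) (W : 'M[R]_p) (D : 'M[R]_(n, p)) a :
  possemidef Y -> W^T = W -> lle W a -> fip D (Y *m D *m W) <= a * fip D (Y *m D).
Proof.
move=> pY sW Wa; have := @fip_psd_lge _ _ _ Y (- W) D (- a) pY.
rewrite linearN /= sW mulmxN fipNr mulNr lerN2; apply=> // u.
by rewrite mulNmx fipNr mulNr lerN2.
Qed.

Lemma sum_sqr_le (R : realType) (M : nat) (x : nat -> R) :
  (\sum_(0 <= t < M) x t) ^+ 2 <= M%:R * \sum_(0 <= t < M) x t ^+ 2.
Proof.
have := fip_CS (const_mx 1 : 'cV[R]_M) (\col_(i < M) x i).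
rewrite !fipE !big_ord1 !big_mkord.
under eq_bigr do rewrite !mxE mul1r.
under [X in _ <= X * _ -> _]eq_bigr do rewrite !mxE mul1r.
under [X in _ <= _ * X -> _]eq_bigr do rewrite !mxE -expr2.
by rewrite sumr_const card_ord.
Qed.

(** * Gradient domination and descent *)

(** Scalar majorant of the adjoint recursion when the closed loop at time [t] has norm at most [r t]
    and [Sigma S] has norm at most [s]. *)
Fixpoint adj_bound (R : realType) (s : R) (r : nat -> R) k t : R :=
  match k with
  | 0%N => s
  | k'.+1 => s + r t ^+ 2 * adj_bound s r k' t.+1
  end.

Lemma adj_bound_ge (R : realType) (s : R) r k t : 0 <= s -> s <= adj_bound s r k t.
Proof.
move=> s0; elim: k t => [|k IH] t //=.
by rewrite lerDl mulr_ge0 ?sqr_ge0// (le_trans s0).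
Qed.

Lemma adj_bound_le (R : realType) (s : R) r r' k t : 0 <= s ->
  (forall t, 0 <= r t <= r' t) -> adj_bound s r k t <= adj_bound s r' k t.
Proof.
move=> s0 rr'; elim: k t => [|k IH] t //=; rewrite lerD2l.
have /andP[r0 rt] := rr' t.
rewrite ler_pM ?sqr_ge0 ?(le_trans s0 (adj_bound_ge _ _ _ s0))//.
by rewrite ler_pXn2r// nnegrE (le_trans r0).
Qed.

(** The geometric sum behind the quotient (rho^(2M) - 1)/(rho^2 - 1) of [c3]. *)
Lemma adj_bound_cst (R : realType) (s rho : R) k t :
  (rho ^+ 2 - 1) * adj_bound s (fun=> rho) k t = s * (rho ^+ (2 * k.+1) - 1).
Proof.
elim: k t => [|k IH] t /=; first by rewrite muln1; ring.
by rewrite mulrDr mulrCA IH (mulnS _ k.+1) exprD; ring.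
Qed.

(* [1 + x <= (1 - X) / (1 - X - x)] turns the product of the factors
   [1 + d t / rho] into the inverse of one minus their sum. *)
Lemma adj_bound_ratio (R : realType) (s rho : R) (d : nat -> R) k t :
  0 <= s -> 0 < rho -> (forall t, 0 <= d t) ->
  \sum_(t <= j < t + k) d j < rho ->
  adj_bound s (fun t => rho + d t) k t - s <=
  (adj_bound s (fun=> rho) k t - s) /
    (1 - (\sum_(t <= j < t + k) d j) / rho) ^+ 2.
Proof.
move=> s0 rho0 d0; elim: k t => [|k IH] t /=.
  by rewrite addn0 big_geq// mul0r subr0 expr1n divr1.
rewrite addnS big_ltn ?ltnS ?leq_addr// -addSn => Xlt.
have X0 : 0 <= \sum_(t.+1 <= j < t.+1 + k) d j by rewrite sumr_ge0.
set X := \sum_(_ <= _ < _) _ in Xlt X0 *.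
have Xlt' : X < rho by apply: le_lt_trans Xlt; rewrite lerDr.
have {IH} := IH t.+1 Xlt'; rewrite -/X.
set y' := adj_bound _ _ _ _; set y := adj_bound _ _ _ _ => H.
have ys : s <= y by exact: adj_bound_ge.
have x0 : 0 <= X / rho by rewrite divr_ge0// ltW.
have x1 : X / rho < 1 by rewrite ltr_pdivrMr// mul1r.
have z0 : 0 <= d t / rho by rewrite divr_ge0// ltW.
have z1 : d t / rho + X / rho < 1 by rewrite -mulrDl ltr_pdivrMr// mul1r.
rewrite (mulrDl (d t) X); set x := X / rho in H x0 x1 z1 *; set z := d t / rho in z0 z1 *.
have -> : d t = rho * z by rewrite mulrCA divff ?gt_eqF// mulr1.
(* As 1/(1 - x)^2 >= 1, the [s] subtracted on both sides of the induction hypothesis can be put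
   back. *)
have H2 : y' <= y / (1 - x) ^+ 2.
  have : s <= s / (1 - x) ^+ 2.
    rewrite ler_peMr// -[leLHS]invr1 lef_pV2 ?posrE ?exprn_gt0 ?subr_gt0//.
    by rewrite expr_le1// ?subr_ge0 ?(ltW x1)// gerBl.
  by rewrite mulrBl in H; lra.
have addsK u : s + u - s = u by ring.
rewrite !addsK.
have -> : (rho + rho * z) ^+ 2 = rho ^+ 2 * (1 + z) ^+ 2 by ring.
rewrite -mulrA -[leRHS]mulrA ler_wpM2l ?sqr_ge0//.
apply: le_trans (ler_wpM2l (sqr_ge0 _) H2) _.
rewrite mulrCA ler_wpM2l ?(le_trans s0)//.
rewrite -expr_div_n -exprVn ler_pXn2r// ?nnegrE ?divr_ge0 ?invr_ge0 ?subr_ge0 ?(ltW x1) ?(ltW z1)//; last lra.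
rewrite ler_pdivrMr ?subr_gt0// mulrC ler_pdivlMr ?subr_gt0//.
rewrite -subr_ge0; have -> : 1 - x - (1 + z) * (1 - (z + x)) = z * (z + x) by ring.
by rewrite mulr_ge0// addr_ge0.
Qed.

(** [G] stands for the norm of Sigma times the geometric quotient, and [X] for the total change of
    the closed loops divided by [rho]. In 21/20 the unit is what [c3] grants to the exact gradient
    step, and 1/20 is left for the sampling error. Since (2 rho + 1) rho >= 3, it follows that X G
    <= 7/40 mn, hence X <= 7/40. *)
Lemma perturb_num (R : realFieldType) (mn rho G X : R) :
  0 < mn -> mn <= G -> 1 <= rho -> 0 <= X ->
  2 * G * (2 * rho + 1) * (X * rho) <= 21 / 20 * mn ->
  X < 1 /\ ((1 - X) ^- 2 - 1) * G <= mn / 2.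
Proof.
move=> mn0 mnG rho1 X0 H.
have G0 : 0 < G by exact: lt_le_trans mnG.
have H1 : 6 * (X * G) <= 21 / 20 * mn.
  apply: le_trans H; rewrite -subr_ge0.
  have -> : 2 * G * (2 * rho + 1) * (X * rho) - 6 * (X * G) =
    2 * (X * G) * ((2 * rho + 3) * (rho - 1)) by ring.
  by apply: mulr_ge0; [apply: mulr_ge0 => //; exact/mulr_ge0/ltW|apply: mulr_ge0; lra].
have X1 : X <= 7 / 40.
  have : X * mn <= 7 / 40 * mn by have := ler_wpM2l X0 mnG; lra.
  by rewrite ler_pM2r.
split; first lra.
have -> : ((1 - X) ^- 2 - 1) * G = (X * G) * (2 - X) / (1 - X) ^+ 2.
  by field; rewrite gt_eqF//; lra.
rewrite ler_pdivrMr ?exprn_gt0//; last lra.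
have H2 : X * G * (2 - X) <= 7 / 40 * mn * (2 - X).
  by rewrite ler_wpM2r//; lra.
apply: le_trans H2 _; rewrite -subr_ge0.
have -> : mn / 2 * (1 - X) ^+ 2 - 7 / 40 * mn * (2 - X) =
  mn * (X ^+ 2 / 2 + (7 / 40 - X) * (33 / 40) + 9 / 1600) by field.
by apply: mulr_ge0; [exact: ltW|have := sqr_ge0 X; lra].
Qed.

(* One gradient step [D = - eta (a + g)], where [g] is the sampling error. *)
Lemma step_term (R : realType) n p (Y Y' : 'M[R]_n) (W : 'M[R]_p)
    (E g : 'M[R]_(n, p)) (B w kap sg eta : R) :
  0 <= B -> 0 <= w -> 0 < sg -> 0 <= kap -> 0 <= eta -> kap <= sg / 2 ->
  kap <= 1 / 2 -> eta * (4 * w * (1 / 2 + B)) <= 1 ->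
  opb Y B -> lge Y sg -> opb (Y' - Y) kap -> opb W w -> W^T = W ->
  let a := 2 *: (Y *m E) in let D := - (eta *: (a + g)) in
  (2 * fip (Y' *m E) D + fip D (Y' *m D *m W) <=
    - eta * (3 / 16 * fn2 a - 65 / 4 * fn2 g) : Prop).
Proof.
move=> B0 w0 sg0 kap0 eta0 kap_sg kap1 etaw YB Ysg Ykap Ww sW a D.
set al := Num.sqrt (fn2 a); set ga := Num.sqrt (fn2 g).
have al0 : 0 <= al by exact: sqrtr_ge0.
have ga0 : 0 <= ga by exact: sqrtr_ge0.
have alE : fn2 a = al ^+ 2 by rewrite sqr_sqrtr ?fn2_ge0.
have gaE : fn2 g = ga ^+ 2 by rewrite sqr_sqrtr ?fn2_ge0.
set X := (Y' - Y) *m E.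
have YEX : Y' *m E = 2^-1 *: a + X.
  by rewrite /X mulmxBl /a scalerA mulVf ?pnatr_eq0// scale1r addrC subrK.
(* The change of the multiplier is absorbed by the gradient: |X| <= kap |E| <= sg |E|/2 <= |Y E|/2 =
   |a|/4. *)
have Xal : Num.sqrt (fn2 X) <= al / 4.
  rewrite -[leRHS]ger0_norm ?divr_ge0// -sqrtr_sqr ler_wsqrtr//.
  apply: le_trans (opb_mx E Ykap) _.
  have H1 := lge_inv E (ltW sg0) Ysg.
  have H2 : kap ^+ 2 * fn2 E <= (sg / 2) ^+ 2 * fn2 E.
    by rewrite ler_wpM2r ?fn2_ge0// ler_pXn2r ?nnegrE// divr_ge0// ltW.
  apply: le_trans H2 _; rewrite !expr_div_n -alE /a fipZl fipZr.
  lra.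
clearbody X a.
have T1 : fip (Y' *m E) D <= - eta * (al ^+ 2 / 4 - 3 / 4 * al * ga).
  rewrite /D fipNr fipZr mulNr lerN2 ler_wpM2l// YEX !fipDl !fipDr !fipZl alE.
  have h1 : - (al * ga) <= fip a g.
    have := fip_le_sqrt (- a) g; rewrite !fipNl fipNr opprK -/al -/ga; lra.
  have h2 : - (al / 4 * al) <= fip X a.
    have := fip_le_sqrt (- X) a; rewrite !fipNl fipNr opprK -/al.
    by have := ler_wpM2r al0 Xal; lra.
  have h3 : - (al / 4 * ga) <= fip X g.
    have := fip_le_sqrt (- X) g; rewrite !fipNl fipNr opprK -/ga.
    by have := ler_wpM2r ga0 Xal; lra.
  lra.
have agn : fn2 (a + g) <= (al + ga) ^+ 2.
  rewrite -[leLHS]sqr_sqrtr ?fn2_ge0// ler_pXn2r ?nnegrE ?sqrtr_ge0 ?addr_ge0//.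
  exact: sqrt_fn2D.
have Y'B : opb Y' (B + kap).
  by rewrite -[Y'](subrK Y) addrC; apply: opbD => //; rewrite addrC.
(* Here [kap <= 1 / 2] turns the bound [B] of [Y] into the factor 1/2 + B of [c4]. *)
have T2 : fip D (Y' *m D *m W) <= eta * ((al + ga) ^+ 2 / 4).
  have -> : fip D (Y' *m D *m W) = eta ^+ 2 * fip (a + g) (Y' *m (a + g) *m W).
    rewrite /D mulmxN mulNmx !fipNr fipNl opprK -scalemxAr -scalemxAl.
    by rewrite fipZl fipZr mulrA.
  have h : fip (a + g) (Y' *m (a + g) *m W) <= (B + kap) * w * fn2 (a + g).
    rewrite -mulmxA; apply: le_trans (fip_opb _ _ _ Y'B) _; first exact: addr_ge0.
    rewrite -mulrA ler_wpM2l ?addr_ge0//.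
    have : Num.sqrt (fn2 ((a + g) *m W)) <= w * Num.sqrt (fn2 (a + g)).
      rewrite -[leRHS]ger0_norm ?mulr_ge0 ?sqrtr_ge0// -sqrtr_sqr ler_wsqrtr//.
      rewrite exprMn sqr_sqrtr ?fn2_ge0// -fn2_tr trmx_mul sW -(fn2_tr (a + g)).
      exact: opb_mx.
    move=> /(ler_wpM2l (sqrtr_ge0 (fn2 (a + g)))) /le_trans; apply.
    by rewrite mulrCA -expr2 sqr_sqrtr ?fn2_ge0.
  have c0 : 0 <= (B + kap) * w by rewrite mulr_ge0// addr_ge0.
  apply: (@le_trans _ _ (eta * (eta * ((B + kap) * w) * (al + ga) ^+ 2))).
    rewrite expr2 -mulrA ler_wpM2l// -mulrA ler_wpM2l//.
    by apply: le_trans h _; rewrite ler_wpM2l.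
  rewrite ler_wpM2l// [leRHS]mulrC ler_wpM2r ?sqr_ge0//.
  have h1 : eta * ((B + kap) * w) <= eta * ((1 / 2 + B) * w).
    by rewrite ler_wpM2l// ler_wpM2r//; lra.
  lra.
(* Completing this square splits the cross term 2 al ga into al^2/16 + 16 ga^2, whence 3/16 = 1/4 -
   1/16 and 65/4 = 16 + 1/4. *)
have T3 : 0 <= (al / 4 - 4 * ga) ^+ 2 by exact: sqr_ge0.
have := ler_wpM2l eta0 T3; rewrite mulr0 alE gaE.
have -> : eta * (al / 4 - 4 * ga) ^+ 2 =
  eta * (al ^+ 2 / 16 - 2 * al * ga + 16 * ga ^+ 2) by field.
have e2 : eta * ((al + ga) ^+ 2 / 4) =
  eta * (al ^+ 2 / 4 + al * ga / 2 + ga ^+ 2 / 4) by field.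
rewrite e2 in T2; lra.
Qed.

(** * Bounds on a sublevel set and contraction of the gap *)

Section Bounds.
Variables (R : realType) (M N m : nat) (S : linear_system R N m).
Local Notation A := (sysA S).
Local Notation C := (sysC S).
Local Notation Q := (procQ S).
Local Notation V := (measR S).
Hypotheses (hM : (0 < M)%N) (hN : (0 < N)%N) (hm : (0 < m)%N).
Hypothesis pP0 : possemidef (init_cov S).
Hypotheses (hQ : forall t, posdef (Q t)) (hR : forall t, posdef (V t)).
Hypotheses (hobs : observable C A) (hA : A \in unitmx).
Implicit Types K : gain R M N m.

Let sP0 : (init_cov S)^T = init_cov S. Proof. by case: pP0. Qed.
Let sQ t : (Q t)^T = Q t. Proof. by case: (hQ t). Qed.
Let sV t : (V t)^T = V t. Proof. by case: (hR t). Qed.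

(** The sum [Sigma S] starts at n = 1, so a null vector [u] satisfies C A^i (A u) = 0 for i < N:
    observability annihilates [A u], and invertibility of [A] then annihilates [u]. *)
Lemma Sigma_posdef : posdef (Sigma S).
Proof.
split=> [|u u0]; first exact: Sigma_sym.
have SE : (u^T *m Sigma S *m u) 0 0 =
    \sum_(1 <= n < N.+1) fn2 (C *m A ^+ n *m u).
  rewrite -mulmxA -fip_cV /Sigma mulmx_suml.
  rewrite /fip mulmx_sumr raddf_sum /=; apply: eq_bigr => n _.
  by rewrite !trmx_mul !mulmxA.
rewrite {}SE lt_def andbC sumr_ge0 => [|? _]; last exact: fn2_ge0.
apply: contra u0; rewrite big_add1 /= big_mkord psumr_eq0 => [|? _]; last exact: fn2_ge0.
move=> /allP H; have CA0 (i : 'I_N) : C *m A ^+ i *m (A *m u) = 0.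
  have /implyP/(_ isT)/eqP/fn2_eq0 := H i (mem_index_enum _).
  by rewrite exprSr => <-; rewrite !mulmxA.
have Au0 : A *m u = 0.
  have fO : row_full (\mxcol_(i < N) (C *m A ^+ i)) by apply/eqP.
  apply: (row_full_inj fO); rewrite mxcol_mul mulmx0.
  rewrite -[0](@submxcolK _ _ _ _ 0); apply: eq_mxcol => i; rewrite CA0.
  by apply/matrixP => ? ?; rewrite !mxE.
by rewrite -(mulKmx hA u) Au0 mulmx0.
Qed.

Let sg := sigma_min (Sigma S).
Lemma sg_gt0 : 0 < sg. Proof. exact: sigma_min_gt0 Sigma_posdef. Qed.

Lemma Sigma_psd : possemidef (Sigma S). Proof. exact/posdef_psd/Sigma_posdef. Qed.

Lemma Sigma_lge : lge (Sigma S) sg. Proof. exact: sigma_min_lge Sigma_psd. Qed.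

Lemma err_cov_psd K t : possemidef (err_cov S K t).
Proof.
elim: t => [//|t IH]; rewrite err_covS; apply: psdD.
  by apply: psd_congr; apply: psdD; [exact: psd_congr|exact: posdef_psd].
by apply: psd_congr; exact: posdef_psd.
Qed.

Lemma pred_cov_psd K t : possemidef (pred_cov S K t).
Proof. by apply: psdD; [apply/psd_congr/err_cov_psd|exact: posdef_psd]. Qed.

Lemma innov_cov_psd K t : possemidef (innov_cov S K t).
Proof. by apply: psdD; [apply/psd_congr/pred_cov_psd|exact: posdef_psd]. Qed.

Lemma riccati_cost_ge0 K : 0 <= riccati_cost S K.
Proof.
by apply: sumr_ge0 => t _; apply: psd_tr_ge0 (err_cov_psd _ _) Sigma_psd.
Qed.

Lemma adjoint_ge K k t : possemidef (adjoint S K k t - Sigma S).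
Proof.
elim: k t => [|k IH] t; first by rewrite subrr; exact: psd0.
rewrite adjointS addrC addKr.
have pY : possemidef (adjoint S K k t.+1).
  by rewrite -[adjoint _ _ _ _](subrK (Sigma S)); apply: psdD => //; exact: Sigma_psd.
by have := psd_congr (closed_loop S K t)^T pY; rewrite trmxK.
Qed.

Lemma adjoint_psd K k t : possemidef (adjoint S K k t).
Proof.
rewrite -[adjoint _ _ _ _](subrK (Sigma S)); apply: psdD; first exact: adjoint_ge.
exact: Sigma_psd.
Qed.

Lemma multiplier_psd K t : possemidef (multiplier S K t).
Proof. exact: adjoint_psd. Qed.

Lemma multiplier_lge K t : lge (multiplier S K t) sg.
Proof.
rewrite -[multiplier _ _ _](subrK (Sigma S)) -[sg]add0r; apply: lgeD.
  exact/psd_lge0/adjoint_ge.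
exact: Sigma_lge.
Qed.

Lemma sigma_low_gt0 : 0 < sigma_low M S.
Proof. by apply: min_upto_gt0 => t; exact: sigma_min_gt0. Qed.

Lemma q_low_gt0 : 0 < q_low M S.
Proof.
apply: min_upto_gt0 => t; apply: sigma_min_gt0 => //.
by apply: posdef_congr => //; rewrite unitmx_inv.
Qed.

Lemma innov_cov_lge K t : (t < M)%N -> lge (innov_cov S K t) (sigma_low M S).
Proof.
move=> tM; rewrite -[sigma_low _ _]add0r; apply: lgeD.
  exact/psd_lge0/psd_congr/pred_cov_psd.
apply: lge_le (sigma_min_lge hm (posdef_psd (hR _))).
exact: (min_upto_le (fun t => sigma_min (V t.+1))).
Qed.

Local Notation f := (@riccati_cost R M N m S).
Local Notation P0 := (init_cov S).

Lemma err_cov_trace K t : (0 < t <= M)%N -> \tr (err_cov S K t) <= f K / sg.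
Proof.
case: t => // t tM; rewrite ler_pdivlMr ?sg_gt0// mulrC.
apply: le_trans (psd_trace_lge (err_cov_psd K t.+1) (Sigma_sym S) Sigma_lge) _.
rewrite /riccati_cost big_mkord (bigD1 (Ordinal tM)) //= lerDl sumr_ge0// => i _.
exact: psd_tr_ge0 (err_cov_psd _ _) Sigma_psd.
Qed.

Lemma constA_ge0 K : 0 <= constA S f P0 K.
Proof.
by rewrite addr_ge0 ?sigma_max_ge0// divr_ge0 ?riccati_cost_ge0// ltW// sg_gt0.
Qed.

Lemma err_cov_lle K t : (t <= M)%N -> lle (err_cov S K t) (constA S f P0 K).
Proof.
case: t => [_|t tM].
  apply: lle_le (opb_lle (sigma_max_ge0 _) (sigma_max_opb _ hN)).
  by rewrite lerDr divr_ge0 ?riccati_cost_ge0// ltW// sg_gt0.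
apply: lle_le (trace_le_psd (err_cov_psd _ _)).
apply: le_trans (err_cov_trace _ _) _; first exact: tM.
by rewrite lerDl sigma_max_ge0.
Qed.

Definition innov_bound K := sigma_up M S
  + spectral_norm (C *m A) ^+ 2 * constA S f P0 K.

Lemma innov_cov_lle K t : (t < M)%N -> lle (innov_cov S K t) (innov_bound K).
Proof.
move=> tM; have -> : innov_cov S K t = (C *m Q t *m C^T + V t.+1)
    + C *m A *m err_cov S K t *m (C *m A)^T.
  rewrite /innov_cov /pred_cov mulmxDr mulmxDl trmx_mul !mulmxA.
  by rewrite [RHS]addrC addrA.
apply: lleD.
  apply: lle_le (opb_lle (sigma_max_ge0 _) (sigma_max_opb _ hm)).
  exact: (max_upto_ge (fun t => sigma_max (C *m Q t *m C^T + V t.+1))).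
apply: lle_congr; [exact: constA_ge0|exact/err_cov_lle/ltnW|exact: sigma_max_opb].
Qed.

Lemma innov_bound_ge K : sigma_low M S <= innov_bound K.
Proof.
have := innov_cov_lge K hM (delta_mx (Ordinal hm) 0).
move=> /le_trans/(_ (innov_cov_lle K hM _)).
by rewrite !fip_cV trmx_delta mul_delta_mx mxE eqxx !mulr1.
Qed.

Lemma innov_bound_gt0 K : 0 < innov_bound K.
Proof. exact: lt_le_trans sigma_low_gt0 (innov_bound_ge K). Qed.

Lemma constB_ge0 K : 0 <= constB S f K.
Proof.
rewrite addr_ge0 ?mulr_ge0 ?sigma_max_ge0 ?ler0n ?riccati_cost_ge0//.
by rewrite invr_ge0 ltW// q_low_gt0.
Qed.

Lemma trace_Sigma_le : \tr (Sigma S) <= N%:R * sigma_max (Sigma S).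
Proof. exact/trace_le_lle/opb_lle/sigma_max_opb/hN/sigma_max_ge0. Qed.

(** Summation by parts applied to the covariances themselves writes f(K) as a sum of traces of
    multipliers against noise covariances. With F = H A^-1, [H] the closed loop, the part F Q F^T
    contributes tr (H^T Y_{s+1} H A^-1 Q A^-T) >= q tr (Y_s - Sigma). This is the origin of [q_low]
    and of [constB]. *)
Lemma multiplier_trace K t : (t <= M)%N -> \tr (multiplier S K t) <= constB S f K.
Proof.
rewrite leq_eqVlt => /orP[/eqP ->|tM].
  rewrite multiplier_last (le_trans trace_Sigma_le)// lerDr divr_ge0 ?riccati_cost_ge0//.
  exact/ltW/q_low_gt0.
rewrite -[multiplier _ _ _](subrK (Sigma S)) mxtraceD; apply: lerD; last exact: trace_Sigma_le.
rewrite ler_pdivlMr ?q_low_gt0// mulrC.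
rewrite /riccati_cost (multiplier_telescope (err_cov_rec S K)).
set F := fun t => 1%:M - gain_at K t *m C.
have Yge s : (s < M)%N -> q_low M S * \tr (multiplier S K s - Sigma S) <=
    \tr (multiplier S K s.+1 *m (F s *m Q s *m (F s)^T +
       gain_at K s *m V s.+1 *m (gain_at K s)^T)).
  move=> sM; rewrite [in leRHS]mulmxDr [leRHS]mxtraceD; apply: ler_wpDr.
    by apply: psd_tr_ge0; [exact: multiplier_psd|apply/psd_congr/posdef_psd].
  have /lge_le Ql := sigma_min_lge hN (psd_congr (invmx A) (posdef_psd (hQ s))).
  have {Ql}Ql := Ql _ (min_upto_le (fun t => sigma_min (invmx A *m Q t *m (invmx A)^T)) sM).
  have sY := psd_trace_lge (adjoint_ge K (M - s) s) _ Ql.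
  apply: le_trans (sY _) _.
    by rewrite !trmx_mul trmxK sQ mulmxA.
  rewrite -/(multiplier S K s) multiplier_rec// addrC addKr.
  have HF : closed_loop S K s *m invmx A = F s.
    by rewrite mulmxBl -!mulmxA mulmxV// mulmx1.
  rewrite -HF trmx_mul !mulmxA le_eqVlt; apply/orP; left; apply/eqP.
  by rewrite -!mulmxA [LHS]mxtrace_mulC !mulmxA.
apply: ler_wpDr.
  by apply: psd_tr_ge0 => //; exact: adjoint_ge.
rewrite big_mkord (bigD1 (Ordinal tM)) //=; apply: ler_wpDr; last exact: Yge.
apply: sumr_ge0 => i _; apply: le_trans (Yge i _) => //.
by rewrite mulr_ge0 ?(ltW q_low_gt0)// psd_trace_ge0//; exact: adjoint_ge.
Qed.

Lemma multiplier_lle K t : (t <= M)%N -> lle (multiplier S K t) (constB S f K).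
Proof.
move=> tM; apply: lle_le (multiplier_trace K tM) _.
exact/trace_le_psd/multiplier_psd.
Qed.

Lemma multiplier_opb K t : (t <= M)%N -> opb (multiplier S K t) (constB S f K).
Proof. by move=> tM; apply: psd_opb (multiplier_psd _ _) (multiplier_lle _ _). Qed.


Lemma gain_at_ord K (i : 'I_M) : gain_at K i = K i.
Proof. by rewrite /gain_at valK. Qed.

Lemma gain_at_ge K t : (M <= t)%N -> gain_at K t = 0.
Proof. by move=> Mt; rewrite /gain_at insubF// ltnNge Mt. Qed.

Definition policy_grad K t : 'M[R]_(N, m) :=
  2 *: (multiplier S K t.+1 *m residual S K t).

(** In the exact difference towards [Ks] the step is minimized out: by [psd_young] each term is at
    least -<E, Y E>/a, with [a] the lower bound of the innovation covariances. The multiplier of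
    [Ks], bounded above, puts [constB] into [c1]; that of [K], bounded below, gives the square of
    [sg]; and 4 is the square of the 2 in [policy_grad]. *)
Lemma polyak_lojasiewicz K Ks :
  f K - f Ks <= c1 S f Ks * \sum_(0 <= t < M) fn2 (policy_grad K t).
Proof.
rewrite -opprB cost_diff // mulr_sumr -sumrN.
apply: ler_sum_nat => t /andP[_ tM].
set D := _ - _; set Y := multiplier S Ks _; set E := residual _ _ _.
set W := innov_cov _ _ _; have a0 := sigma_low_gt0; set a := sigma_low M S in a0.
have pY : possemidef Y by exact: multiplier_psd.
have H1 : a * fip D (Y *m D) <= fip D (Y *m D *m W).
  by apply: fip_psd_lge => //; [exact: innov_cov_sym|exact: innov_cov_lge].
have H2 : 0 <= a * (a * fip D (Y *m D) + 2 * fip (Y *m E) D) + fip E (Y *m E).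
  exact: psd_young.
have H3 : fip E (Y *m E) <= constB S f Ks * fn2 E.
  by apply: lle_mx; exact: multiplier_lle.
have H4 : sg ^+ 2 * fn2 E <= fn2 (multiplier S K t.+1 *m E).
  by apply: lge_inv (multiplier_lge _ _); exact/ltW/sg_gt0.
rewrite /policy_grad fipZl fipZr /c1 -/sg -/a -/E; set B := constB _ _ _ in H3 *.
set G := fn2 (multiplier _ _ _ *m _) in H4 *.
have sg0 := sg_gt0; have B0 : 0 <= B := constB_ge0 _.
have -> : B / (4 * a * sg ^+ 2) * (2 * (2 * G)) = B * (G / sg ^+ 2) / a.
  by field; rewrite !gt_eqF.
rewrite ler_pdivlMr// (le_trans (y := B * fn2 E))//; last first.
  by rewrite ler_wpM2l// ler_pdivlMr ?exprn_gt0// mulrC.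
apply: le_trans H3; rewrite -subr_ge0.
apply: le_trans H2 _; rewrite -subr_ge0.
have -> : fip E (Y *m E) - - (2 * fip (Y *m E) D + fip D (Y *m D *m W)) * a -
   (a * (a * fip D (Y *m D) + 2 * fip (Y *m E) D) + fip E (Y *m E)) =
   a * (fip D (Y *m D *m W) - a * fip D (Y *m D)) by ring.
by rewrite mulr_ge0 ?(ltW a0)// subr_ge0.
Qed.

(** The trial gain K - residual / w, with [w] bounding the innovation covariances, lowers the cost
    by at least sg / w times the sum, and the cost cannot fall below its minimum. The multipliers
    met here are those of the trial gain, but only their semidefiniteness and the lower bound [sg]
    matter. *)
Lemma sum_residual_le K Ks : is_minimizer f Ks ->
  \sum_(0 <= t < M) fn2 (residual S K t) <= innov_bound K / sg * (f K - f Ks).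
Proof.
move=> minKs; have w0 := innov_bound_gt0 K; set w := innov_bound K in w0 *.
pose K' : gain R M N m := fun i => K i - w^-1 *: residual S K i.
have sg0 := sg_gt0.
suff H : f K' - f K <= - (sg / w) * \sum_(0 <= t < M) fn2 (residual S K t).
  have -> : w / sg = (sg / w)^-1 by rewrite invf_div.
  by rewrite ler_pdivlMl ?divr_gt0//; have := minKs K'; lra.
rewrite cost_diff // mulr_sumr; apply: ler_sum_nat => t /andP[_ tM].
have -> : gain_at K' t - gain_at K t = - (w^-1 *: residual S K t).
  by rewrite !(gain_at_ord _ (Ordinal tM)) /K' addrAC subrr sub0r.
set E := residual _ _ _; set Y := multiplier _ _ _; set W := innov_cov _ _ _.
have pY : possemidef Y by exact: multiplier_psd.
have H1 : fip E (Y *m E *m W) <= w * fip E (Y *m E).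
  by apply: fip_psd_lle => //; [exact: innov_cov_sym|exact: innov_cov_lle].
have H2 : sg * fn2 E <= fip E (Y *m E) by exact/lge_mx/multiplier_lge.
rewrite mulmxN mulNmx !fipNr fipNl opprK -scalemxAr -scalemxAl !fipZr fipZl.
rewrite (fipC _ E).
have H3 : w^-1 * (w^-1 * fip E (Y *m E *m W)) <= w^-1 * fip E (Y *m E).
  by rewrite ler_pM2l ?invr_gt0// ler_pdivrMl.
apply: (@le_trans _ _ (- (w^-1 * fip E (Y *m E)))); first lra.
by rewrite mulNr lerN2 mulrAC [leLHS]mulrC ler_pM2l ?invr_gt0.
Qed.

Definition gap_root Ks K := Num.sqrt (M%:R * (c2 S f P0 K)^-1 * (f K - f Ks)).

Lemma c2E K : (c2 S f P0 K)^-1 = 4 * innov_bound K / sg.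
Proof. by rewrite /c2 invf_div. Qed.

(** Cauchy-Schwarz over time; the 4 in the inverse of [c2] accounts for the division by 2. *)
Lemma sum_sqrt_residual_le K Ks : is_minimizer f Ks ->
  \sum_(0 <= t < M) Num.sqrt (fn2 (residual S K t)) <= gap_root Ks K / 2.
Proof.
move=> minKs; set X := \sum_(_ <= _ < _) _.
have X0 : 0 <= X by apply: sumr_ge0 => t _; exact: sqrtr_ge0.
rewrite ler_pdivlMr// -[leLHS]ger0_norm ?mulr_ge0// -sqrtr_sqr ler_wsqrtr//.
rewrite exprMn c2E.
have := sum_sqr_le M (fun t => Num.sqrt (fn2 (residual S K t))); rewrite -/X.
under eq_bigr do rewrite sqr_sqrtr ?fn2_ge0//.
have := ler_wpM2l (ler0n R M) (sum_residual_le K minKs).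
set s := \sum_(_ <= _ < _) _ => H1 H2.
have -> : M%:R * (4 * innov_bound K / sg) * (f K - f Ks) =
  4 * (M%:R * (innov_bound K / sg * (f K - f Ks))) by ring.
have -> : (2 : R) ^+ 2 = 4 by ring.
by rewrite mulrC ler_pM2l// (le_trans H2).
Qed.


Lemma constA_le K K0 : f K <= f K0 -> constA S f P0 K <= constA S f P0 K0.
Proof. by move=> KK0; rewrite lerD2r ler_pM2r// invr_gt0 sg_gt0. Qed.

Lemma innov_bound_le K K0 : f K <= f K0 -> innov_bound K <= innov_bound K0.
Proof. by move=> KK0; rewrite lerD2l ler_wpM2l ?sqr_ge0// constA_le. Qed.

Lemma constB_le K K0 : f K <= f K0 -> constB S f K <= constB S f K0.
Proof. by move=> KK0; rewrite lerD2r ler_pM2r// invr_gt0 q_low_gt0. Qed.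

Lemma gap_root_le Ks K K0 : is_minimizer f Ks -> f K <= f K0 ->
  gap_root Ks K <= gap_root Ks K0.
Proof.
move=> minKs KK0; rewrite ler_wsqrtr// -!mulrA ler_wpM2l ?ler0n// !c2E.
have sg0 := sg_gt0; apply: ler_pM.
- by rewrite divr_ge0 ?mulr_ge0 ?(ltW (innov_bound_gt0 _))// ltW.
- by rewrite subr_ge0.
- by rewrite ler_pM2r ?invr_gt0// ler_pM2l// innov_bound_le.
- by rewrite lerD2r.
Qed.

Lemma constC_le Ks K K0 : is_minimizer f Ks -> f K <= f K0 ->
  constC S f P0 Ks K <= constC S f P0 Ks K0.
Proof.
move=> minKs KK0; rewrite lerD2r ler_pM2r ?invr_gt0 ?sigma_low_gt0// lerD//.
  exact: gap_root_le.
by rewrite !ler_wpM2r ?sigma_max_ge0// constA_le.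
Qed.

Lemma constC_ge0 Ks K : 0 <= constC S f P0 Ks K.
Proof.
have a0 := sigma_low_gt0; rewrite addr_ge0//.
  by rewrite divr_ge0 ?(ltW a0)// addr_ge0 ?sqrtr_ge0// !mulr_ge0 ?constA_ge0 ?sigma_max_ge0.
by apply: sumr_ge0 => t _; rewrite divr_ge0 ?(ltW a0) ?sigma_max_ge0.
Qed.

(** By definition of the residual, W K_t^T = residual^T + C A P_t A^T + C Q_t with [W] the
    innovation covariance, which is at least [sigma_low], and P_t the error covariance. These are
    the three summands of [constC], whose sum over time bounds the value at [t]. *)
Lemma gain_opb Ks K t : is_minimizer f Ks ->
  opb (gain_at K t) (constC S f P0 Ks K).
Proof.
move=> minKs; have [tM|/gain_at_ge -> u] := ltnP t M; last first.
  by rewrite mul0mx fip0r mulr_ge0 ?sqr_ge0 ?fn2_ge0.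
have a0 := sigma_low_gt0.
pose b := gap_root Ks K
  + constA S f P0 K * spectral_norm (C *m A) * spectral_norm A
  + spectral_norm (C *m Q t).
have b1 : 0 <= constA S f P0 K * spectral_norm (C *m A) * spectral_norm A.
  by rewrite !mulr_ge0 ?constA_ge0 ?sigma_max_ge0.
have b0 : 0 <= b by rewrite !addr_ge0 ?sqrtr_ge0 ?sigma_max_ge0.
have Kb : opb (innov_cov S K t *m (gain_at K t)^T) b.
  have -> : innov_cov S K t *m (gain_at K t)^T = (residual S K t)^T
      + C *m A *m err_cov S K t *m A^T + C *m Q t.
    have -> : innov_cov S K t *m (gain_at K t)^T =
        (residual S K t)^T + C *m pred_cov S K t.
      rewrite /residual trmxD trmxN !trmx_mul trmxK pred_cov_sym// innov_cov_sym//.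
      by rewrite subrK.
    by rewrite /pred_cov mulmxDr !mulmxA addrA.
  have g0 : 0 <= gap_root Ks K := sqrtr_ge0 _.
  apply: opbD (addr_ge0 g0 b1) (sigma_max_ge0 _) _ (sigma_max_opb _ hN).
  apply: (opbD g0 b1).
    apply: opb_tr; apply: opb_le (opb_fn2 _); first exact: sqrtr_ge0.
    have := sum_sqrt_residual_le K minKs; rewrite big_mkord (bigD1 (Ordinal tM))//=.
    set r := \sum_(_ < _ | _) _; have r0 : 0 <= r by apply: sumr_ge0 => i _; exact: sqrtr_ge0.
    by lra.
  rewrite (mulrC (constA _ _ _ _)); apply: opbM; last exact/opb_tr/sigma_max_opb.
  apply: opbM; first exact: sigma_max_opb.
  apply: psd_opb; first exact: err_cov_psd.
  exact/err_cov_lle/ltnW.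
rewrite -[gain_at K t]trmxK; apply: opb_tr.
apply: (@opb_le _ _ _ _ (b / sigma_low M S)).
- by rewrite divr_ge0// ltW.
- rewrite /b mulrDl lerD2l big_mkord (bigD1 (Ordinal tM))//= lerDl sumr_ge0// => i _.
  by rewrite divr_ge0 ?sigma_max_ge0// ltW.
- move=> u; rewrite expr_div_n mulrAC ler_pdivlMr ?exprn_gt0// mulrC.
  apply: le_trans (lge_inv _ (ltW a0) (innov_cov_lge K tM)) _.
  by rewrite mulmxA; exact: Kb.
Qed.

Lemma closed_loop_opb Ks K K0 b t : is_minimizer f Ks -> f K <= f K0 ->
  opb (closed_loop S K t) (rho_max S f P0 Ks K0 b).
Proof.
move=> minKs KK0.
apply: (@opb_le _ _ _ _ (spectral_norm A + constC S f P0 Ks K * spectral_norm (C *m A))).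
- by rewrite addr_ge0 ?mulr_ge0 ?sigma_max_ge0 ?constC_ge0.
- rewrite /rho_max le_max; apply/orP; left; rewrite lerD2l mulrC.
  by rewrite ler_wpM2l ?sigma_max_ge0// constC_le.
apply: opbD; rewrite ?sigma_max_ge0 ?mulr_ge0 ?sigma_max_ge0 ?constC_ge0//.
  exact: sigma_max_opb.
by apply/opbN/opbM; [exact: gain_opb|exact: sigma_max_opb].
Qed.

Lemma adjoint_opb K rho s k t : 0 <= s -> 0 <= rho -> opb (Sigma S) s ->
  (forall t, opb (closed_loop S K t) rho) ->
  opb (adjoint S K k t) (adj_bound s (fun=> rho) k t).
Proof.
move=> s0 rho0 Ss Hr; elim: k t => [//|k IH] t; rewrite adjointS /=.
have y0 := le_trans s0 (adj_bound_ge (fun=> rho) k t.+1 s0).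
apply: opbD; rewrite ?mulr_ge0 ?sqr_ge0//.
by rewrite expr2 mulrAC; apply: opbM (Hr _); apply: opbM => //; exact/opb_tr.
Qed.

(** H'^T Y' H' - H^T Y H splits into three products whose norm bounds add up exactly to the
    increment of the scalar recursion from [rho] to [rho + d]. *)
Lemma adjoint_perturb K K' rho s (d : nat -> R) k t :
  0 <= s -> 0 <= rho -> opb (Sigma S) s -> (forall t, 0 <= d t) ->
  (forall t, opb (closed_loop S K t) rho) ->
  (forall t, opb (closed_loop S K' t - closed_loop S K t) (d t)) ->
  opb (adjoint S K' k t - adjoint S K k t)
    (adj_bound s (fun t => rho + d t) k t - adj_bound s (fun=> rho) k t).
Proof.
move=> s0 rho0 Ss d0 Hr Hd; elim: k t => [|k IH] t.
  by move=> u; rewrite /adjoint !subrr mul0mx fip0r expr0n mul0r.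
rewrite !adjointS /=.
have Yb := adjoint_opb k t.+1 s0 rho0 Ss Hr.
have {}IH := IH t.+1; set y' := adj_bound _ _ _ _ in IH *.
set y := adj_bound _ _ _ _ in IH Yb *.
have y0 : 0 <= y := le_trans s0 (adj_bound_ge _ _ _ s0).
have yy' : 0 <= y' - y.
  by rewrite subr_ge0; apply: adj_bound_le => // j; rewrite rho0 lerDl d0.
have {}Hd := Hd t; have {}Hr := Hr t.
move: (closed_loop S K' t) (closed_loop S K t) Hd Hr => H' H Hd Hr.
move: (adjoint S K' k t.+1) (adjoint S K k t.+1) Yb IH => Y' Y Yb IH.
have Hr' : opb H' (rho + d t).
  by rewrite -[H'](subrK H) addrC; apply: opbD.
have -> : Sigma S + H'^T *m Y' *m H' - (Sigma S + H^T *m Y *m H) =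
   H'^T *m (Y' - Y) *m H' + ((H' - H)^T *m Y *m H' + H^T *m Y *m (H' - H)).
  rewrite trmxD trmxN !(mulmxDl, mulmxDr, mulNmx, mulmxN).
  by apply/matrixP => i j; rewrite !(mxaddE, mxoppE); ring.
have -> : s + (rho + d t) ^+ 2 * y' - (s + rho ^+ 2 * y) =
  (rho + d t) * (y' - y) * (rho + d t) + (d t * y * (rho + d t) + rho * y * d t) by ring.
have rd0 : 0 <= rho + d t by rewrite addr_ge0.
have HT := opb_tr Hr; have HT' := opb_tr Hr'; have HdT := opb_tr Hd.
have p1 := opbM (opbM HT' IH) Hr'; have p2 := opbM (opbM HdT Yb) Hr'.
have p3 := opbM (opbM HT Yb) Hd.
have q1 : 0 <= (rho + d t) * (y' - y) * (rho + d t).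
  by rewrite mulr_ge0// mulr_ge0.
have q2 : 0 <= d t * y * (rho + d t) by rewrite mulr_ge0// mulr_ge0.
have q3 : 0 <= rho * y * d t by rewrite mulr_ge0// mulr_ge0.
exact: opbD q1 (addr_ge0 q2 q3) p1 (opbD q2 q3 p2 p3).
Qed.


Lemma multiplier_perturb K K' rho s (d : nat -> R) t :
  0 <= s -> 1 < rho -> opb (Sigma S) s -> (forall t, 0 <= d t) ->
  (forall t, opb (closed_loop S K t) rho) ->
  (forall t, opb (closed_loop S K' t - closed_loop S K t) (d t)) ->
  0 < Num.min 1 sg -> Num.min 1 sg <= s ->
  2 * s * ((rho ^+ (2 * M) - 1) / (rho ^+ 2 - 1)) * (2 * rho + 1)
    * \sum_(0 <= t < M) d t <= 21 / 20 * Num.min 1 sg ->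
  (0 < t <= M)%N ->
  opb (multiplier S K' t - multiplier S K t) (Num.min 1 sg / 2).
Proof.
move=> s0 rho1 Ss d0 Hr Hd mn0 mns; set Geo := (rho ^+ _ - 1) / _; set D := \sum_(_ <= _ < _) _.
move=> HD /andP[t0 tM]; have rho0 : 0 < rho by lra.
have D0 : 0 <= D by rewrite sumr_ge0.
have rho21 : 0 < rho ^+ 2 - 1 by rewrite subr_gt0 expr_gt1// ltW.
have Geo1 : 1 <= Geo.
  rewrite /Geo ler_pdivlMr// mul1r lerD2r ler_eXn2l//.
  by rewrite leq_pmulr.
have sG : s <= s * Geo by rewrite ler_peMr.
have [||||X1 XG] := @perturb_num _ (Num.min 1 sg) rho (s * Geo) (D / rho) mn0.
- exact: le_trans sG.
- exact: ltW.
- by rewrite divr_ge0// ltW.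
- rewrite divfK ?gt_eqF//; apply: le_trans HD.
  by rewrite le_eqVlt; apply/orP; left; apply/eqP; ring.
have X0 : 0 <= D / rho by rewrite divr_ge0// ltW.
have Dlt : D < rho by move: X1; rewrite ltr_pdivrMr// mul1r.
set k := (M - t)%N.
have Dk0 : 0 <= \sum_(t <= j < t + k) d j by rewrite sumr_ge0.
have DkD : \sum_(t <= j < t + k) d j <= D.
  rewrite /D (@big_cat_nat _ _ _ t 0 M)//= subnKC// lerDr.
  by rewrite sumr_ge0.
have Hy := @adj_bound_ratio _ s rho d k t s0 rho0 d0 (le_lt_trans DkD Dlt).
apply: opb_le (adjoint_perturb k t s0 (ltW rho0) Ss d0 Hr Hd).
  rewrite subr_ge0; apply: adj_bound_le => // j.
  by rewrite (ltW rho0) lerDl d0.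
apply: le_trans XG.
set y' := adj_bound _ _ _ _ in Hy *; set y := adj_bound _ _ _ _ in Hy *.
have ys : 0 <= y - s by rewrite subr_ge0 adj_bound_ge.
(* As [t >= 1], at most [M] powers of rho^2 occur, so the geometric quotient of [c3] suffices. *)
have yG : y - s <= s * Geo.
  apply: (@le_trans _ _ y); first by rewrite gerBl.
  rewrite mulrA ler_pdivlMr// mulrC adj_bound_cst ler_wpM2l// lerD2r.
  by rewrite ler_eXn2l// leq_mul2l /= /k ltn_subrL t0 hM.
set x := _ / rho in Hy; set X := D / rho in X0 X1 *.
have xX : x <= X by rewrite ler_pM2r ?invr_gt0.
have x0 : 0 <= x by rewrite divr_ge0// ltW.
have H1 : (1 - x) ^- 2 <= (1 - X) ^- 2.
  rewrite lef_pV2 ?posrE ?exprn_gt0 ?subr_gt0 ?(le_lt_trans xX)//.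
  by rewrite ler_pXn2r ?nnegrE ?subr_ge0 ?(ltW X1) ?(le_trans xX) ?(ltW X1)// lerB.
have H2 : 0 <= (1 - X) ^- 2 - 1.
  rewrite subr_ge0 -[leLHS]invr1 lef_pV2 ?posrE ?exprn_gt0 ?subr_gt0//.
  by rewrite expr_le1// ?subr_ge0 ?(ltW X1)// gerBl.
apply: le_trans (ler_wpM2l H2 yG).
have := ler_wpM2l ys H1; lra.
Qed.


Lemma sg_le_Sigma : sg <= spectral_norm (Sigma S).
Proof.
have := Sigma_lge (delta_mx (Ordinal hN) 0).
move=> /le_trans/(_ (opb_lle (sigma_max_ge0 _) (sigma_max_opb _ hN) _)).
by rewrite !fip_cV trmx_delta mul_delta_mx mxE eqxx !mulr1.
Qed.

Lemma constB_gt0 K : 0 < constB S f K.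
Proof.
rewrite ltr_wpDl//; first by rewrite divr_ge0 ?riccati_cost_ge0// ltW// q_low_gt0.
by rewrite mulr_gt0 ?ltr0n// (lt_le_trans sg_gt0)// sg_le_Sigma.
Qed.

Lemma c1_gt0 Ks : 0 < c1 S f Ks.
Proof.
by rewrite /c1 divr_gt0 ?constB_gt0// !mulr_gt0 ?exprn_gt0 ?sigma_low_gt0 ?sg_gt0.
Qed.

Lemma descent_step K Ks K0 b eta sl (g : nat -> 'M[R]_(N, m)) :
  is_minimizer f Ks -> f K <= f K0 -> 0 < b -> 0 <= eta -> 0 <= sl ->
  let rho := rho_max S f P0 Ks K0 b in
  eta * (2 * constB S f K0 * gap_root Ks K0
         * ((rho ^+ (2 * M) - 1) / (rho ^+ 2 - 1)) * (2 * rho + 1)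
         * spectral_norm (Sigma S) * Num.max (spectral_norm (C *m A)) 1)
    <= Num.min 1 sg ->
  eta * (4 * innov_bound K0 * (2^-1 + constB S f K0)) <= 1 ->
  (forall t, Num.sqrt (fn2 (g t)) <= sl) ->
  M%:R * sl <= constB S f K0 * gap_root Ks K0 / 20 ->
  let K' : gain R M N m := fun i => K i - eta *: (policy_grad K i + g i) in
  (f K' - f K <= - eta * (3 / 16 * \sum_(0 <= t < M) fn2 (policy_grad K t)
                          - 65 / 4 * \sum_(0 <= t < M) fn2 (g t)) : Prop).
Proof.
move=> minKs KK0 b0 eta0 sl0 rho H3 H4 gsl Msl K'.
set s := spectral_norm (Sigma S) in H3; set ca := spectral_norm (C *m A) in H3.
set B0 := constB S f K0 in H3 H4 Msl; set x0 := gap_root Ks K0 in H3 Msl.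
set Geo := (rho ^+ _ - 1) / _ in H3.
have sg0 := sg_gt0; have sgs : sg <= s := sg_le_Sigma.
have mn0 : 0 < Num.min 1 sg by rewrite lt_min ltr01.
have mn1 : Num.min 1 sg <= 1 by rewrite ge_min lexx.
have mnsg : Num.min 1 sg <= sg by rewrite ge_min lexx orbT.
(* The positive [b] in [rho_max] is what keeps the geometric quotient away from 0/0. *)
have rho1 : 1 < rho by rewrite /rho /rho_max lt_max; apply/orP; right; lra.
have rho0 : 0 < rho := lt_trans ltr01 rho1.
have s0 : 0 <= s by exact: sigma_max_ge0.
have ca0 : 0 <= ca by exact: sigma_max_ge0.
have B00 : 0 <= B0 := constB_ge0 _; have x00 : 0 <= x0 := sqrtr_ge0 _.
have DE t : (t < M)%N -> gain_at K' t - gain_at K t = - (eta *: (policy_grad K t + g t)).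
  by move=> tM; rewrite !(gain_at_ord _ (Ordinal tM)) /K' addrAC subrr sub0r.
(* The change of the closed loop is measured by [d]; beyond the horizon both gains are 0. *)
pose d t := if (t < M)%N then
  eta * (2 * B0 * Num.sqrt (fn2 (residual S K t)) + sl) * ca else 0.
have d0 t : 0 <= d t.
  by rewrite /d; case: ifP => // _; rewrite !mulr_ge0// addr_ge0// !mulr_ge0 ?sqrtr_ge0.
have Hd t : opb (closed_loop S K' t - closed_loop S K t) (d t).
  have -> : closed_loop S K' t - closed_loop S K t =
      - (gain_at K' t - gain_at K t) *m (C *m A).
    rewrite /closed_loop mulNmx mulmxBl.
    by apply/matrixP => i j; rewrite !(mxaddE, mxoppE); ring.
  rewrite /d; case: ltnP => [tM|tM]; last first.
    by rewrite !gain_at_ge// subrr oppr0 mul0mx => u; rewrite mul0mx fip0r expr0n mul0r.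
  apply: opbM; last exact: sigma_max_opb.
  rewrite DE// opprK; apply: opbZ => //; apply: opb_le (opb_fn2 _); first exact: sqrtr_ge0.
  apply: le_trans (sqrt_fn2D _ _) _; apply: lerD => //.
  rewrite -[leRHS]ger0_norm ?mulr_ge0 ?sqrtr_ge0// -sqrtr_sqr ler_wsqrtr//.
  rewrite /policy_grad fipZl fipZr mulrA -expr2 -mulrA !exprMn sqr_sqrtr ?fn2_ge0//.
  rewrite ler_wpM2l ?sqr_ge0//; apply: opb_mx.
  apply: opb_le (multiplier_opb _ _) => //; first exact: constB_ge0.
  exact: constB_le.
(* The residual norms sum to at most half of the root, so the exact gradient contributes [B0 * x0];
   the sampling error adds at most a twentieth of it. *)
have sumd : \sum_(0 <= t < M) d t <= eta * (21 / 20 * B0 * x0) * ca.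
  have -> : \sum_(0 <= t < M) d t = eta * (2 * B0 *
      (\sum_(0 <= t < M) Num.sqrt (fn2 (residual S K t))) + M%:R * sl) * ca.
    rewrite (eq_big_nat _ _ (F2 := fun t =>
      eta * (2 * B0 * Num.sqrt (fn2 (residual S K t)) + sl) * ca)); last first.
      by move=> t /andP[_ tM]; rewrite /d tM.
    rewrite -mulr_suml -mulr_sumr big_split /= -mulr_sumr.
    by rewrite sumr_const_nat subn0 -[sl *+ M]mulr_natl.
  rewrite ler_wpM2r// ler_wpM2l//.
  have := sum_sqrt_residual_le K minKs; have := gap_root_le minKs KK0.
  rewrite -/x0; set e := \sum_(_ <= _ < _) _ => h1 h2.
  have h3 : e <= x0 / 2 by lra.
  by have := ler_wpM2l B00 h3; lra.
have Hr t : opb (closed_loop S K t) rho by exact: closed_loop_opb.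
have rho21 : 0 < rho ^+ 2 - 1 by rewrite subr_gt0 expr_gt1// ltW.
have Geo0 : 0 <= Geo.
  by rewrite divr_ge0 ?(ltW rho21)// subr_ge0 exprn_ege1// ltW.
have r21 : 0 <= 2 * rho + 1 by lra.
have two0 := ler0n R 2.
have pert t : (0 < t <= M)%N ->
    opb (multiplier S K' t - multiplier S K t) (Num.min 1 sg / 2).
  apply: (@multiplier_perturb K K' rho s d t s0 rho1 (sigma_max_opb _ hN) d0 Hr Hd
    mn0 (le_trans mnsg sgs)).
  have c0 := mulr_ge0 (mulr_ge0 (mulr_ge0 two0 s0) Geo0) r21.
  apply: le_trans (ler_wpM2l c0 sumd) _.
  have h4 : ca <= Num.max ca 1 by rewrite le_max lexx.
  have c1 := mulr_ge0 eta0
    (mulr_ge0 (mulr_ge0 (mulr_ge0 (mulr_ge0 two0 B00) x00) Geo0) (mulr_ge0 r21 s0)).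
  by have := ler_wpM2l c1 h4; lra.
rewrite cost_diff// !mulr_sumr -sumrB mulr_sumr; apply: ler_sum_nat => t /andP[_ tM].
rewrite DE//; apply: (@step_term _ _ _ _ _ _ _ _ B0 (innov_bound K0) (Num.min 1 sg / 2) sg) => //.
- exact/ltW/innov_bound_gt0.
- by rewrite divr_ge0// ltW.
- lra.
- lra.
- by rewrite div1r.
- apply: opb_le (multiplier_opb _ _) => //; first exact: constB_ge0.
  exact: constB_le.
- exact: multiplier_lge.
- exact: pert.
- apply: psd_opb; first exact: innov_cov_psd.
  by apply: lle_le (innov_cov_lle _ _) => //; exact: innov_bound_le.
- exact: innov_cov_sym.
Qed.


(** The strict inequality makes the root, hence the denominator of [c3], positive, so that the
    division in the extended reals is the real one. *)
Lemma step_size_bounds Ks K0 b eta : f Ks < f K0 -> 0 < b ->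
  (eta%:E <= Order.min (c3 S f P0 Ks K0 b) (c4 S f P0 K0)%:E)%E ->
  let rho := rho_max S f P0 Ks K0 b in
  eta * (2 * constB S f K0 * gap_root Ks K0
         * ((rho ^+ (2 * M) - 1) / (rho ^+ 2 - 1)) * (2 * rho + 1)
         * spectral_norm (Sigma S) * Num.max (spectral_norm (C *m A)) 1)
    <= Num.min 1 sg /\
  eta * (4 * innov_bound K0 * (2^-1 + constB S f K0)) <= 1.
Proof.
move=> fs b0; rewrite le_min => /andP[h3 h4] rho; split; last first.
  move: h4; rewrite lee_fin /c4 -/(innov_bound K0) => h4.
  have e0 : 0 < 4 * innov_bound K0 * (2^-1 + constB S f K0).
    apply: mulr_gt0; first by apply: mulr_gt0 => //; exact: innov_bound_gt0.
    by apply: ltr_wpDr; [exact: constB_ge0|rewrite invr_gt0].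
  by rewrite -ler_pdivlMr// div1r.
move: h3; rewrite /c3 -/rho -/(gap_root Ks K0).
set den := 2 * _ * _ * _ * _ * _ * _ => h3.
have rho1 : 1 < rho by rewrite /rho /rho_max lt_max; apply/orP; right; lra.
have rho0 : 0 < rho := lt_trans ltr01 rho1.
have rho21 : 0 < rho ^+ 2 - 1 by rewrite subr_gt0 expr_gt1// ltW.
have den0 : 0 < den.
  have g0 : 0 < gap_root Ks K0.
    rewrite /gap_root sqrtr_gt0 c2E; apply: mulr_gt0; last by rewrite subr_gt0.
    apply: mulr_gt0; first by rewrite ltr0n.
    by apply: divr_gt0 sg_gt0; apply: mulr_gt0 => //; exact: innov_bound_gt0.
  have G0 : 0 < (rho ^+ (2 * M) - 1) / (rho ^+ 2 - 1).
    by apply: divr_gt0 => //; rewrite subr_gt0 exprn_egt1// -lt0n muln_gt0 hM.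
  have s0 : 0 < spectral_norm (Sigma S) := lt_le_trans sg_gt0 sg_le_Sigma.
  have m0 : 0 < Num.max (spectral_norm (C *m A)) 1 by rewrite lt_max ltr01 orbT.
  have r0 : 0 < 2 * rho + 1 by lra.
  have t0 : 0 < 2 :> R by [].
  exact: mulr_gt0 (mulr_gt0 (mulr_gt0 (mulr_gt0 (mulr_gt0 (mulr_gt0 t0
    (constB_gt0 _)) g0) G0) r0) s0) m0.
move: h3; rewrite inver gt_eqF// -EFinM lee_fin.
by rewrite ler_pdivlMr.
Qed.

(** [g] is the sampling error. It is controlled only at gains in the sublevel set of [K0], so the
    induction also has to show that the iterates stay there. *)
Lemma sgd_linear_rate Ks K0 b eta : is_minimizer f Ks -> f Ks < f K0 ->
  0 < b -> 0 < eta ->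
  (eta%:E <= Order.min (c3 S f P0 Ks K0 b) (c4 S f P0 K0)%:E)%E ->
  exists2 s1, 0 < s1 & forall (Kq : nat -> gain R M N m)
      (g : nat -> gain R M N m) (epsilon sl : R),
    0 < epsilon -> 0 <= sl -> sl <= s1 -> sl ^+ 2 <= s1 * epsilon ->
    Kq 0%N = K0 ->
    (forall k, Kq k.+1 = fun i => Kq k i - eta *: (policy_grad (Kq k) i + g k i)) ->
    (forall k i, f (Kq k) <= f K0 -> Num.sqrt (fn2 (g k i)) <= sl) ->
    forall k, (forall j, (j <= k)%N -> epsilon <= f (Kq j) - f Ks) ->
    f (Kq k) - f Ks <= (1 - eta / (8 * c1 S f Ks)) ^+ k * (f K0 - f Ks).
Proof.
move=> minKs fs b0 eta0 /(step_size_bounds fs b0)[H3 H4].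
have M0 : 0 < M%:R :> R by rewrite ltr0n.
set c := c1 S f Ks; have c0 : 0 < c := c1_gt0 Ks.
have g0 : 0 < gap_root Ks K0.
  rewrite /gap_root sqrtr_gt0 c2E; apply: mulr_gt0; last by rewrite subr_gt0.
  apply: mulr_gt0 => //; apply: divr_gt0 sg_gt0.
  by apply: mulr_gt0 => //; exact: innov_bound_gt0.
have B00 := constB_gt0 K0.
(* [sa] keeps the sampling error below a twentieth of the bound for the exact step. In [sb], 260 is
   16 times 65/4: the loss 65/4 of [descent_step] then costs 1/16 of the squared gradient, and 3/16
   - 1/16 = 1/8 is the 1/8 of the rate. *)
pose sa := constB S f K0 * gap_root Ks K0 / 20 / M%:R.
pose sb := (260 * M%:R * c)^-1.
have sa0 : 0 < sa by rewrite /sa !divr_gt0// mulr_gt0.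
have sb0 : 0 < sb.
  by rewrite invr_gt0; apply: mulr_gt0 c0; apply: mulr_gt0; rewrite ?ltr0n.
exists (Num.min sa sb); first by rewrite lt_min sa0 sb0.
move=> Kq g e sl e0 sl0; rewrite le_min => /andP[sla _] sl2 Kq0 KqS gsl.
have {}sl2 : sl ^+ 2 <= sb * e.
  by apply: le_trans sl2 _; rewrite ler_wpM2r ?(ltW e0)// ge_min lexx orbT.
have step k : f (Kq k) <= f K0 -> e <= f (Kq k) - f Ks ->
    f (Kq k.+1) - f Ks <= (1 - eta / (8 * c)) * (f (Kq k) - f Ks).
  move=> KK0 Ke; set K := Kq k in KK0 Ke *.
  pose gt t := gain_at (g k) t.
  have gts t : Num.sqrt (fn2 (gt t)) <= sl.
    rewrite /gt; have [tM|tM] := ltnP t M.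
      by rewrite (gain_at_ord _ (Ordinal tM)) gsl.
    by rewrite gain_at_ge// fip0r sqrtr0.
  have Msl : M%:R * sl <= constB S f K0 * gap_root Ks K0 / 20.
    by rewrite mulrC -ler_pdivlMr.
  have := descent_step minKs KK0 b0 (ltW eta0) sl0 H3 H4 gts Msl.
  have -> : (fun i : 'I_M => K i - eta *: (policy_grad K i + gt i)) = Kq k.+1.
    by rewrite KqS; apply/funext => i; rewrite /gt gain_at_ord.
  have PL := polyak_lojasiewicz K Ks; rewrite -/c in PL.
  set Sa := \sum_(_ <= _ < _) fn2 (policy_grad _ _) in PL *.
  set Sg := \sum_(_ <= _ < _) fn2 (gt _).
  have Sg1 : Sg <= M%:R * sl ^+ 2.
    apply: (@le_trans _ _ (\sum_(0 <= t < M) sl ^+ 2)).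
      apply: ler_sum => t _; rewrite -[leLHS]sqr_sqrtr ?fn2_ge0//.
      by rewrite ler_pXn2r// nnegrE sqrtr_ge0.
    by rewrite sumr_const_nat subn0 mulr_natl.
  (* Here the gap being at least [e] is used: by gradient domination the absolute error becomes
     small relative to the gradient. *)
  have Sg2 : Sg <= Sa / 260.
    apply: le_trans Sg1 _; apply: le_trans (ler_wpM2l (ltW M0) sl2) _.
    have -> : M%:R * (sb * e) = e / c / 260 by rewrite /sb; field; rewrite !gt_eqF.
    rewrite ler_pM2r ?invr_gt0 ?ltr0n// ler_pdivrMr// mulrC; exact: le_trans Ke PL.
  have Sa1 : (f K - f Ks) / c <= Sa by rewrite ler_pdivrMr// mulrC.
  have h1 : 0 <= Sa / 260 - Sg by lra.
  have h2 : 0 <= Sa - (f K - f Ks) / c by lra.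
  have := mulr_ge0 (ltW eta0) h1; have := mulr_ge0 (ltW eta0) h2.
  have -> : (1 - eta / (8 * c)) * (f K - f Ks) =
    (f K - f Ks) - eta * ((f K - f Ks) / c) / 8 by field; rewrite gt_eqF.
  set z := (f K - f Ks) / c; move=> q1 q2 q3; rewrite /= in q3; lra.
suff main k : (forall j, (j <= k)%N -> e <= f (Kq j) - f Ks) ->
   f (Kq k) <= f K0 /\
   f (Kq k) - f Ks <= (1 - eta / (8 * c)) ^+ k * (f K0 - f Ks).
  by move=> k /main[].
elim: k => [|k IH] He; first by rewrite Kq0 expr0 mul1r.
have [KK0 Kr] := IH (fun j jk => He j (leqW jk)).
have Ke := He k (leqnSn k); have Ke' := He k.+1 (leqnn _).
have H := step k KK0 Ke.
(* The factor times a positive gap dominates the next gap, which is at least [e]; so the factor is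
   nonnegative. *)
have ge0 : 0 <= 1 - eta / (8 * c).
  have p : 0 < f (Kq k) - f Ks by exact: lt_le_trans Ke.
  by rewrite -(pmulr_lge0 _ p) (le_trans _ H)// (le_trans _ Ke')// ltW.
have r1 : 0 <= eta / (8 * c) by rewrite divr_ge0 ?(ltW eta0)// mulr_ge0// ltW.
split.
  have p : 0 <= f (Kq k) - f Ks by rewrite (le_trans (ltW e0)).
  move: (mulr_ge0 r1 p) H; set r := eta / _; lra.
by rewrite exprS -mulrA; apply: le_trans H _; rewrite ler_wpM2l.
Qed.

End Bounds.

(** * Gaussian integrals *)

Section WeightedIntegral.
Import HBNNSimple.
Variables (R : realType) (d : measure_display) (T : measurableType d).
Variables (d' : measure_display) (T' : measurableType d').
Variables (mu : {measure set T -> \bar R}) (nu : {measure set T' -> \bar R}).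
Variables (h : T -> R) (X : T -> T') (c : R).
Hypotheses (mh : measurable_fun setT h) (mX : measurable_fun setT X).
Hypothesis h0 : forall w, 0 <= h w.
Hypothesis hX : forall B : set T', measurable B ->
  (\int[mu]_w (h w * \1_(X @^-1` B) w)%:E = c%:E * nu B)%E.

Let weighted_simple (f : {nnsfun T' >-> R}) :
  (\int[mu]_w (h w * f (X w))%:E = c%:E * \int[nu]_x (f x)%:E)%E.
Proof.
set s := fset_set (f @` setT).
have s_ge0 (i : 'I_#|`s|) : 0 <= s`_i.
  have : s`_i \in s by rewrite mem_nth.
  by rewrite in_fset_set// inE => -[x _ <-].
have mpre (y : R) : measurable (f @^-1` [set y]) by [].
have mXpre (y : R) : measurable (X @^-1` (f @^-1` [set y])).
  by rewrite -[X in measurable X]setTI; exact: mX.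
have fE := fimfunEord f; rewrite -/s in fE.
under eq_integral => w _ do rewrite fE mulr_sumr -sumEFin.
under [in RHS]eq_integral => w _ do rewrite fE -sumEFin.
rewrite !ge0_integral_sum//.
- rewrite ge0_sume_distrr; last first.
    by move=> i _; apply: integral_ge0 => x _; rewrite lee_fin mulr_ge0.
  apply: eq_bigr => i _.
  under eq_integral => w _ do rewrite mulrCA EFinM.
  under [in RHS]eq_integral => w _ do rewrite EFinM.
  rewrite !ge0_integralZl_EFin//.
  + rewrite integral_indic// setIT muleCA; congr (_ * _)%E.
    exact: (hX (mpre s`_i)).
  + exact/measurable_EFinP/measurable_indic.
  + by move=> w _; rewrite lee_fin mulr_ge0.
  + apply/measurable_EFinP/measurable_funM => //.
    by apply: measurableT_comp => //; exact: measurable_indic.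
- by move=> i; apply/measurable_EFinP/measurable_funM => //.
- by move=> i x _; rewrite lee_fin mulr_ge0.
- move=> i; apply/measurable_EFinP/measurable_funM => //.
  apply: measurable_funM => //; apply: measurableT_comp => //; exact: measurable_indic.
- by move=> i x _; rewrite lee_fin !mulr_ge0.
Qed.

(** Monotone convergence extends the identity [hX] from indicators to nonnegative functions. The
    weight is a density when [X] is the identity, and the product of the remaining factors in
    [mixed_prod]. *)
Lemma ge0_integral_weighted (phi : T' -> R) :
  measurable_fun setT phi -> (forall x, 0 <= phi x) ->
  (\int[mu]_w (h w * phi (X w))%:E = c%:E * \int[nu]_x (phi x)%:E)%E.
Proof.
move=> mphi phi0.
have mphi' : measurable_fun setT (EFin \o phi) by exact/measurable_EFinP.
pose a n : {nnsfun T' >-> R} := nnsfun_approx measurableT mphi' n.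
have acvg x : (a n x)%:E @[n --> \oo] --> (phi x)%:E.
  exact: (cvg_nnsfun_approx measurableT mphi' (fun x _ => phi0 x)).
have and_ : nondecreasing_seq (fun n => a n : T' -> R) := nd_nnsfun_approx measurableT mphi'.
have and' x m n : (m <= n)%N -> a m x <= a n x.
  by move=> mn; have /lefP := and_ _ _ mn; exact.
have r1 : (\int[nu]_x (a n x)%:E)%E @[n --> \oo] --> (\int[nu]_x (phi x)%:E)%E.
  rewrite (_ : (\int[nu]_x _)%E = (\int[nu]_x limn (fun n => (a n x)%:E))%E); last first.
    by apply: eq_integral => x _; apply/esym/cvg_lim => //; exact: acvg.
  apply: cvg_monotone_convergence => //.
  - by move=> n; exact/measurable_EFinP.
  - by move=> n x _; rewrite lee_fin.
  - by move=> x _ m n mn; rewrite lee_fin and'.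
have r2 : (\int[mu]_w (h w * a n (X w))%:E)%E @[n --> \oo] -->
    (\int[mu]_w (h w * phi (X w))%:E)%E.
  rewrite (_ : (\int[mu]_x (h x * phi _)%:E)%E =
      (\int[mu]_x limn (fun n => (h x * a n (X x))%:E))%E); last first.
    apply: eq_integral => x _; apply/esym/cvg_lim => //.
    rewrite EFinM; under eq_fun do rewrite EFinM.
    by apply: cvgeZl => //; exact: acvg.
  apply: cvg_monotone_convergence => //.
  - move=> n; apply/measurable_EFinP/measurable_funM => //.
    exact: measurableT_comp.
  - by move=> n x _; rewrite lee_fin mulr_ge0.
  - by move=> x _ m n mn; rewrite lee_fin ler_wpM2l ?and'.
have r3 : (\int[mu]_w (h w * a n (X w))%:E)%E @[n --> \oo] -->
    (c%:E * \int[nu]_x (phi x)%:E)%E.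
  by under eq_fun do rewrite weighted_simple; exact: cvgeZl.
by rewrite -(cvg_lim _ r2)// (cvg_lim _ r3).
Qed.
End WeightedIntegral.

Section GaussianIntegrals.
Variable R : realType.

Lemma ge0_integral_normal (m s : R) (phi : R -> R) :
  measurable_fun setT phi -> (forall x, 0 <= phi x) ->
  (\int[normal_prob m s]_x (phi x)%:E =
   \int[lebesgue_measure]_x (normal_pdf m s x * phi x)%:E)%E.
Proof.
move=> mphi phi0.
have := @ge0_integral_weighted R _ _ _ _ lebesgue_measure (normal_prob m s)
  (normal_pdf m s) id 1 (measurable_normal_pdf m s) (@measurable_id _ _ setT)
  (normal_pdf_ge0 m s) _ phi mphi phi0.
rewrite mul1e => ->// B mB; rewrite mul1e /normal_prob [RHS]integral_mkcond.
apply: eq_integral => x _; rewrite /= patchE indicE.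
by case: ifPn => xB; rewrite ?mulr1 ?mulr0.
Qed.

Lemma normal_pdf_neq0 (m s x : R) : s != 0 ->
  normal_pdf m s x = normal_peak s * normal_fun m s x.
Proof. by move=> s0; rewrite /normal_pdf (negbTE s0). Qed.

(** Completing the square, the exponential weight shifts the mean by s^2 t. *)
Lemma normal_mgf (m s t : R) : s != 0 ->
  (\int[normal_prob m s]_x (expR (t * (x - m)))%:E = (expR (s ^+ 2 * t ^+ 2 / 2))%:E)%E.
Proof.
move=> s0; rewrite ge0_integral_normal; last by move=> x; exact: expR_ge0.
  rewrite (_ : (\int[_]_x _)%E = (\int[lebesgue_measure]_x
      ((expR (s ^+ 2 * t ^+ 2 / 2))%:E * (normal_pdf (m + s ^+ 2 * t) s x)%:E))%E).
    rewrite ge0_integralZl_EFin ?expR_ge0//.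
    - by rewrite integral_normal_pdf mule1.
    - by move=> x _; rewrite lee_fin normal_pdf_ge0.
    - by apply/measurable_EFinP; exact: measurable_normal_pdf.
  apply: eq_integral => x _; rewrite -EFinM; congr (_%:E).
  rewrite !normal_pdf_neq0// /normal_fun -(mulrA (normal_peak s)) -expRD mulrCA -expRD.
  by congr (_ * expR _); field.
by apply: measurableT_comp => //; apply: measurable_funM => //; exact: measurable_funB.
Qed.

(** With a = 1 - 2 l s^2, the weight turns the density into 1/sqrt a times the normal density of
    standard deviation s/sqrt a. *)
Lemma normal_exp_sqr (m s l : R) : s != 0 -> 2 * l * s ^+ 2 < 1 ->
  (\int[normal_prob m s]_x (expR (l * (x - m) ^+ 2))%:E =
   ((Num.sqrt (1 - 2 * l * s ^+ 2))^-1)%:E)%E.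
Proof.
move=> s0 ls; rewrite ge0_integral_normal; last by move=> x; exact: expR_ge0.
  set a := 1 - 2 * l * s ^+ 2; have a0 : 0 < a by rewrite subr_gt0.
  pose s' := s / Num.sqrt a.
  have sa0 : 0 < Num.sqrt a by rewrite sqrtr_gt0.
  have s'0 : s' != 0 by rewrite mulf_neq0// invr_eq0 gt_eqF.
  rewrite (_ : (\int[_]_x _)%E = (\int[lebesgue_measure]_x
      ((Num.sqrt a)^-1%:E * (normal_pdf m s' x)%:E))%E).
    rewrite ge0_integralZl_EFin ?invr_ge0 ?sqrtr_ge0//.
    - by rewrite integral_normal_pdf mule1.
    - by move=> x _; rewrite lee_fin normal_pdf_ge0.
    - by apply/measurable_EFinP; exact: measurable_normal_pdf.
  apply: eq_integral => x _; rewrite -EFinM; congr (_%:E).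
  have s'2 : s' ^+ 2 = s ^+ 2 / a by rewrite expr_div_n sqr_sqrtr// ltW.
  rewrite !normal_pdf_neq0// /normal_fun -(mulrA (normal_peak s)) -expRD [RHS]mulrA; congr (_ * expR _).
    rewrite /normal_peak s'2 -invfM -sqrtrM ?(ltW a0)//; congr (Num.sqrt _)^-1.
    by field; rewrite gt_eqF.
  by rewrite s'2 /a; field; rewrite s0 andbT gt_eqF.
apply: measurableT_comp => //; apply: measurable_funM => //.
by apply: measurable_funX; exact: measurable_funB.
Qed.

Lemma ge0_integral_gaussian d (T : measurableType d) (P : probability T R)
    (Y : T -> R) (m v : R) (phi : R -> R) : measurable_fun setT Y ->
  (forall B, measurable B -> P (Y @^-1` B) = gaussian_law m v B) ->
  measurable_fun setT phi -> (forall x, 0 <= phi x) ->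
  (\int[P]_w (phi (Y w))%:E = if v == 0%R then (phi m)%:E
     else \int[normal_prob m (Num.sqrt v)]_x (phi x)%:E)%E.
Proof.
move=> mY PY mphi phi0.
have hY (B : set R) : measurable B ->
    (\int[P]_w (1 * \1_(Y @^-1` B) w)%:E = P (Y @^-1` B))%E.
  move=> mB; under eq_integral do rewrite mul1r.
  rewrite integral_indic ?setIT//.
  by rewrite -[X in measurable X]setTI; exact: mY.
have E1 : (\int[P]_w (phi (Y w))%:E = \int[P]_w (1 * phi (Y w))%:E)%E.
  by apply: eq_integral => w _; rewrite mul1r.
rewrite E1 /gaussian_law in PY *; case: ifPn PY => [_|v0] PY.
  rewrite (@ge0_integral_weighted R _ T _ _ P (dirac m) (cst 1) Y 1)//; last first.
    by move=> B mB; rewrite hY// PY// mul1e.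
  rewrite mul1e integral_dirac// ?diracT ?mul1e//.
  exact/measurable_EFinP.
rewrite (@ge0_integral_weighted R _ T _ _ P (normal_prob m (Num.sqrt v)) (cst 1) Y 1)//.
  by rewrite mul1e.
by move=> B mB; rewrite hY// PY// mul1e.
Qed.

Lemma gaussian_mgf d (T : measurableType d) (P : probability T R)
    (Y : T -> R) (m v t : R) : measurable_fun setT Y -> 0 <= v ->
  (forall B, measurable B -> P (Y @^-1` B) = gaussian_law m v B) ->
  (\int[P]_w (expR (t * (Y w - m)))%:E = (expR (v * t ^+ 2 / 2))%:E)%E.
Proof.
move=> mY v0 PY; rewrite (ge0_integral_gaussian (phi := fun x => expR (t * (x - m))) mY PY).
- case: eqVneq => [->|vn0]; first by rewrite subrr mulr0 !mul0r expR0.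
  rewrite normal_mgf ?sqr_sqrtr// gt_eqF// sqrtr_gt0 lt_def vn0//.
- by apply: measurableT_comp => //; apply: measurable_funM => //; exact: measurable_funB.
- by move=> x; exact: expR_ge0.
Qed.

Lemma gaussian_exp_sqr d (T : measurableType d) (P : probability T R)
    (Y : T -> R) (m v l : R) : measurable_fun setT Y -> 0 <= v ->
  (forall B, measurable B -> P (Y @^-1` B) = gaussian_law m v B) ->
  2 * l * v < 1 ->
  (\int[P]_w (expR (l * (Y w - m) ^+ 2))%:E = ((Num.sqrt (1 - 2 * l * v))^-1)%:E)%E.
Proof.
move=> mY v0 PY lv.
rewrite (ge0_integral_gaussian (phi := fun x => expR (l * (x - m) ^+ 2)) mY PY).
- case: eqVneq => [->|vn0].
    by rewrite subrr expr0n /= !mulr0 expR0 subr0 sqrtr1 invr1.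
  rewrite normal_exp_sqr ?sqr_sqrtr// gt_eqF// sqrtr_gt0 lt_def vn0//.
- apply: measurableT_comp => //; apply: measurable_funM => //.
  by apply: measurable_funX; exact: measurable_funB.
- by move=> x; exact: expR_ge0.
Qed.

End GaussianIntegrals.

(** * Independence and concentration *)

Section Expectation.
Variables (R : realType) (d : measure_display) (T : measurableType d).
Variable P : probability T R.
Implicit Types X Y : T -> R.

Definition L1 X : Prop := P.-integrable setT (EFin \o X).
Definition Ex X : R := \int[P]_w X w.

Lemma L1_meas X : L1 X -> measurable_fun setT X.
Proof. by move=> /measurable_int/measurable_EFinP. Qed.

Lemma L1_le X Y : measurable_fun setT X -> (forall w, `|X w| <= Y w) -> L1 Y -> L1 X.
Proof.
move=> mX XY; apply: le_integrable => //; first exact/measurable_EFinP.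
move=> w _ /=; rewrite lee_fin (le_trans (XY w))//; exact: ler_norm.
Qed.

Lemma L1_lty X : measurable_fun setT X -> (forall w, 0 <= X w) ->
  (\int[P]_w (X w)%:E < +oo)%E -> L1 X.
Proof.
move=> mX X0 Xoo; apply/integrableP; split; first exact/measurable_EFinP.
rewrite (_ : (\int[P]_w _)%E = (\int[P]_w (X w)%:E)%E)//.
by apply: eq_integral => w _ /=; rewrite ger0_norm.
Qed.

Lemma Ex_EFin X : L1 X -> (\int[P]_w (X w)%:E)%E = (Ex X)%:E.
Proof. by move=> iX; rewrite /Ex /Rintegral fineK// integrable_fin_num. Qed.

Lemma Ex_expectation X : fine ('E_P[X])%E = Ex X.
Proof. by rewrite unlock. Qed.

Lemma L1D X Y : L1 X -> L1 Y -> L1 (fun w => X w + Y w).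
Proof. by move=> iX iY; have := integrableD measurableT iX iY. Qed.

Lemma L1Z a X : L1 X -> L1 (fun w => a * X w).
Proof. by move=> iX; have := integrableZl measurableT a iX. Qed.

Lemma L1_cst a : L1 (fun=> a).
Proof. by apply: finite_measure_integrable_cst. Qed.

Lemma L1N X : L1 X -> L1 (fun w => - X w).
Proof. by move=> /(L1Z (-1)); congr L1; apply/funext => w; rewrite mulN1r. Qed.

Lemma L1_sum I (s : seq I) (F : I -> T -> R) : (forall i, L1 (F i)) ->
  L1 (fun w => \sum_(i <- s) F i w).
Proof.
move=> iF; elim: s => [|i s IH].
  by under eq_fun do rewrite big_nil; exact: L1_cst.
by under eq_fun do rewrite big_cons; exact: L1D.
Qed.

Lemma ExD X Y : L1 X -> L1 Y -> Ex (fun w => X w + Y w) = Ex X + Ex Y.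
Proof. by move=> iX iY; exact: RintegralD. Qed.

Lemma ExZ a X : L1 X -> Ex (fun w => a * X w) = a * Ex X.
Proof. by move=> iX; exact: RintegralZl. Qed.

Lemma Ex_cst a : Ex (fun=> a) = a.
Proof.
by rewrite /Ex Rintegral_cst// [X in fine X](_ : _ = 1%E) ?mulr1//; exact: probability_setT.
Qed.

Lemma ExN X : L1 X -> Ex (fun w => - X w) = - Ex X.
Proof.
move=> iX; rewrite -mulN1r -ExZ//; congr Ex.
by apply/funext => w; rewrite mulN1r.
Qed.

Lemma Ex_sum I (s : seq I) (F : I -> T -> R) : (forall i, L1 (F i)) ->
  Ex (fun w => \sum_(i <- s) F i w) = \sum_(i <- s) Ex (F i).
Proof.
move=> iF; elim: s => [|i s IH].
  by rewrite big_nil -[RHS](Ex_cst 0); congr Ex; apply/funext => w; rewrite big_nil.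
rewrite big_cons -IH -ExD//; last exact: L1_sum.
by congr Ex; apply/funext => w; rewrite big_cons.
Qed.

Lemma Ex_le X Y : L1 X -> L1 Y -> (forall w, X w <= Y w) -> Ex X <= Ex Y.
Proof. by move=> iX iY XY; apply: le_Rintegral. Qed.

Lemma Ex_ge0 X : (forall w, 0 <= X w) -> 0 <= Ex X.
Proof. by move=> X0; apply: Rintegral_ge0. Qed.

Definition L2 X : Prop := measurable_fun setT X /\ L1 (fun w => X w ^+ 2).

Lemma L2D X Y : L2 X -> L2 Y -> L2 (fun w => X w + Y w).
Proof.
move=> [mX iX] [mY iY]; split; first exact: measurable_funD.
apply: (@L1_le _ (fun w => 2 * (X w ^+ 2 + Y w ^+ 2))).
- by apply: measurable_funX; exact: measurable_funD.
- move=> w; rewrite ger0_norm ?sqr_ge0//; have := sqr_ge0 (X w - Y w).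
  by rewrite !expr2; lra.
- exact/L1Z/L1D.
Qed.

Lemma L2Z a X : L2 X -> L2 (fun w => a * X w).
Proof.
move=> [mX iX]; split; first exact: measurable_funM.
by under eq_fun do rewrite exprMn; exact: L1Z.
Qed.

Lemma L2_cst a : L2 (fun=> a).
Proof. by split; [exact: measurable_cst|exact: L1_cst]. Qed.

Lemma L2_sum I (s : seq I) (F : I -> T -> R) : (forall i, L2 (F i)) ->
  L2 (fun w => \sum_(i <- s) F i w).
Proof.
move=> iF; elim: s => [|i s IH].
  by under eq_fun do rewrite big_nil; exact: L2_cst.
by under eq_fun do rewrite big_cons; exact: L2D.
Qed.

Lemma L2_mul X Y : L2 X -> L2 Y -> L1 (fun w => X w * Y w).
Proof.
move=> [mX iX] [mY iY]; apply: (L1_le _ _ (L1D iX iY)).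
  exact: measurable_funM.
move=> w; have := sqr_ge0 (X w - Y w); have := sqr_ge0 (X w + Y w).
by have := sqr_ge0 (X w); have := sqr_ge0 (Y w); rewrite ler_norml !expr2; lra.
Qed.

Lemma L2_L1 X : L2 X -> L1 X.
Proof.
move=> X2; have := L2_mul X2 (L2_cst 1); congr L1.
by apply/funext => w; rewrite mulr1.
Qed.

Definition L2v p (u : T -> 'cV[R]_p) : Prop := forall i, L2 (fun w => u w i 0).
(** Uncentred; a covariance as soon as one of the two vectors has mean zero. *)
Definition cross p q (u : T -> 'cV[R]_p) (v : T -> 'cV[R]_q) : 'M[R]_(p, q) :=
  \matrix_(i, j) Ex (fun w => u w i 0 * v w j 0).

Lemma L2v_cst p (u : 'cV[R]_p) : L2v (fun=> u).
Proof. by move=> i; exact: L2_cst. Qed.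

Lemma L2vD p (u v : T -> 'cV[R]_p) : L2v u -> L2v v -> L2v (fun w => u w + v w).
Proof.
by move=> u2 v2 i; under eq_fun do rewrite mxE; apply: L2D.
Qed.

Lemma L2vM p q (B : 'M[R]_(p, q)) (u : T -> 'cV[R]_q) :
  L2v u -> L2v (fun w => B *m u w).
Proof.
move=> u2 i; under eq_fun do rewrite mxE.
by apply: L2_sum => j; apply: L2Z.
Qed.

Lemma L2vN p (u : T -> 'cV[R]_p) : L2v u -> L2v (fun w => - u w).
Proof.
by move=> u2 i; under eq_fun do rewrite mxE -mulN1r; apply: L2Z.
Qed.

Lemma L2vB p (u v : T -> 'cV[R]_p) : L2v u -> L2v v -> L2v (fun w => u w - v w).
Proof. by move=> u2 v2; apply: L2vD => //; exact: L2vN. Qed.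

Lemma cross_tr p q (u : T -> 'cV[R]_p) (v : T -> 'cV[R]_q) :
  (cross u v)^T = cross v u.
Proof.
apply/matrixP => i j; rewrite !mxE; congr Ex.
by apply/funext => w; rewrite mulrC.
Qed.

Lemma crossDl p q (u u' : T -> 'cV[R]_p) (v : T -> 'cV[R]_q) :
  L2v u -> L2v u' -> L2v v ->
  cross (fun w => u w + u' w) v = cross u v + cross u' v.
Proof.
move=> u2 u2' v2; apply/matrixP => i j; rewrite !mxE -ExD; try exact: L2_mul.
by congr Ex; apply/funext => w; rewrite mxE mulrDl.
Qed.

Lemma crossMl p q r (B : 'M[R]_(p, r)) (u : T -> 'cV[R]_r) (v : T -> 'cV[R]_q) :
  L2v u -> L2v v -> cross (fun w => B *m u w) v = B *m cross u v.
Proof.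
move=> u2 v2; apply/matrixP => i j; rewrite !mxE.
rewrite (eq_bigr (fun k => Ex (fun w => B i k * (u w k 0 * v w j 0)))); last first.
  by move=> k _; rewrite mxE ExZ//; exact: L2_mul.
rewrite -Ex_sum; last by move=> k; apply: L1Z; exact: L2_mul.
by congr Ex; apply/funext => w; rewrite mxE mulr_suml; apply: eq_bigr => k _; rewrite mulrA.
Qed.

Lemma crossNl p q (u : T -> 'cV[R]_p) (v : T -> 'cV[R]_q) :
  L2v u -> L2v v -> cross (fun w => - u w) v = - cross u v.
Proof.
move=> u2 v2; apply/matrixP => i j; rewrite !mxE -ExN; last exact: L2_mul.
by congr Ex; apply/funext => w; rewrite mxE mulNr.
Qed.

Lemma crossDr p q (u : T -> 'cV[R]_p) (v v' : T -> 'cV[R]_q) :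
  L2v u -> L2v v -> L2v v' ->
  cross u (fun w => v w + v' w) = cross u v + cross u v'.
Proof.
by move=> u2 v2 v2'; rewrite -[LHS]trmxK cross_tr crossDl// linearD /= !cross_tr.
Qed.

Lemma crossMr p q r (B : 'M[R]_(p, r)) (u : T -> 'cV[R]_q) (v : T -> 'cV[R]_r) :
  L2v u -> L2v v -> cross u (fun w => B *m v w) = cross u v *m B^T.
Proof.
by move=> u2 v2; rewrite -[LHS]trmxK cross_tr crossMl// trmx_mul cross_tr.
Qed.

Lemma Ex_trace_cross p q (u : T -> 'cV[R]_p) (v : T -> 'cV[R]_q) (B : 'M[R]_(q, p)) :
  L2v u -> L2v v ->
  L1 (fun w => \tr (u w *m (v w)^T *m B)) /\
  Ex (fun w => \tr (u w *m (v w)^T *m B)) = \tr (cross u v *m B).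
Proof.
move=> u2 v2; have E w : \tr (u w *m (v w)^T *m B) =
    \sum_i \sum_j B j i * (u w i 0 * v w j 0).
  apply: eq_bigr => i _; rewrite mxE; apply: eq_bigr => j _.
  by rewrite mxE big_ord1 mxE mulrC.
have iE i j : L1 (fun w => B j i * (u w i 0 * v w j 0)).
  by apply: L1Z; exact: L2_mul.
split; first by rewrite (funext E); do 2?(apply: L1_sum => ?).
rewrite (funext E) Ex_sum; last by move=> i; exact: L1_sum.
apply: eq_bigr => i _; rewrite Ex_sum// mxE; apply: eq_bigr => j _.
by rewrite ExZ ?mxE 1?mulrC//; exact: L2_mul.
Qed.

End Expectation.

(** * Product formulas for independent variables *)

Section IndependentProducts.
Variables (R : realType) (d : measure_display) (T : measurableType d).
Variable P : probability T R.

Lemma prod_indic (I : Type) (s : seq I) (E : I -> set T) w :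
  \prod_(i <- s) (\1_(E i) w : R) = \1_(\big[setI/setT]_(i <- s) E i) w.
Proof.
elim: s => [|i s IH]; first by rewrite !big_nil indicT.
by rewrite !big_cons IH indicI.
Qed.

Variables (I : eqType) (F : I -> set (set T)) (g : I -> T -> R).
Hypothesis indF : mutually_independent P F.
Hypothesis mF : forall i A, F i A -> measurable A.
Hypothesis g0 : forall i w, 0 <= g i w.
Hypothesis gF : forall i B, measurable B -> F i (g i @^-1` B).
Hypothesis gL1 : forall i, L1 P (g i).

(** Induction on the number of factors that are functions rather than indicators. Taking for factor
    [i] the indicator of the preimage of an arbitrary [B] determines the law of [g i] weighted by
    the other factors; integrating against that law puts [g i] itself in. *)
Let mixed_prod (s1 s2 : seq I) (E : I -> set T) : uniq (s1 ++ s2) ->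
  (forall i, i \in s2 -> F i (E i)) ->
  (\int[P]_w ((\prod_(i <- s1) g i w) * \prod_(i <- s2) \1_(E i) w)%:E =
   ((\prod_(i <- s1) Ex P (g i)) * \prod_(i <- s2) fine (P (E i)))%:E)%E.
Proof.
elim: s1 s2 E => [|i s1 IH] s2 E us FE.
  rewrite big_nil mul1r.
  have mI : measurable (\big[setI/setT]_(j <- s2) E j).
    rewrite big_seq; apply: big_ind => //; first exact: measurableI.
    by move=> j js; exact: mF (FE _ js).
  under eq_integral do rewrite big_nil mul1r prod_indic.
  rewrite integral_indic// setIT; apply: etrans (indF us FE) _.
  rewrite -prodEFin; apply: eq_big_seq => j js.
  by rewrite fineK// fin_num_measure//; exact: mF (FE _ js).
have /andP[iNs us'] : (i \notin s1 ++ s2) && uniq (s1 ++ s2) := us.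
have uis : uniq (s1 ++ i :: s2) by rewrite (perm_uniq (permEl (perm_catCA s1 [:: i] s2))).
have mX : measurable_fun setT (g i) := L1_meas (gL1 i).
pose X : {RV P >-> R} := mfun_Sub (mem_set mX).
have is2 : i \notin s2 by move: iNs; rewrite mem_cat negb_or => /andP[].
pose h w := (\prod_(j <- s1) g j w) * \prod_(j <- s2) \1_(E j) w.
pose c := (\prod_(j <- s1) Ex P (g j)) * \prod_(j <- s2) fine (P (E j)).
have mh : measurable_fun setT h.
  apply: measurable_funM; first by apply: measurable_prod => j _; exact: L1_meas.
  rewrite (_ : (fun w => _) = \1_(\big[setI/setT]_(j <- s2) E j)); last first.
    by apply/funext => w; rewrite prod_indic.
  apply: measurable_indic; rewrite big_seq; apply: big_ind => //; first exact: measurableI.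
  by move=> j js; exact: mF (FE _ js).
have h0 w : 0 <= h w.
  rewrite mulr_ge0// prodr_ge0// => j _; exact: g0.
have hX (B : set R) : measurable B ->
    (\int[P]_w (h w * \1_(X @^-1` B) w)%:E = c%:E * distribution P X B)%E.
  move=> mB; pose E' j := if j == i then g i @^-1` B else E j.
  have FE' j : j \in i :: s2 -> F j (E' j).
    rewrite inE /E'; case: eqVneq => [-> _|_ /=]; [exact: gF|exact: FE].
  have E'i : E' i = g i @^-1` B by rewrite /E' eqxx.
  have E's2 (G : set T -> R) : \prod_(j <- s2) G (E' j) = \prod_(j <- s2) G (E j).
    by apply: eq_big_seq => j js; rewrite /E' ifN//; apply: contraNneq is2 => <-.
  have := IH (i :: s2) E' uis FE'.
  rewrite big_cons (E's2 (fun A => fine (P A))) E'i mulrCA EFinM.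
  rewrite fineK; last by rewrite fin_num_measure//; exact: mF (gF i mB).
  rewrite muleC => <-; apply: eq_integral => w _; rewrite big_cons E'i.
  by rewrite (E's2 (fun A => \1_A w)) mulrCA mulrA mulrC mulrA.
(* The test function must be nonnegative on the whole line; the positive part agrees with the
   identity on the values of [g i]. *)
have mmax : measurable_fun setT (fun x : R => Num.max x 0).
  exact: measurable_maxr.
have max0 x : 0 <= Num.max x (0 : R) by rewrite le_max lexx orbT.
have gmax w : Num.max (X w) 0 = g i w by apply/max_idPl; exact: g0.
transitivity (\int[P]_w (h w * Num.max (X w) 0)%:E)%E.
  by apply: eq_integral => w _; rewrite gmax /h big_cons; congr (_%:E); ring.
rewrite (ge0_integral_weighted mh mX h0 hX mmax max0).
rewrite ge0_integral_distribution//; last exact/measurable_EFinP.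
rewrite (_ : (\int[P]_x _)%E = (Ex P (g i))%:E).
  by rewrite -EFinM big_cons /c mulrC mulrA.
by rewrite -Ex_EFin//; apply: eq_integral => w _; rewrite /= gmax.
Qed.


Lemma integral_prod_indep (s : seq I) : uniq s ->
  (\int[P]_w (\prod_(i <- s) g i w)%:E = (\prod_(i <- s) Ex P (g i))%:E)%E.
Proof.
move=> us; have := @mixed_prod s [::] (fun=> setT).
rewrite cats0 big_nil mulr1 => <- //.
by apply: eq_integral => w _; rewrite big_nil mulr1.
Qed.
End IndependentProducts.

Section IndependentPairs.
Variables (R : realType) (d : measure_display) (T : measurableType d).
Variable P : probability T R.

Lemma mutually_independent_pair (I : eqType) (F : I -> set (set T)) (i j : I) :
  i != j -> mutually_independent P F ->
  mutually_independent P (fun b : bool => if b then F i else F j).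
Proof.
move=> ij indF s E us FE; pose phi (b : bool) := if b then i else j.
have phiI : injective phi.
  by move=> [] [] //= /eqP; rewrite ?(negbTE ij)// eq_sym (negbTE ij).
pose E' k := if k == i then E true else E false.
have E'phi b : E' (phi b) = E b.
  by case: b; rewrite /E' /= ?eqxx// eq_sym (negbTE ij).
have us' : uniq (map phi s) by rewrite map_inj_uniq.
have FE' k : k \in map phi s -> F k (E' k).
  by move=> /mapP[b bs ->]; rewrite E'phi; case: b bs => /FE.
have := indF _ E' us' FE'; rewrite !big_map.
by under eq_bigr do rewrite E'phi; under [in RHS]eq_bigr do rewrite E'phi.
Qed.

Lemma L2_max X : L2 P X -> L2 P (fun w => Num.max (X w) 0).
Proof.
move=> [mX iX]; have mM : measurable_fun setT (fun w => Num.max (X w) 0).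
  by apply: measurable_maxr.
split => //; apply: (L1_le _ _ iX); first exact: measurable_funX.
move=> w; rewrite ger0_norm ?sqr_ge0//; case: (leP (X w) 0) => // _.
by rewrite expr0n sqr_ge0.
Qed.

(** The product formula is for nonnegative factors, so both variables are split into positive and
    negative parts. Passing to the index type [bool] gives the formula a factor for every index. *)
Lemma Ex_mul_indep (I : eqType) (F : I -> set (set T)) (i j : I) (X Y : T -> R) :
  mutually_independent P F -> (forall i A, F i A -> measurable A) -> i != j ->
  (forall B, measurable B -> F i (X @^-1` B)) ->
  (forall B, measurable B -> F j (Y @^-1` B)) ->
  L2 P X -> L2 P Y -> Ex P (fun w => X w * Y w) = Ex P X * Ex P Y.
Proof.
move=> indF mF ij FX FY X2 Y2.
have ind2 := mutually_independent_pair ij indF.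
pose pos (a : R) (Z : T -> R) w := Num.max (a * Z w) 0.
have pos2 a Z : L2 P Z -> L2 P (pos a Z) by move=> Z2; apply: L2_max; exact: L2Z.
have posF k a (Z : T -> R) : (forall B, measurable B -> F k (Z @^-1` B)) ->
    forall B, measurable B -> F k (pos a Z @^-1` B).
  move=> FZ B mB; have mm : measurable_fun setT (fun x : R => Num.max (a * x) 0).
    by apply: measurable_maxr => //; exact: measurable_funM.
  rewrite (_ : _ @^-1` _ = Z @^-1` ((fun x : R => Num.max (a * x) 0) @^-1` B))//.
  by apply: FZ; rewrite -[X in measurable X]setTI; exact: mm.
have prodE a b : Ex P (fun w => pos a X w * pos b Y w) = Ex P (pos a X) * Ex P (pos b Y).
  pose g (k : bool) := if k then pos a X else pos b Y.
  have := @integral_prod_indep _ _ _ P bool _ g ind2 _ _ _ _ [:: true; false] isT.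
  rewrite !big_cons !big_nil mulr1.
  under eq_integral do rewrite !big_cons !big_nil mulr1.
  rewrite Ex_EFin; last by apply: L2_mul; exact: pos2.
  move=> H; apply: EFin_inj; apply: H.
  - by case=> A; exact: mF.
  - by case=> w; rewrite /g /pos le_max lexx orbT.
  - by case; exact: posF.
  - by case; apply: L2_L1; exact: pos2.
have posD (x : R) : x = Num.max (1 * x) 0 - Num.max (-1 * x) 0.
  rewrite mul1r mulN1r; case: (leP x 0) => x0.
    by rewrite (max_idPl _) ?oppr_ge0// sub0r opprK.
  by rewrite (max_idPr _) ?subr0// oppr_le0 ltW.
have EB Z1 Z2 : L1 P Z1 -> L1 P Z2 -> Ex P (fun w => Z1 w - Z2 w) = Ex P Z1 - Ex P Z2.
  by move=> i1 i2; rewrite ExD ?ExN//; exact: L1N.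
have XE : Ex P X = Ex P (pos 1 X) - Ex P (pos (-1) X).
  rewrite -EB; try by (apply: L2_L1; exact: pos2).
  by congr Ex; apply/funext => w; exact: posD.
have YE : Ex P Y = Ex P (pos 1 Y) - Ex P (pos (-1) Y).
  rewrite -EB; try by (apply: L2_L1; exact: pos2).
  by congr Ex; apply/funext => w; exact: posD.
have pp a b : L1 P (fun w => pos a X w * pos b Y w) by apply: L2_mul; exact: pos2.
have ppN a b c e : L1 P (fun w => pos a X w * pos b Y w - pos c X w * pos e Y w).
  by apply: L1D => //; exact: L1N.
rewrite XE YE mulrBl !mulrBr -!prodE -!EB//.
by congr Ex; apply/funext => w; rewrite {1}(posD (X w)) {1}(posD (Y w)) /pos; ring.
Qed.

End IndependentPairs.

(** * Exponential tails and Chernoff bounds *)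

Section Concentration.
Variable R : realType.

(** From exp (-x) >= 1 - x follows exp x <= 1 + x exp x. For u >= 0 this is used twice; for u < 0
    once, followed by exp u >= 1 + u. *)
Lemma expR_le_quadratic (u : R) : expR u <= 1 + u + u ^+ 2 * expR `|u|.
Proof.
have H (x : R) : expR x <= 1 + x * expR x.
  have := expR_ge1Dx (- x); rewrite expRN => /(ler_wpM2l (expR_ge0 x)).
  by rewrite divff ?gt_eqF ?expR_gt0//; lra.
have [u0|u0] := leP 0 u.
  rewrite ger0_norm//; apply: le_trans (H u) _.
  by have := ler_wpM2l u0 (H u); rewrite expr2; lra.
apply: le_trans (H u) _; rewrite -addrA lerD2l.
have h1 : u * expR u <= u * (1 + u) by rewrite ler_nM2l// expR_ge1Dx.
have h2 : 1 <= expR `|u| by rewrite -expR0 ler_expR.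
have h3 := ler_wpM2l (sqr_ge0 u) h2.
by rewrite !expr2 in h3 *; lra.
Qed.

Lemma sqr_le_expR (l x : R) : 0 < l -> x ^+ 2 <= 16 / l ^+ 2 * expR (l * `|x| / 2).
Proof.
move=> l0; pose y := l * `|x| / 4.
have y0 : 0 <= y by rewrite !mulr_ge0// ltW.
have h1 : y <= expR y by apply: le_trans (expR_ge1Dx y); rewrite lerDr.
have h2 : y ^+ 2 <= expR y ^+ 2 by rewrite ler_pXn2r ?nnegrE ?expR_ge0.
have -> : expR (l * `|x| / 2) = expR y ^+ 2.
  by rewrite expr2 -expRD /y; congr expR; field.
apply: le_trans (ler_wpM2l _ h2); last by rewrite divr_ge0 ?sqr_ge0.
rewrite le_eqVlt; apply/orP; left; apply/eqP.
rewrite /y -(real_normK (num_real x)); field; exact: lt0r_neq0.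
Qed.

Variables (d : measure_display) (T : measurableType d) (P : probability T R).

(** In the second-order bound for exp (t Y), [Y] the centred variable, |t| <= l/2 leaves the
    remainder t^2 Y^2 exp (l |Y|/2); by [sqr_le_expR] the factor Y^2 uses up the other half of the
    exponent at the price 16/l^2. Centring costs a factor exp B, since l |E Z| <= E exp (l |Z|) <=
    B. *)
Lemma centered_mgf (Z : T -> R) (l B t : R) : 0 < l -> measurable_fun setT Z ->
  (\int[P]_w (expR (l * `|Z w|))%:E <= B%:E)%E -> `|t| <= l / 2 ->
  L1 P (fun w => expR (t * (Z w - Ex P Z))) /\
  Ex P (fun w => expR (t * (Z w - Ex P Z))) <= expR (16 / l ^+ 2 * (B * expR B) * t ^+ 2).
Proof.
move=> l0 mZ ZB tl; have mZa : measurable_fun setT (fun w => `|Z w|).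
  by apply: measurableT_comp => //.
have iE : L1 P (fun w => expR (l * `|Z w|)).
  apply: L1_lty; last exact: le_lt_trans ZB (ltry _).
    by apply: measurableT_comp => //; exact: measurable_funM.
  by move=> w; exact: expR_ge0.
have EB : Ex P (fun w => expR (l * `|Z w|)) <= B by rewrite -lee_fin -Ex_EFin.
have lZ w : l * `|Z w| <= expR (l * `|Z w|).
  by apply: le_trans (expR_ge1Dx _); rewrite lerDr.
have iA : L1 P (fun w => l * `|Z w|).
  by apply: (L1_le _ _ iE) => [|w]; [exact: measurable_funM|rewrite ger0_norm ?mulr_ge0// ltW].
have iZa : L1 P (fun w => `|Z w|).
  have := L1Z l^-1 iA; congr L1; apply/funext => w.
  by rewrite mulKf// gt_eqF.
have iZ : L1 P Z by apply: (L1_le _ _ iZa).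
set mu := Ex P Z.
have muB : l * `|mu| <= B.
  apply: le_trans EB; apply: le_trans (Ex_le iA iE lZ).
  by rewrite ExZ// ler_pM2l//; exact: le_normr_Rintegral.
pose Y w := Z w - mu.
have mY : measurable_fun setT Y by exact: measurable_funB.
have mYa : measurable_fun setT (fun w => `|Y w|) by apply: measurableT_comp.
have YE w : expR (l * `|Y w|) <= expR B * expR (l * `|Z w|).
  rewrite -expRD ler_expR; apply: le_trans (_ : l * (`|Z w| + `|mu|) <= _).
    by rewrite ler_pM2l// ler_normB.
  by rewrite mulrDr addrC lerD2r.
have iYE : L1 P (fun w => expR (l * `|Y w|)).
  apply: (L1_le _ _ (L1Z (expR B) iE)).
    by apply: measurableT_comp => //; exact: measurable_funM.
  by move=> w; rewrite ger0_norm ?expR_ge0.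
have EYE : Ex P (fun w => expR (l * `|Y w|)) <= B * expR B.
  apply: le_trans (Ex_le iYE (L1Z (expR B) iE) YE) _.
  by rewrite ExZ// mulrC ler_wpM2r ?expR_ge0.
have tY w : `|t * Y w| <= l * `|Y w| / 2.
  by rewrite normrM mulrAC ler_wpM2r.
have iY : L1 P (fun w => t * Y w).
  by apply: L1Z; apply: L1D => //; exact: L1_cst.
have it : L1 P (fun w => expR (t * Y w)).
  apply: (L1_le _ _ iYE); first by apply: measurableT_comp => //; exact: measurable_funM.
  move=> w; rewrite ger0_norm ?expR_ge0// ler_expR (le_trans (ler_norm _))//.
  by rewrite (le_trans (tY w))// ler_pdivrMr// ler_peMr ?mulr_ge0 ?(ltW l0)//; lra.
split => //.
pose c := 16 / l ^+ 2 * t ^+ 2.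
have c0 : 0 <= c by rewrite mulr_ge0 ?sqr_ge0// divr_ge0 ?sqr_ge0.
have bound w : expR (t * Y w) <= 1 + t * Y w + c * expR (l * `|Y w|).
  apply: le_trans (expR_le_quadratic _) _; rewrite lerD2l.
  have h1 : expR `|t * Y w| <= expR (l * `|Y w| / 2) by rewrite ler_expR.
  have h2 := sqr_le_expR (Y w) l0.
  have -> : expR (l * `|Y w|) = expR (l * `|Y w| / 2) * expR (l * `|Y w| / 2).
    by rewrite -expRD; congr expR; field.
  have h3 : t ^+ 2 * Y w ^+ 2 <= c * expR (l * `|Y w| / 2).
    apply: le_trans (ler_wpM2l (sqr_ge0 t) h2) _.
    by rewrite le_eqVlt; apply/orP; left; apply/eqP; rewrite /c; ring.
  rewrite exprMn (mulrA c); apply: ler_pM h3 h1; last exact: expR_ge0.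
  by rewrite mulr_ge0 ?sqr_ge0.
have iB : L1 P (fun w => 1 + t * Y w + c * expR (l * `|Y w|)).
  by apply: L1D; [apply: L1D => //; exact: L1_cst|exact: L1Z].
apply: le_trans (Ex_le it iB bound) _.
rewrite ExD; [|by apply: L1D => //; exact: L1_cst|exact: L1Z].
rewrite ExD//; last exact: L1_cst.
rewrite Ex_cst !ExZ//; last by apply: L1D => //; exact: L1_cst.
have -> : Ex P Y = 0.
  by rewrite /Y ExD//; [rewrite Ex_cst subrr|exact: L1_cst].
rewrite mulr0 addr0; apply: le_trans (expR_ge1Dx _); rewrite lerD2l.
apply: le_trans (ler_wpM2l c0 EYE) _.
by rewrite le_eqVlt; apply/orP; left; apply/eqP; rewrite /c; ring.
Qed.

End Concentration.

Section EmpiricalMean.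
Variable R : realType.

(** Markov's inequality for the product of the exponentials, whose mean factors by independence. The
    sign of [t] is free, so that one statement serves both tails. *)
Lemma chernoff_indep d (T : measurableType d) (P : probability T R) (L : nat)
    (F : 'I_L -> set (set T)) (Z : 'I_L -> T -> R) (V t s : R) :
  mutually_independent P F -> (forall i A, F i A -> measurable A) ->
  (forall i B, measurable B -> F i (Z i @^-1` B)) ->
  (forall i, L1 P (fun w => expR (t * Z i w))) ->
  (forall i, Ex P (fun w => expR (t * Z i w)) <= expR (V * t ^+ 2)) ->
  measurable [set w | s <= t * \sum_i Z i w] /\
  (P [set w | (s <= t * \sum_i Z i w)%R] <= (expR (L%:R * (V * t ^+ 2) - s))%:E)%E.
Proof.
move=> indF mF FZ iZ EZ; set A := [set w | _].
have mZ i : measurable_fun setT (Z i).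
  by move=> _ B mB; rewrite setTI; exact: mF (FZ i B mB).
have mS : measurable_fun setT (fun w => t * \sum_i Z i w).
  by apply: measurable_funM => //; exact: measurable_sum.
have mA : measurable A.
  have := mS measurableT `[s, +oo[%classic (measurable_itv _); rewrite setTI.
  by congr measurable; apply/seteqP; split=> w /=; rewrite in_itv /= andbT.
split => //.
have H := @integral_prod_indep _ _ _ P _ F (fun i w => expR (t * Z i w)) indF mF
  (fun i w => expR_ge0 _) _ iZ (index_enum _) (index_enum_uniq _).
have {}H := H _.
have E1 : (\int[P]_w (\prod_i expR (t * Z i w))%:E <= (expR (L%:R * (V * t ^+ 2)))%:E)%E.
  rewrite H; last first.
    move=> i B mB; have mm : measurable_fun setT (fun x : R => expR (t * x)).
      by apply: measurableT_comp => //; exact: measurable_funM.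
    rewrite (_ : _ @^-1` _ = Z i @^-1` ((fun x : R => expR (t * x)) @^-1` B))//.
    by apply: FZ; rewrite -[X in measurable X]setTI; exact: mm.
  rewrite lee_fin; apply: (@le_trans _ _ (\prod_(i < L) expR (V * t ^+ 2))).
    by apply: ler_prod => i _; rewrite EZ andbT; apply: Ex_ge0 => w; exact: expR_ge0.
  by rewrite prodr_const card_ord expRM_natl.
have mE : measurable_fun setT (fun w => \prod_i expR (t * Z i w)).
  by apply: measurable_prod => i _; exact: L1_meas (iZ i).
have p0 w : 0 <= \prod_i expR (t * Z i w) by apply: prodr_ge0 => i _; exact: expR_ge0.
have <- : (\int[P]_w (\1_A w)%:E = P A)%E by rewrite integral_indic ?setIT.
apply: (@le_trans _ _ (\int[P]_w ((expR (- s))%:E * (\prod_i expR (t * Z i w))%:E))%E).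
  apply: ge0_le_integral => //.
  - exact/measurable_EFinP/measurable_indic.
  - by under eq_fun do rewrite -EFinM; apply/measurable_EFinP/measurable_funM.
  move=> w _; rewrite -EFinM lee_fin indicE.
  have -> : \prod_i expR (t * Z i w) = expR (t * \sum_i Z i w).
    by rewrite mulr_sumr expR_sum.
  rewrite -expRD; case: (boolP (w \in A)) => [|_]; last exact: expR_ge0.
  by rewrite inE /A /= => sw; rewrite -expR0 ler_expR addrC subr_ge0.
rewrite ge0_integralZl_EFin ?expR_ge0//; last exact/measurable_EFinP.
  by rewrite addrC expRD EFinM lee_pmul2l// ?lte_fin ?expR_gt0//.
by move=> w _; rewrite lee_fin.
Qed.

(** [k] is both the range of [s] and the rate in the exponent, hence a minimum of two quantities; it
    is chosen from [l] and [B] alone, before the probability space. *)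
Lemma empirical_mean_dev (l B : R) : 0 < l -> exists2 k, 0 < k &
  forall d (T : measurableType d) (P : probability T R) (L : nat)
    (F : 'I_L -> set (set T)) (Z : 'I_L -> T -> R) (s : R),
  (0 < L)%N ->
  mutually_independent P F -> (forall i A, F i A -> measurable A) ->
  (forall i B, measurable B -> F i (Z i @^-1` B)) ->
  (forall i, \int[P]_w (expR (l * `|Z i w|))%:E <= B%:E)%E ->
  0 < s -> s <= k ->
  exists A, [/\ measurable A, (P A <= (2 * expR (- (k * L%:R * s ^+ 2)))%:E)%E &
    forall w, ~ A w ->
     `|L%:R^-1 * \sum_i Z i w - L%:R^-1 * \sum_i Ex P (Z i)| <= s].
Proof.
(* The modulus and the added 1 make [V] positive whatever [B] is. *)
move=> l0; pose V := 16 / l ^+ 2 * (`|B| * expR `|B|) + 1.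
have V0 : 0 < V.
  by rewrite ltr_wpDl// mulr_ge0 ?divr_ge0 ?sqr_ge0 ?mulr_ge0 ?expR_ge0.
have k1 : 0 < V * l by exact: mulr_gt0.
have k2 : 0 < (4 * V)^-1 by rewrite invr_gt0 mulr_gt0.
exists (Num.min (V * l) (4 * V)^-1); first by rewrite lt_min k1 k2.
move=> d T P L F Z s L0 indF mF FZ ZB s0; rewrite le_min => /andP[sV _].
set k := Num.min _ _; have kV : k <= (4 * V)^-1 by rewrite ge_min lexx orbT.
have Lr : 0 < L%:R :> R by rewrite ltr0n.
have mZ i : measurable_fun setT (Z i).
  by move=> _ C mC; rewrite setTI; exact: mF (FZ i C mC).
pose Y i w := Z i w - Ex P (Z i).
have FY i C : measurable C -> F i (Y i @^-1` C).
  move=> mC; have mm : measurable_fun setT (fun x : R => x - Ex P (Z i)).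
    exact: measurable_funB.
  rewrite (_ : _ @^-1` _ = Z i @^-1` ((fun x : R => x - Ex P (Z i)) @^-1` C))//.
  by apply: FZ; rewrite -[X in measurable X]setTI; exact: mm.
have mgf i t : `|t| <= l / 2 -> L1 P (fun w => expR (t * Y i w)) /\
    Ex P (fun w => expR (t * Y i w)) <= expR (V * t ^+ 2).
  move=> tl; have ZB' : (\int[P]_w (expR (l * `|Z i w|))%:E <= `|B|%:E)%E.
    by apply: le_trans (ZB i) _; rewrite lee_fin ler_norm.
  have [iY EY] := centered_mgf l0 (mZ i) ZB' tl; split => //.
  apply: le_trans EY _; rewrite ler_expR ler_wpM2r ?sqr_ge0//.
  by rewrite /V lerDl.
(* This [t] minimizes V t^2 - s t and gives the exponent -s^2/(4 V) per sample; [s <= V * l] keeps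
   it in the range of [centered_mgf]. *)
pose t := s / (2 * V).
have t0 : 0 < t by rewrite divr_gt0 ?mulr_gt0.
have tl : t <= l / 2.
  by rewrite /t ler_pdivrMr ?mulr_gt0// (le_trans sV)// le_eqVlt; apply/orP; left; apply/eqP; field.
have side (t' : R) : `|t'| = t -> exists A, [/\ measurable A,
    (P A <= (expR (- (k * L%:R * s ^+ 2)))%:E)%E &
    forall w, ~ A w -> t' * \sum_i Y i w <= t * (L%:R * s)].
  move=> t't; have t'l : `|t'| <= l / 2 by rewrite t't.
  have [mA PA] := chernoff_indep (t * (L%:R * s)) indF mF FY
    (fun i => (mgf i t' t'l).1) (fun i => (mgf i t' t'l).2).
  exists [set w | t * (L%:R * s) <= t' * \sum_i Y i w]; split => //.
    apply: le_trans PA _; rewrite lee_fin ler_expR.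
    have -> : t' ^+ 2 = t ^+ 2 by rewrite -t't real_normK ?num_real.
    have -> : L%:R * (V * t ^+ 2) - t * (L%:R * s) = - ((4 * V)^-1 * L%:R * s ^+ 2).
      by rewrite /t; field; rewrite gt_eqF.
    by rewrite lerN2 ler_wpM2r ?sqr_ge0// ler_wpM2r// ltW.
  by move=> w /negP; rewrite /= -ltNge => /ltW.
have [|A1 [mA1 PA1 A1s]] := side t; first by rewrite gtr0_norm.
have [|A2 [mA2 PA2 A2s]] := side (- t); first by rewrite normrN gtr0_norm.
exists (A1 `|` A2); split; first exact: measurableU.
  apply: le_trans (measureU2 _ mA1 mA2) _.
  by rewrite mulr_natl mulr2n EFinD; exact: leeD.
move=> w /not_orP[/A1s h1 /A2s h2].
have YE : L%:R^-1 * \sum_i Z i w - L%:R^-1 * \sum_i Ex P (Z i) =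
    L%:R^-1 * \sum_i Y i w by rewrite -mulrBr -sumrB.
move: h1 h2; rewrite YE mulNr -mulrN !ler_pM2l// => h1 h2.
rewrite normrM gtr0_norm ?invr_gt0// ler_pdivrMl// ler_norml.
by rewrite h1 andbT lerNl.
Qed.

End EmpiricalMean.

(** * Moments of the filter *)

Section GaussianMoments.
Variable R : realType.

Lemma le0_of_small (x K : R) : (forall t, 0 < t -> t <= 1 -> x <= K * t) -> x <= 0.
Proof.
move=> H; rewrite leNgt; apply/negP => x0; pose c := `|K| + x.
have c0 : 0 < c by rewrite ltr_wpDl.
have h1 : 0 < x / (2 * c) by rewrite divr_gt0 ?mulr_gt0.
have Kn : 0 <= `|K| by exact: normr_ge0.
have h2 : x / (2 * c) <= 1 by rewrite ler_pdivrMr ?mulr_gt0// mul1r /c; lra.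
have := H _ h1 h2; apply/negP; rewrite -ltNge mulrA ltr_pdivrMr ?mulr_gt0//.
have := ler_wpM2r (ltW x0) (ler_norm K); have := mulr_gt0 x0 x0.
have := mulr_ge0 (ltW x0) Kn; rewrite /c; lra.
Qed.

Lemma inv_sqrt_le (u : R) : `|u| <= 1 / 2 ->
  (Num.sqrt (1 - u))^-1 <= 1 + u / 2 + u ^+ 2.
Proof.
rewrite ler_norml => /andP[u1 u2]; set r := 1 + _ + _.
have sq := sqr_ge0 u; have r0 : 0 < r by rewrite /r; lra.
have a0 : 0 < 1 - u by lra.
rewrite -[leRHS]invrK lef_pV2 ?posrE ?invr_gt0 ?sqrtr_gt0//.
rewrite -[leLHS]ger0_norm ?invr_ge0 ?(ltW r0)// -sqrtr_sqr ler_wsqrtr//.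
rewrite exprVn -[leLHS]mul1r ler_pdivrMr ?exprn_gt0// -subr_ge0 /r.
have -> : (1 - u) * (1 + u / 2 + u ^+ 2) ^+ 2 - 1 =
  u ^+ 2 * (5 / 4 - 5 / 4 * u - u * u ^+ 2) by field.
apply: mulr_ge0 => //.
have u3 : u * u ^+ 2 <= 1 / 2 * u ^+ 2 by rewrite ler_wpM2r//; lra.
have u4 : u ^+ 2 <= 1 / 4.
  have := mulr_ge0 (_ : 0 <= 1 / 2 - u) (_ : 0 <= u + 1 / 2).
  by rewrite expr2 => h; have := h ltac:(lra) ltac:(lra); lra.
lra.
Qed.

Variables (d : measure_display) (T : measurableType d) (P : probability T R).
Variables (Y : T -> R) (m v : R).
Hypotheses (mY : measurable_fun setT Y) (v0 : 0 <= v).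
Hypothesis lawY : forall B, measurable B -> P (Y @^-1` B) = gaussian_law m v B.

(** Small enough for u = 2 l0 v to satisfy the condition |u| <= 1/2 of [inv_sqrt_le]. *)
Let l0 : R := (4 * (v + 1))^-1.
Let l0p : 0 < l0. Proof. by rewrite invr_gt0 mulr_gt0// ltr_wpDl. Qed.
Let l0v : l0 * v <= 1 / 4.
Proof.
by rewrite /l0 ler_pdivrMl ?mulr_gt0 ?ltr_wpDl//; lra.
Qed.

Let mYm : measurable_fun setT (fun w => Y w - m).
Proof. exact: measurable_funB. Qed.

Let exp_sqr_L1 l : l <= l0 -> L1 P (fun w => expR (l * (Y w - m) ^+ 2)) /\
  Ex P (fun w => expR (l * (Y w - m) ^+ 2)) = (Num.sqrt (1 - 2 * l * v))^-1.
Proof.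
move=> ll0; have lv : 2 * l * v < 1.
  by have := ler_wpM2r v0 ll0; have := l0v; lra.
have E := gaussian_exp_sqr mY v0 lawY lv.
have i1 : L1 P (fun w => expR (l * (Y w - m) ^+ 2)).
  apply: L1_lty; last by rewrite E ltry.
    by apply: measurableT_comp => //; apply: measurable_funM => //; exact: measurable_funX.
  by move=> w; exact: expR_ge0.
by split=> //; apply: EFin_inj; rewrite -E Ex_EFin.
Qed.

Lemma gaussian_L2 : L2 P (fun w => Y w - m).
Proof.
split=> //; have [i1 _] := exp_sqr_L1 (lexx l0).
apply: (L1_le _ _ (L1Z l0^-1 i1)); first exact: measurable_funX.
move=> w; rewrite ger0_norm ?sqr_ge0// ler_pdivlMl//.
by apply: le_trans (expR_ge1Dx _); rewrite lerDr.
Qed.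

(** Comparing 1 + t E(Y - m) with exp (v t^2/2) = 1 + O(t^2) for small [t] of either sign forces the
    centred mean to vanish, with no differentiation under the integral. *)
Lemma gaussian_centered : Ex P (fun w => Y w - m) = 0.
Proof.
have iY := L2_L1 gaussian_L2; set a := Ex _ _.
pose K := v / 2 + (v / 2) ^+ 2 * expR (v / 2).
have H t : `|t| <= 1 -> t * a <= K * t ^+ 2.
  move=> t1; have E := gaussian_mgf t mY v0 lawY.
  have i1 : L1 P (fun w => expR (t * (Y w - m))).
    apply: L1_lty; last by rewrite E ltry.
      by apply: measurableT_comp => //; exact: measurable_funM.
    by move=> w; exact: expR_ge0.
  have E' : Ex P (fun w => expR (t * (Y w - m))) = expR (v * t ^+ 2 / 2).
    by apply: EFin_inj; rewrite -E Ex_EFin.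
  have i2 : L1 P (fun w => 1 + t * (Y w - m)).
    by apply: L1D; [exact: L1_cst|exact: L1Z].
  have := Ex_le i2 i1 (fun w => expR_ge1Dx _); rewrite E'.
  rewrite ExD; [|exact: L1_cst|exact: L1Z]; rewrite Ex_cst ExZ// -/a => h.
  have t2 : t ^+ 2 <= 1 by rewrite -(real_normK (num_real t)) expr_le1.
  set u := v * t ^+ 2 / 2 in h.
  have u0 : 0 <= u by rewrite divr_ge0// mulr_ge0 ?sqr_ge0.
  have uv : u <= v / 2 by rewrite ler_pM2r// ler_piMr.
  have q := expR_le_quadratic u; rewrite ger0_norm// in q.
  have e1 : expR u <= expR (v / 2) by rewrite ler_expR.
  have e2 : u ^+ 2 <= (v / 2) ^+ 2 * t ^+ 2.
    have -> : u ^+ 2 = (v / 2) ^+ 2 * t ^+ 2 * t ^+ 2 by rewrite /u; field.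
    by rewrite ler_piMr// mulr_ge0 ?sqr_ge0.
  have e3 : u ^+ 2 * expR u <= (v / 2) ^+ 2 * t ^+ 2 * expR (v / 2).
    by apply: ler_pM => //; rewrite ?sqr_ge0 ?expR_ge0.
  have -> : K * t ^+ 2 = u + (v / 2) ^+ 2 * t ^+ 2 * expR (v / 2).
    by rewrite /K /u; field.
  lra.
apply/eqP; rewrite eq_le; apply/andP; split.
  apply: (@le0_of_small _ K) => t t0 t1.
  have := H t; rewrite gtr0_norm// => /(_ t1).
  by rewrite expr2 mulrA [leRHS]mulrC ler_pM2l.
rewrite -oppr_le0; apply: (@le0_of_small _ K) => t t0 t1.
have := H (- t); rewrite normrN gtr0_norm// => /(_ t1).
by rewrite sqrrN expr2 mulrA [leRHS]mulrC mulNr -mulrN ler_pM2l.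
Qed.

(** The same comparison, now of 1 + l E(Y - m)^2 with (1 - 2 l v)^(-1/2) = 1 + l v + O(l^2), for
    small [l] of either sign. *)
Lemma gaussian_variance : Ex P (fun w => (Y w - m) ^+ 2) = v.
Proof.
have [_ iY] := gaussian_L2; set b := Ex _ _.
have H l : `|l| <= l0 -> l * (b - v) <= 4 * v ^+ 2 * l ^+ 2.
  move=> ll; have ll' : l <= l0 by apply: le_trans ll; exact: ler_norm.
  have [i1 E] := exp_sqr_L1 ll'.
  have i2 : L1 P (fun w => 1 + l * (Y w - m) ^+ 2).
    by apply: L1D; [exact: L1_cst|exact: L1Z].
  have := Ex_le i2 i1 (fun w => expR_ge1Dx _); rewrite E.
  rewrite ExD; [|exact: L1_cst|exact: L1Z]; rewrite Ex_cst ExZ// -/b => h.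
  have lv : `|2 * l * v| <= 1 / 2.
    rewrite !normrM (ger0_norm v0) (ger0_norm (_ : 0 <= 2))//.
    by have := ler_wpM2r v0 ll; have := l0v; lra.
  have := inv_sqrt_le lv; rewrite !exprMn.
  have -> : (2 : R) ^+ 2 = 4 by ring.
  lra.
pose t' t := t * l0.
apply/eqP; rewrite eq_le -subr_le0 -[v <= b]subr_le0; apply/andP; split.
  apply: (@le0_of_small _ (4 * v ^+ 2 * l0)) => t t0 t1.
  have tl : 0 < t * l0 by exact: mulr_gt0.
  have := H (t * l0); rewrite gtr0_norm// ler_piMl ?(ltW l0p)// => /(_ isT).
  have -> : 4 * v ^+ 2 * (t * l0) ^+ 2 = t * l0 * (4 * v ^+ 2 * l0 * t) by ring.
  by rewrite ler_pM2l.
apply: (@le0_of_small _ (4 * v ^+ 2 * l0)) => t t0 t1.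
have tl : 0 < t * l0 by exact: mulr_gt0.
have := H (- (t * l0)); rewrite normrN gtr0_norm// ler_piMl ?(ltW l0p)// => /(_ isT).
rewrite sqrrN mulNr -mulrN opprB.
have -> : 4 * v ^+ 2 * (t * l0) ^+ 2 = t * l0 * (4 * v ^+ 2 * l0 * t) by ring.
by rewrite ler_pM2l.
Qed.

Lemma gaussian_exp_sqr_bound :
  (\int[P]_w (expR (l0 * (Y w - m) ^+ 2))%:E <= 2%:E)%E.
Proof.
have [i1 E] := exp_sqr_L1 (lexx l0); rewrite Ex_EFin// E lee_fin.
have a0 := mulr_ge0 (ltW l0p) v0.
have := @inv_sqrt_le (2 * l0 * v); rewrite ger0_norm; last by rewrite -mulrA mulr_ge0.
move=> /(_ ltac:(have := l0v; lra)) /le_trans; apply.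
have a1 : (2 * l0 * v) ^+ 2 <= (1 / 2) ^+ 2.
  by rewrite ler_pXn2r ?nnegrE//; have := l0v; lra.
have a2 : (1 / 2 : R) ^+ 2 = 1 / 4 by field.
by rewrite a2 in a1; have := l0v; lra.
Qed.

End GaussianMoments.

(** * Measurability with respect to a generated sigma-algebra *)

Section GeneratedSigma.
Variables (R : realType) (d : measure_display) (T : measurableType d) (J : Type).
Variable X : J -> T -> R.

Definition gmeas (f : T -> R) : Prop :=
  forall B, measurable B -> generated_sigma X (f @^-1` B).

Let G : set (set T) := [set E | exists j (B : set R), measurable B /\ E = X j @^-1` B].

Let gmeasE f : gmeas f <-> measurable_fun [set: g_sigma_algebraType G] f.
Proof.
split=> [fB _ B mB|mf B mB]; first by rewrite setTI; exact: fB.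
by have := mf measurableT B mB; rewrite setTI.
Qed.

Lemma gmeas_gen j : gmeas (X j).
Proof. by move=> B mB; apply: sub_sigma_algebra; exists j, B. Qed.

Lemma gmeas_cst (c : R) : gmeas (fun=> c).
Proof. exact/gmeasE/measurable_cst. Qed.

Lemma gmeas_mul f g : gmeas f -> gmeas g -> gmeas (fun w => f w * g w).
Proof. by move=> /gmeasE mf /gmeasE mg; exact/gmeasE/measurable_funM. Qed.

Lemma gmeas_sub f (c : R) : gmeas f -> gmeas (fun w => f w - c).
Proof. by move=> /gmeasE mf; apply/gmeasE/measurable_funB => //. Qed.

Lemma generated_sigma_measurable A : (forall j, measurable_fun setT (X j)) ->
  generated_sigma X A -> measurable A.
Proof.
move=> mX; apply: smallest_sub; first exact: sigma_algebra_measurable.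
by move=> _ [j [B [mB ->]]]; rewrite -[X in measurable X]setTI; exact: mX.
Qed.

End GeneratedSigma.

(** * Mean and covariance of a Gaussian vector *)

Section GaussianVectors.
Variables (R : realType) (d : measure_display) (T : measurableType d).
Variables (P : probability T R) (n : nat) (X : T -> 'cV[R]_n).
Variables (mu : 'cV[R]_n) (S : 'M[R]_n).
Hypothesis gX : gaussian_vector P X mu S.

Let Y (a : 'cV[R]_n) w := (a^T *m X w) 0 0.

Let mY a : measurable_fun setT (Y a).
Proof.
have [_ mX _] := gX.
rewrite (_ : Y a = fun w => \sum_i a^T 0 i * X w i 0); last first.
  by apply/funext => w; rewrite /Y mxE.
by apply: measurable_sum => i; exact: measurable_funM.
Qed.

Let v0 (a : 'cV[R]_n) : 0 <= (a^T *m S *m a) 0 0.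
Proof. by have [[_ H] _ _] := gX. Qed.

Let lawY a B : measurable B ->
  P (Y a @^-1` B) = gaussian_law ((a^T *m mu) 0 0) ((a^T *m S *m a) 0 0) B.
Proof. by have [_ _ H] := gX; exact: H. Qed.

Let YE a w : Y a w - (a^T *m mu) 0 0 = (a^T *m (X w - mu)) 0 0.
Proof. by rewrite /Y mulmxBr mxaddE mxoppE. Qed.

Let comp (u : 'cV[R]_n) i : ((delta_mx i 0 : 'cV[R]_n)^T *m u) 0 0 = u i 0.
Proof. by rewrite trmx_delta -rowE mxE. Qed.

Lemma gaussian_vector_L2 : L2v P (fun w => X w - mu).
Proof.
move=> i; have := gaussian_L2 (mY (delta_mx i 0)) (v0 _) (lawY _).
by under eq_fun do rewrite YE comp.
Qed.

Lemma gaussian_vector_centered i : Ex P (fun w => (X w - mu) i 0) = 0.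
Proof.
have := gaussian_centered (mY (delta_mx i 0)) (v0 _) (lawY _).
by under eq_fun do rewrite YE comp.
Qed.

(** The variances of the linear forms show that the quadratic form of the difference vanishes;
    Cauchy-Schwarz at basis vectors then kills every entry. *)
Lemma gaussian_vector_cross : cross P (fun w => X w - mu) (fun w => X w - mu) = S.
Proof.
set u := fun w => X w - mu; have u2 : L2v P u := gaussian_vector_L2.
have [[sS _] _ _] := gX.
have q (a : 'cV[R]_n) : (a^T *m cross P u u *m a) 0 0 = (a^T *m S *m a) 0 0.
  rewrite -(gaussian_variance (mY a) (v0 a) (lawY a)) -crossMl// -{2}[a]trmxK -crossMr//.
    rewrite mxE; congr (Ex P); apply/funext => w.
    by rewrite YE expr2.
  exact: L2vM.
have D0 : possemidef (cross P u u - S).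
  split=> [|a]; first by rewrite linearB /= sS cross_tr.
  by rewrite mulmxBr mulmxBl mxaddE mxoppE q subrr.
apply/eqP; rewrite -subr_eq0; apply/eqP/matrixP => i j; rewrite [RHS]mxE.
apply/eqP; rewrite -sqrf_eq0 eq_le sqr_ge0 andbT.
have := psd_CS (delta_mx i 0 : 'cV_n) (delta_mx j 0) D0.
have z : fip (delta_mx i 0 : 'cV_n) ((cross P u u - S) *m delta_mx i 0) = 0.
  by rewrite fip_cV mulmxA mulmxBr mulmxBl mxaddE mxoppE q subrr.
by rewrite z mul0r fip_cV mulmxA trmx_delta -rowE -colE [(col _ _) _ _]mxE [(row _ _) _ _]mxE.
Qed.

End GaussianVectors.

(** * Second moments of the estimation errors and innovations *)

Section Realization.
Variables (R : realType) (d : measure_display) (T : measurableType d).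
Variables (P : probability T R) (M N m : nat) (S : linear_system R N m).
Variable z : noise R T N m.
Hypothesis rz : realizes P S z.
Local Notation A := (sysA S).
Local Notation C := (sysC S).

Let x0 w := init_state z w - init_mean S.
Let om := proc_noise z.
Let vn := meas_noise z.

Lemma noise_sigma_measurable i B : noise_sigma z i B -> measurable B.
Proof.
have [[_ mX _] gw gv _] := rz; case: i => [[t|t]|] /=; apply: generated_sigma_measurable => //.
- by move=> j; have [_ mW _] := gw t; exact: mW.
- by move=> j; have [_ mW _] := gv t; exact: mW.
Qed.

Lemma om_L2 t : L2v P (om t).
Proof.
have [_ gw _ _] := rz; have := gaussian_vector_L2 (gw t).
by under eq_fun do rewrite subr0.
Qed.

Lemma vn_L2 t : L2v P (vn t).
Proof.
have [_ _ gv _] := rz; have := gaussian_vector_L2 (gv t).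
by under eq_fun do rewrite subr0.
Qed.

Lemma x0_L2 : L2v P x0.
Proof. by have [g0 _ _ _] := rz; exact: gaussian_vector_L2 g0. Qed.

Lemma om_mean t i : Ex P (fun w => om t w i 0) = 0.
Proof.
have [_ gw _ _] := rz; have := gaussian_vector_centered (gw t) i.
by under eq_fun do rewrite subr0.
Qed.

Lemma vn_mean t i : Ex P (fun w => vn t w i 0) = 0.
Proof.
have [_ _ gv _] := rz; have := gaussian_vector_centered (gv t) i.
by under eq_fun do rewrite subr0.
Qed.

Lemma om_cross t : cross P (om t) (om t) = procQ S t.
Proof.
have [_ gw _ _] := rz; have := gaussian_vector_cross (gw t).
by under eq_fun do rewrite subr0.
Qed.

Lemma vn_cross t : cross P (vn t) (vn t) = measR S t.
Proof.
have [_ _ gv _] := rz; have := gaussian_vector_cross (gv t).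
by under eq_fun do rewrite subr0.
Qed.

Lemma x0_cross : cross P x0 x0 = init_cov S.
Proof. by have [g0 _ _ _] := rz; exact: gaussian_vector_cross g0. Qed.

Lemma init_error_cov_eq : init_error_cov P S z = init_cov S.
Proof.
rewrite -x0_cross; apply/matrixP => i j; rewrite !mxE Ex_expectation.
by congr (Ex P); apply/funext => w; rewrite mxE big_ord1 [(_^T) _ _]mxE.
Qed.

Lemma cross_indep p q (u : T -> 'cV[R]_p) (v : T -> 'cV[R]_q) i j : i != j ->
  (forall a B, measurable B -> noise_sigma z i ((fun w => u w a 0) @^-1` B)) ->
  (forall a B, measurable B -> noise_sigma z j ((fun w => v w a 0) @^-1` B)) ->
  L2v P u -> L2v P v -> (forall a, Ex P (fun w => v w a 0) = 0) -> cross P u v = 0.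
Proof.
move=> ij uF vF u2 v2 v0; have [_ _ _ ind] := rz.
apply/matrixP => a b; rewrite !mxE.
rewrite (Ex_mul_indep ind noise_sigma_measurable ij (uF a) (vF b) (u2 a) (v2 b)).
by rewrite v0 mulr0.
Qed.

Let omF t a B : measurable B -> noise_sigma z (Some (inl t)) ((fun w => om t w a 0) @^-1` B).
Proof. exact: gmeas_gen. Qed.
Let vnF t a B : measurable B -> noise_sigma z (Some (inr t)) ((fun w => vn t w a 0) @^-1` B).
Proof. exact: gmeas_gen. Qed.
Let x0F a B : measurable B -> noise_sigma z None ((fun w => x0 w a 0) @^-1` B).
Proof.
rewrite (_ : (fun w => x0 w a 0) = (fun w => init_state z w a 0 - init_mean S a 0)).
  by apply: gmeas_sub; exact: gmeas_gen.
by apply/funext => w; rewrite !mxE.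
Qed.

Lemma cross_om_om s t : s != t -> cross P (om s) (om t) = 0.
Proof.
move=> st; apply: (cross_indep (i := Some (inl s)) (j := Some (inl t))) => //.
- exact: omF.
- exact: omF.
- exact: om_L2.
- exact: om_L2.
- exact: om_mean.
Qed.

Lemma cross_vn_vn s t : s != t -> cross P (vn s) (vn t) = 0.
Proof.
move=> st; apply: (cross_indep (i := Some (inr s)) (j := Some (inr t))) => //.
- exact: vnF.
- exact: vnF.
- exact: vn_L2.
- exact: vn_L2.
- exact: vn_mean.
Qed.

Lemma cross_om_vn s t : cross P (om s) (vn t) = 0.
Proof.
apply: (cross_indep (i := Some (inl s)) (j := Some (inr t))) => //.
- exact: omF.
- exact: vnF.
- exact: om_L2.
- exact: vn_L2.
- exact: vn_mean.
Qed.

Lemma cross_vn_om s t : cross P (vn s) (om t) = 0.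
Proof. by rewrite -[LHS]trmxK cross_tr cross_om_vn trmx0. Qed.

Lemma cross_x0_om t : cross P x0 (om t) = 0.
Proof.
apply: (cross_indep (i := None) (j := Some (inl t))) => //.
- exact: omF.
- exact: x0_L2.
- exact: om_L2.
- exact: om_mean.
Qed.

Lemma cross_x0_vn t : cross P x0 (vn t) = 0.
Proof.
apply: (cross_indep (i := None) (j := Some (inr t))) => //.
- exact: vnF.
- exact: x0_L2.
- exact: vn_L2.
- exact: vn_mean.
Qed.

Variable K : gain R M N m.
Local Notation e := (est_error S z K).
Local Notation obs w := (fun s => observation S z s w).

Definition innovation t w : 'cV[R]_m :=
  observation S z t.+1 w - C *m A *m estimate S K (obs w) t.

Lemma innovationE t : innovation t = fun w => C *m (A *m e t w + om t w) + vn t.+1 w.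
Proof.
apply/funext => w; rewrite /innovation /observation /est_error /= -/om -/vn.
rewrite !(mulmxDr, mulmxN) !mulmxA.
by apply/matrixP => i j; rewrite !(mxaddE, mxoppE); ring.
Qed.

Lemma est_errorS t : e t.+1 =
  fun w => A *m e t w + om t w - gain_at K t *m innovation t w.
Proof.
apply/funext => w; rewrite /innovation /est_error /= -/om.
rewrite !(mulmxDr, mulmxN) !mulmxA.
by apply/matrixP => i j; rewrite !(mxaddE, mxoppE); ring.
Qed.

Lemma est_error_L2 t : L2v P (e t).
Proof.
elim: t => [|t IH]; first exact: x0_L2.
rewrite est_errorS innovationE; apply: L2vB.
  by apply: L2vD; [exact: L2vM|exact: om_L2].
apply: L2vM; apply: L2vD; last exact: vn_L2.
by apply: L2vM; apply: L2vD; [exact: L2vM|exact: om_L2].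
Qed.

Let pred t w := A *m e t w + om t w.
Lemma pred_L2 t : L2v P (pred t).
Proof. by apply: L2vD; [apply: L2vM; exact: est_error_L2|exact: om_L2]. Qed.

Lemma innovation_L2 t : L2v P (innovation t).
Proof. by rewrite innovationE; apply: L2vD; [apply: L2vM; exact: pred_L2|exact: vn_L2]. Qed.

(** The error at time [t] is built from the initial error, the process noises before [t] and the
    measurement noises at times 1 to [t]: the innovation at [s] reads the observation at [s + 1]. *)
Lemma cross_error_noise q (n : T -> 'cV[R]_q) t : L2v P n ->
  cross P x0 n = 0 -> (forall s, (s < t)%N -> cross P (om s) n = 0) ->
  (forall s, (s < t)%N -> cross P (vn s.+1) n = 0) ->
  cross P (e t) n = 0.
Proof.
move=> n2 xn; elim: t => [//|t IH] on vnn.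
have IHt := IH (fun s st => on s (ltnW st)) (fun s st => vnn s (ltnW st)).
have pn : cross P (pred t) n = 0.
  rewrite crossDl//; [|by apply: L2vM; exact: est_error_L2|exact: om_L2].
  by rewrite crossMl ?IHt ?mulmx0 ?add0r ?on//; exact: est_error_L2.
have inn : cross P (innovation t) n = 0.
  rewrite innovationE crossDl//; [|exact/L2vM/pred_L2|exact: vn_L2].
  by rewrite crossMl//; [rewrite pn vnn// mulmx0 addr0|exact: pred_L2].
rewrite est_errorS crossDl//; [|exact: pred_L2|exact/L2vN/L2vM/innovation_L2].
rewrite pn add0r crossNl//; last exact/L2vM/innovation_L2.
by rewrite crossMl//; [rewrite inn mulmx0 oppr0|exact: innovation_L2].
Qed.

Lemma cross_error_om t s : (t <= s)%N -> cross P (e t) (om s) = 0.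
Proof.
move=> ts; apply: cross_error_noise; [exact: om_L2|exact: cross_x0_om| |].
  by move=> r rt; rewrite cross_om_om// neq_ltn (leq_trans rt ts).
by move=> r rt; exact: cross_vn_om.
Qed.

Lemma cross_error_vn t s : (t < s)%N -> cross P (e t) (vn s) = 0.
Proof.
move=> ts; apply: cross_error_noise; [exact: vn_L2|exact: cross_x0_vn| |].
  by move=> r rt; exact: cross_om_vn.
by move=> r rt; rewrite cross_vn_vn// neq_ltn (leq_ltn_trans rt ts).
Qed.

Let pred_vn t : cross P (pred t) (vn t.+1) = 0.
Proof.
rewrite crossDl//; [|by apply: L2vM; exact: est_error_L2|exact: om_L2|exact: vn_L2].
rewrite crossMl ?cross_error_vn ?cross_om_vn ?mulmx0 ?addr0//.
  exact: est_error_L2.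
exact: vn_L2.
Qed.

Let pred_pred t : cross P (e t) (e t) = err_cov S K t ->
  cross P (pred t) (pred t) = pred_cov S K t.
Proof.
move=> IH; have e2 := est_error_L2 t; have o2 := om_L2 t; have p2 := pred_L2 t.
have Ae2 : L2v P (fun w => A *m e t w) by exact: L2vM.
rewrite crossDl// !crossDr// !crossMl// !crossMr// IH om_cross cross_error_om//.
have -> : cross P (om t) (e t) = 0 by rewrite -[LHS]trmxK cross_tr cross_error_om// trmx0.
by rewrite mulmx0 mul0mx addr0 add0r mulmxA.
Qed.

Lemma pred_innov t : cross P (e t) (e t) = err_cov S K t ->
  cross P (pred t) (innovation t) = pred_cov S K t *m C^T.
Proof.
move=> IH; have p2 := pred_L2 t; have v2 := vn_L2 t.+1.
have Cp2 : L2v P (fun w => C *m pred t w) by exact: L2vM.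
by rewrite innovationE (crossDr p2 Cp2 v2) (crossMr C p2 p2) pred_pred// pred_vn addr0.
Qed.

Lemma innov_innov t : cross P (e t) (e t) = err_cov S K t ->
  cross P (innovation t) (innovation t) = innov_cov S K t.
Proof.
move=> IH; have v2 := vn_L2 t.+1; have p2 := pred_L2 t.
have Cp2 : L2v P (fun w => C *m pred t w) by exact: L2vM.
rewrite innovationE (crossDl Cp2 v2 (L2vD Cp2 v2)) (crossDr Cp2 Cp2 v2).
rewrite (crossDr v2 Cp2 v2) (crossMl C p2 Cp2) (crossMl C p2 v2) (crossMr C p2 p2).
rewrite (crossMr C v2 p2) pred_pred// pred_vn.
have -> : cross P (vn t.+1) (pred t) = 0 by rewrite -[LHS]trmxK cross_tr pred_vn trmx0.
by rewrite mulmx0 mul0mx addr0 add0r vn_cross mulmxA.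
Qed.

Lemma est_error_cross t : cross P (e t) (e t) = err_cov S K t.
Proof.
elim: t => [|t IH]; first exact: x0_cross.
have i2 := innovation_L2 t; have p2 := pred_L2 t.
have Ki2 : L2v P (fun w => gain_at K t *m innovation t w) by exact: L2vM.
have Ni2 : L2v P (fun w => - (gain_at K t *m innovation t w)) by exact: L2vN.
rewrite est_errorS.
have Nr (u : T -> 'cV[R]_N) : L2v P u ->
    cross P u (fun w => - (gain_at K t *m innovation t w)) =
    - (cross P u (innovation t) *m (gain_at K t)^T).
  by move=> u2; rewrite -[LHS]trmxK cross_tr crossNl// crossMl// linearN /= trmx_mul cross_tr.
rewrite (crossDl p2 Ni2 (L2vD p2 Ni2)) (crossDr p2 p2 Ni2) (crossDr Ni2 p2 Ni2) !Nr//.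
rewrite (crossNl Ki2 p2) (crossNl Ki2 i2) (crossMl _ i2 p2) (crossMl _ i2 i2).
rewrite pred_pred// pred_innov// innov_innov//.
have -> : cross P (innovation t) (fun w => A *m e t w + om t w) = C *m pred_cov S K t.
  rewrite -[LHS]trmxK cross_tr pred_innov// trmx_mul trmxK; congr (_ *m _).
  by rewrite -pred_pred// cross_tr.
rewrite err_cov_expand !mulmxA.
by rewrite mulNmx; apply/matrixP => i j; rewrite !(mxaddE, mxoppE); ring.
Qed.

(** The laws and the independence of the noises fix all second moments, so the cost depends on the
    realization only through [S]. *)
Lemma cost_eq : cost P S z K = riccati_cost S K.
Proof.
rewrite /cost Ex_expectation /riccati_cost.
rewrite (_ : (fun w => _) = (fun w => \sum_(0 <= t < M)
    \tr (e t.+1 w *m (e t.+1 w)^T *m Sigma S))); last first.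
  by apply/funext => w; rewrite raddf_sum.
have e2 t : L2v P (e t) := est_error_L2 t.
rewrite Ex_sum; last by move=> t; have [] := Ex_trace_cross (Sigma S) (e2 t.+1) (e2 t.+1).
apply: eq_bigr => t _; have [_ ->] := Ex_trace_cross (Sigma S) (e2 t.+1) (e2 t.+1).
by rewrite est_error_cross.
Qed.

End Realization.

(** * The sample gradient as a function of empirical moments *)

Section SampleGradient.
Variables (R : realType) (M N m : nat) (S : linear_system R N m).
Local Notation A := (sysA S).
Local Notation C := (sysC S).
Implicit Types (K : gain R M N m) (y : nat -> 'cV[R]_m).

Fixpoint transition K s j : 'M[R]_N :=
  match j with
  | 0%N => 1%:M
  | j'.+1 => closed_loop S K (s + j') *m transition K s j'
  end.

Lemma transition_recr K s j :
  transition K s j.+1 = transition K s.+1 j *m closed_loop S K s.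
Proof.
elim: j => [|j IH]; first by rewrite /= addn0 mulmx1 mul1mx.
by rewrite [LHS]/= -/(transition K s j.+1) IH mulmxA addnS.
Qed.

(** The sample gradient carries one transition matrix for each later time; its mean is matched with
    this unrolled form of the multiplier. *)
Lemma adjoint_sum K k t : adjoint S K k t =
  \sum_(0 <= j < k.+1) (transition K t j)^T *m Sigma S *m transition K t j.
Proof.
elim: k t => [|k IH] t.
  by rewrite big_nat1 /= trmx1 mul1mx mulmx1.
rewrite adjointS IH [RHS]big_nat_recl//= trmx1 mul1mx mulmx1; congr (_ + _).
rewrite mulmx_sumr mulmx_suml; apply: eq_bigr => j _.
by rewrite -/(transition K t j.+1) transition_recr trmx_mul !mulmxA.
Qed.

Definition innov_at K y t : 'cV[R]_m := y t.+1 - C *m A *m estimate S K y t.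

Lemma estimateS K y t :
  estimate S K y t.+1 = A *m estimate S K y t + gain_at K t *m innov_at K y t.
Proof. by []. Qed.

Lemma gain_at_shift K (t : 'I_M) D s :
  gain_at (shift_gain K t D) s = gain_at K s + (if s == t then D else 0).
Proof.
rewrite /gain_at; case: insubP => [i iM si|sM]; last first.
  by rewrite ifN ?addr0//; apply: contraNneq sM => ->.
by rewrite /shift_gain -si val_eqE; case: ifP; rewrite ?addr0.
Qed.

Lemma estimate_shift_le K (t : 'I_M) D y s : (s <= t)%N ->
  estimate S (shift_gain K t D) y s = estimate S K y s.
Proof.
elim: s => [//|s IH] st; rewrite !estimateS /innov_at IH ?(ltnW st)//.
by rewrite gain_at_shift ltn_eqF// addr0.
Qed.

(** The block at [t] acts once, at time [t]; the later gains are unchanged and transport the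
    perturbation through the closed loop. The estimates are thus affine in that block and the
    squared prediction errors quadratic polynomials, so the sample gradient is explicit. *)
Lemma estimate_shift K (t : 'I_M) D y j :
  estimate S (shift_gain K t D) y (t.+1 + j) =
  estimate S K y (t.+1 + j) + transition K t.+1 j *m D *m innov_at K y t.
Proof.
elim: j => [|j IH].
  rewrite addn0 !estimateS /innov_at estimate_shift_le// gain_at_shift eqxx.
  by rewrite mulmxDl mul1mx addrA.
have ts : (t < t.+1 + j)%N by exact: leq_addr.
have -> : transition K t.+1 j.+1 =
  closed_loop S K (t.+1 + j) *m transition K t.+1 j by [].
rewrite addnS; move: (t.+1 + j)%N ts IH => s ts IH.
rewrite !estimateS /innov_at -/(innov_at K y t) IH gain_at_shift gtn_eqF//= addr0.
move: (transition K t.+1 j) (innov_at K y t) => Ph nu.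
rewrite /closed_loop !(mulmxDl, mulmxDr, mulmxN, mulNmx) !mulmxA.
by apply/matrixP => a b; rewrite !(mxaddE, mxoppE); ring.
Qed.

Lemma pred_error_shift K (t : 'I_M) D y i n : (t <= i)%N ->
  pred_error S y i n (shift_gain K t D) = pred_error S y i n K -
    C *m A ^+ n *m transition K t.+1 (i - t) *m D *m innov_at K y t.
Proof.
move=> ti; rewrite /pred_error.
have -> : i.+1 = (t.+1 + (i - t))%N by rewrite addSn subnKC.
rewrite estimate_shift mulmxDr !mulmxA.
by apply/matrixP => a b; rewrite !(mxaddE, mxoppE); ring.
Qed.

Lemma derive1_quadratic (a b c : R) :
  derive1 (fun h : R => a + b * h + c * h ^+ 2) 0 = b.
Proof.
rewrite derive1E.
have H : is_derive (0 : R) (1 : R) (fun h : R => a + b * h + c * h ^+ 2) b.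
  apply: is_derive_eq; rewrite /GRing.scale /=; ring.
by rewrite derive_val.
Qed.

Lemma block_gradient_sqr K (t : 'I_M) y i n : (t <= i)%N ->
  block_gradient t
    (fun K' => ((pred_error S y i n K')^T *m pred_error S y i n K') 0 0) K =
  -2 *: ((transition K t.+1 (i - t))^T *m (C *m A ^+ n)^T *m
         (pred_error S y i n K *m (innov_at K y t)^T)).
Proof.
move=> ti; apply/matrixP => p q; rewrite mxE.
set u := pred_error S y i n K.
set B := C *m A ^+ n *m transition K t.+1 (i - t); set nu := innov_at K y t.
pose v := B *m delta_mx p q *m nu.
rewrite (_ : (fun h : R => _) =
    (fun h : R => fn2 u + (-2 * fip u v) * h + fn2 v * h ^+ 2)); last first.
  apply/funext => h; rewrite -fip_cV pred_error_shift// -/u -/nu -/B.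
  rewrite -scalemxAr -scalemxAl -/v; clearbody v u; rewrite fipBl !fipBr !fipZl !fipZr (fipC v u); ring.
rewrite derive1_quadratic mxE; congr (_ * _).
have dn : delta_mx p q *m nu = nu q 0 *: (delta_mx p 0 : 'cV_N).
  apply/matrixP => a b; rewrite ord1 !mxE (bigD1 q)//= big1 => [|k kq].
    by rewrite !mxE !eqxx !andbT addr0 mulrC.
  by rewrite !mxE (negbTE kq) andbF mul0r.
rewrite /v -mulmxA dn -scalemxAr fipZr fipC fip_mull /B trmx_mul mulmxA.
set U := _ *m u; rewrite fip_cV trmx_delta -rowE [(row _ _) _ _]mxE.
by rewrite [RHS]mxE big_ord1 [(nu^T) _ _]mxE mulrC.
Qed.

Lemma grad_estimateE L (y : 'I_L -> nat -> 'cV[R]_m) K (t : 'I_M) :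
  grad_estimate S y K t = \sum_(t <= i < M) \sum_(1 <= n < N.+1)
    -2 *: ((transition K t.+1 (i - t))^T *m (C *m A ^+ n)^T *m
    (L%:R^-1 *: \sum_(l < L) pred_error S (y l) i n K *m (innov_at K (y l) t)^T)).
Proof.
rewrite /grad_estimate scaler_sumr; apply: eq_big_nat => i /andP[ti _].
rewrite exchange_big scaler_sumr; apply: eq_bigr => n _ /=.
under eq_bigr do rewrite block_gradient_sqr//.
by rewrite -scaler_sumr -mulmx_sumr scalerA mulrC -scalerA scalemxAr.
Qed.

Notation J := (option ('I_(M + N) * 'I_m)).
Notation nf := #|{: J}|.

(** All entries of y_1, ..., y_{M+N} together with the constant 1, needed because the filter starts
    at [init_mean] and its estimates are affine in the observations. The index [s] stands for time
    [s + 1]. *)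
Definition feature_val y (a : J) : R := if a is Some (s, q) then y s.+1 q 0 else 1.
Definition feature y : 'cV[R]_nf := \col_a feature_val y (enum_val a).
Definition select (s : nat) : 'M[R]_(m, nf) :=
  \matrix_(q, a) (if (enum_val a : J) is Some (s', q')
                  then (nat_of_ord s' == s) && (q' == q) else false)%:R.
Definition select1 : 'M[R]_(1, nf) := \matrix_(q, a) ((enum_val a : J) == None)%:R.

Lemma sum_feature y p (X : 'M[R]_(p, nf)) q (a0 : J) :
  (forall a, X q a = (enum_val a == a0)%:R) ->
  (X *m feature y) q 0 = feature_val y a0.
Proof.
move=> XE; rewrite mxE.
transitivity (\sum_(a < nf) (enum_val a == a0)%:R * feature_val y (enum_val a)).
  by apply: eq_bigr => a _; rewrite XE mxE.
rewrite -(big_enum_val (fun a : J => (a == a0)%:R * feature_val y a)).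
rewrite (bigD1 a0)//= eqxx mul1r big1 ?addr0// => a /negbTE ->.
by rewrite mul0r.
Qed.

Lemma select1_feature y : select1 *m feature y = 1%:M.
Proof.
apply/matrixP => i j; rewrite !ord1 (@sum_feature y _ _ _ None).
  by rewrite mxE eqxx.
by move=> a; rewrite mxE.
Qed.

Lemma select_feature y s : (s < M + N)%N -> select s *m feature y = y s.+1.
Proof.
move=> sMN; apply/matrixP => q j; rewrite !ord1.
rewrite (@sum_feature y _ _ _ (Some (Ordinal sMN, q)))// => a.
by rewrite mxE; case: (enum_val a) => [[s' q']|].
Qed.

Fixpoint est_coef K t : 'M[R]_(N, nf) :=
  match t with
  | 0%N => init_mean S *m select1
  | t'.+1 => A *m est_coef K t'
             + gain_at K t' *m (select t' - C *m A *m est_coef K t')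
  end.
Definition innov_coef K t := select t - C *m A *m est_coef K t.
Definition error_coef K i n := select (i + n) - C *m A ^+ n *m est_coef K i.+1.

Lemma est_coefE K y t : (t <= M + N)%N -> estimate S K y t = est_coef K t *m feature y.
Proof.
elim: t => [_|t IH tMN] /=; first by rewrite -mulmxA select1_feature mulmx1.
by rewrite IH ?(ltnW tMN)// mulmxDl -!mulmxA mulmxBl select_feature// !mulmxA.
Qed.

Lemma innov_coefE K y t : (t < M + N)%N -> innov_at K y t = innov_coef K t *m feature y.
Proof.
by move=> tMN; rewrite /innov_at est_coefE ?(ltnW tMN)// mulmxBl select_feature// !mulmxA.
Qed.

Lemma error_coefE K y i n : (i < M)%N -> (n <= N)%N ->
  pred_error S y i n K = error_coef K i n *m feature y.
Proof.
move=> iM nN; have h : (i + n < M + N)%N by rewrite -addSn leq_add.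
rewrite /pred_error est_coefE; last by apply: leq_trans iM _; exact: leq_addr.
by rewrite mulmxBl select_feature// addn1 !mulmxA.
Qed.

Definition grad_term K t i n (Z : 'M[R]_nf) : 'M[R]_(N, m) :=
  -2 *: ((transition K t.+1 (i - t))^T *m (C *m A ^+ n)^T *m
         (error_coef K i n *m Z *m (innov_coef K t)^T)).
Definition moment_grad K t (Z : 'M[R]_nf) : 'M[R]_(N, m) :=
  \sum_(t <= i < M) \sum_(1 <= n < N.+1) grad_term K t i n Z.

Lemma moment_gradD K t Z Z' : moment_grad K t (Z + Z') = moment_grad K t Z + moment_grad K t Z'.
Proof.
rewrite -big_split; apply: eq_bigr => i _; rewrite -big_split; apply: eq_bigr => n _ /=.
by rewrite -scalerDr -mulmxDr -mulmxDl -mulmxDr.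
Qed.

Lemma moment_gradZ K t a Z : moment_grad K t (a *: Z) = a *: moment_grad K t Z.
Proof.
rewrite scaler_sumr; apply: eq_bigr => i _; rewrite scaler_sumr; apply: eq_bigr => n _.
by rewrite /grad_term -scalemxAr -scalemxAl -scalemxAr !scalerA mulrC.
Qed.

Lemma grad_estimate_moment L (y : 'I_L -> nat -> 'cV[R]_m) K (t : 'I_M) :
  grad_estimate S y K t =
  moment_grad K t (L%:R^-1 *: \sum_(l < L) feature (y l) *m (feature (y l))^T).
Proof.
rewrite grad_estimateE; apply: eq_big_nat => i /andP[ti iM].
apply: eq_big_nat => n /andP[n1 nN]; rewrite /grad_term; congr (_ *: (_ *m _)).
rewrite -scalemxAr -scalemxAl; congr (_ *: _).
rewrite mulmx_sumr mulmx_suml; apply: eq_bigr => l _.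
rewrite error_coefE// innov_coefE ?trmx_mul ?mulmxA//.
exact: leq_trans (ltn_ord t) (leq_addr _ _).
Qed.

End SampleGradient.

(** * The mean of the sample gradient *)

Section GradientMean.
Variables (R : realType) (d : measure_display) (T : measurableType d).
Variables (P : probability T R) (M N m : nat) (S : linear_system R N m).
Variable z : noise R T N m.
Hypothesis rz : realizes P S z.
Local Notation A := (sysA S).
Local Notation C := (sysC S).
Local Notation obs w := (fun s => observation S z s w).
Variable K : gain R M N m.
Local Notation e := (est_error S z K).
Local Notation nu := (innovation S z K).
Local Notation om := (proc_noise z).
Local Notation vn := (meas_noise z).

Lemma state_L2 t : L2v P (state S z t).
Proof.
elim: t => [|t IH].
  have := L2vD (x0_L2 rz) (L2v_cst P (init_mean S)).
  by congr L2v; apply/funext => w; rewrite subrK.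
by apply: L2vD; [exact: L2vM|exact: om_L2 rz _].
Qed.

Lemma observation_L2 t : L2v P (observation S z t).
Proof. by apply: L2vD; [apply: L2vM; exact: state_L2|exact: vn_L2 rz _]. Qed.

Lemma feature_L2 : L2v P (fun w => feature M N (obs w)).
Proof.
move=> a; rewrite (_ : (fun w => _) = fun w => feature_val (obs w) (enum_val a)).
  by case: (enum_val a) => [[s q]|]; [exact: observation_L2|exact: L2_cst].
by apply/funext => w; rewrite mxE.
Qed.

Let nu_L2 t : L2v P (nu t). Proof. exact: innovation_L2. Qed.

Lemma cross_om_innov s t : (t < s)%N -> cross P (om s) (nu t) = 0.
Proof.
move=> ts; have o2 := om_L2 rz s; have e2 := est_error_L2 rz K t.
have p2 := pred_L2 rz K t; have v2 := vn_L2 rz t.+1.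
have Cp2 := L2vM C p2; have Ae2 := L2vM A e2.
rewrite innovationE (crossDr o2 Cp2 v2) (crossMr C o2 p2) (cross_om_vn rz) addr0.
rewrite (crossDr o2 Ae2 (om_L2 rz t)) (crossMr A o2 e2) (cross_om_om rz) ?gtn_eqF//.
have -> : cross P (om s) (e t) = 0.
  by rewrite -[LHS]trmxK cross_tr (cross_error_om rz) ?trmx0// ltnW.
by rewrite mul0mx addr0 mul0mx.
Qed.

Lemma cross_vn_innov s t : (t.+1 < s)%N -> cross P (vn s) (nu t) = 0.
Proof.
move=> ts; have o2 := vn_L2 rz s; have e2 := est_error_L2 rz K t.
have p2 := pred_L2 rz K t; have v2 := vn_L2 rz t.+1.
have Cp2 := L2vM C p2; have Ae2 := L2vM A e2.
rewrite innovationE (crossDr o2 Cp2 v2) (crossMr C o2 p2) (cross_vn_vn rz) ?gtn_eqF// addr0.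
rewrite (crossDr o2 Ae2 (om_L2 rz t)) (crossMr A o2 e2) (cross_vn_om rz).
have -> : cross P (vn s) (e t) = 0.
  by rewrite -[LHS]trmxK cross_tr (cross_error_vn rz) ?trmx0// ltnW.
by rewrite mul0mx addr0 mul0mx.
Qed.

(** For j = 0 the correlation of the error with the innovation just absorbed is the predicted
    covariance times C^T, minus K_t times the innovation covariance: minus the residual. Later
    noises are uncorrelated with that innovation, so afterwards the closed loop merely transports
    the correlation. *)
Lemma cross_error_innov t j :
  cross P (e (t.+1 + j)) (nu t) = - (transition S K t.+1 j *m residual S K t).
Proof.
have n2 := nu_L2 t.
elim: j => [|j IH].
  have p2 := pred_L2 rz K t; have Kn2 := L2vM (gain_at K t) n2.
  rewrite addn0 mul1mx est_errorS (crossDl p2 (L2vN Kn2) n2) (crossNl Kn2 n2).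
  rewrite (crossMl _ n2 n2) (pred_innov rz) ?(est_error_cross rz)//.
  by rewrite (innov_innov rz) ?(est_error_cross rz)// /residual opprB.
have ts : (t < t.+1 + j)%N by exact: leq_addr.
have -> : transition S K t.+1 j.+1 =
  closed_loop S K (t.+1 + j) *m transition S K t.+1 j by [].
rewrite addnS -mulmxA -mulmxN -IH; move: (t.+1 + j)%N ts => s ts.
have e2 := est_error_L2 rz K s; have o2 := om_L2 rz s; have v2 := vn_L2 rz s.+1.
have p2 := pred_L2 rz K s; have n2s := nu_L2 s.
have Kn2 := L2vM (gain_at K s) n2s; have Cp2 := L2vM C p2; have Ae2 := L2vM A e2.
rewrite est_errorS (crossDl p2 (L2vN Kn2) n2) (crossNl Kn2 n2) (crossMl _ n2s n2).
have pE : cross P (fun w => A *m e s w + om s w) (nu t) = A *m cross P (e s) (nu t).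
  by rewrite (crossDl Ae2 o2 n2) (crossMl A e2 n2) cross_om_innov// addr0.
have -> : cross P (nu s) (nu t) = C *m (A *m cross P (e s) (nu t)).
  by rewrite innovationE (crossDl Cp2 v2 n2) (crossMl C p2 n2) pE cross_vn_innov// addr0.
by rewrite pE /closed_loop mulmxBl !mulmxA.
Qed.

Fixpoint future_noise s n w : 'cV[R]_N :=
  if n is n'.+1 then A *m future_noise s n' w + om (s + n') w else 0.

Lemma state_future s n w : state S z (s + n) w = A ^+ n *m state S z s w + future_noise s n w.
Proof.
elim: n => [|n IH]; first by rewrite addn0 expr0 mul1mx addr0.
by rewrite addnS /= IH mulmxDr exprS mulmxA addrA.
Qed.

Lemma future_noise_L2 s n : L2v P (future_noise s n).
Proof.
elim: n => [|n IH]; first exact: L2v_cst.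
by apply: L2vD; [exact: L2vM|exact: om_L2 rz _].
Qed.

Lemma cross_future s n t : (t < s)%N -> cross P (future_noise s n) (nu t) = 0.
Proof.
move=> ts; have n2 := nu_L2 t; elim: n => [|n IH].
  apply/matrixP => i j; rewrite [RHS]mxE /cross mxE -[RHS](Ex_cst P 0); congr (Ex P).
  by apply/funext => w; rewrite mxE mul0r.
have f2 := future_noise_L2 s n; have Af2 := L2vM A f2; have o2 := om_L2 rz (s + n).
rewrite (crossDl Af2 o2 n2) (crossMl A f2 n2) IH mulmx0 add0r cross_om_innov//.
by rewrite (leq_trans ts)// leq_addr.
Qed.

(** The prediction error is C A^n e_{i+1} plus noises that the innovation at [t] has not seen. For n
    = 0 and i = t both would contain the measurement noise at t + 1; this is why it matters that the
    sums over [n] start at 1. *)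
Lemma cross_pred_error i n t : (t <= i)%N -> (0 < n)%N ->
  cross P (fun w => pred_error S (obs w) i n K) (nu t) =
  - (C *m A ^+ n *m (transition S K t.+1 (i - t) *m residual S K t)).
Proof.
move=> ti n0; have n2 := nu_L2 t.
have e2 := est_error_L2 rz K i.+1; have f2 := future_noise_L2 i.+1 n.
have v2 := vn_L2 rz (i.+1 + n).
rewrite (_ : (fun w => _) = (fun w => C *m A ^+ n *m e i.+1 w +
    (C *m future_noise i.+1 n w + vn (i.+1 + n) w))); last first.
  apply/funext => w; rewrite /pred_error /observation /est_error.
  have -> : (i + n + 1 = i.+1 + n)%N by rewrite addn1 addSn.
  rewrite state_future !(mulmxDr, mulmxN) !mulmxA.
  by apply/matrixP => a b; rewrite !(mxaddE, mxoppE); ring.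
have Cf2 := L2vM C f2; have Ae2 := L2vM (C *m A ^+ n) e2.
rewrite (crossDl Ae2 (L2vD Cf2 v2) n2) (crossDl Cf2 v2 n2) (crossMl _ e2 n2) (crossMl _ f2 n2).
rewrite cross_future ?ltnS// mulmx0 add0r cross_vn_innov; last first.
  by rewrite addSn ltnS (leq_ltn_trans ti)// -{1}[i]addn0 ltn_add2l.
rewrite addr0; have -> : i.+1 = (t.+1 + (i - t))%N by rewrite addSn subnKC.
by rewrite cross_error_innov mulmxN.
Qed.

(** The sum over [n] rebuilds [Sigma S], and the sum over [i] the unrolled adjoint. *)
Lemma moment_grad_mean (t : 'I_M) :
  moment_grad S K t (cross P (fun w => feature M N (obs w)) (fun w => feature M N (obs w))) =
  policy_grad S K t.
Proof.
set F := fun w => feature M N (obs w); have F2 : L2v P F := feature_L2.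
pose Ph j := transition S K t.+1 j.
have termE i n : (t <= i < M)%N -> (0 < n <= N)%N -> grad_term S K t i n (cross P F F) =
    2 *: ((Ph (i - t)%N)^T *m ((C *m A ^+ n)^T *m (C *m A ^+ n)) *m Ph (i - t)%N *m residual S K t).
  move=> /andP[ti iM] /andP[n0 nN]; rewrite /grad_term.
  have <- : cross P (fun w => pred_error S (obs w) i n K) (nu t) =
      error_coef S K i n *m cross P F F *m (innov_coef S K t)^T.
    rewrite -(crossMl _ F2 F2) -(crossMr _ (L2vM _ F2) F2).
    congr cross; apply/funext => w; first by rewrite error_coefE.
    rewrite -innov_coefE//.
    exact: leq_trans (ltn_ord t) (leq_addr _ _).
  by rewrite cross_pred_error// mulmxN scalerN scaleNr opprK !mulmxA.
transitivity (\sum_(t <= i < M)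
   2 *: ((Ph (i - t)%N)^T *m Sigma S *m Ph (i - t)%N *m residual S K t)).
  apply: eq_big_nat => i iM.
  rewrite (eq_big_nat _ _ (fun n (h : (1 <= n < N.+1)%N) => termE i n iM h)) -scaler_sumr; congr (_ *: _).
  by rewrite /Sigma mulmx_sumr !mulmx_suml.
rewrite -scaler_sumr /policy_grad; congr (_ *: _).
rewrite -mulmx_suml /multiplier adjoint_sum; congr (_ *m _).
(* With j = i - t, these M - t terms are those of the adjoint with M - (t + 1) steps left. *)
rewrite -{1}[nat_of_ord t]add0n big_addn -(subnSK (ltn_ord t)).
by apply: eq_big_nat => j _; rewrite addnK.
Qed.

End GradientMean.

(** * Uniformity over a ball of gains *)

Section GradientBound.
Variables (R : realType) (M N m : nat) (S : linear_system R N m) (r : R).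
Implicit Types K : gain R M N m.

Let ball K := forall t, opb (gain_at K t) r.
(** Only the existence of a bound is wanted, so boundedness on the ball is propagated through sums,
    products and transposes instead of being computed. *)
Let bounded p q (F : gain R M N m -> 'M[R]_(p, q)) :=
  exists2 b, 0 <= b & forall K, ball K -> opb (F K) b.

Let bounded_cst p q (X : 'M[R]_(p, q)) : bounded (fun=> X).
Proof. by exists (Num.sqrt (fn2 X)) => [|K _]; [exact: sqrtr_ge0|exact: opb_fn2]. Qed.

Let bounded_gain t : bounded (fun K => gain_at K t).
Proof.
exists `|r| => // K /(_ t) Kr u; have := Kr u.
by rewrite real_normK ?num_real.
Qed.

Let boundedM p q s (F : gain R M N m -> 'M[R]_(p, q)) (G : gain R M N m -> 'M[R]_(q, s)) :
  bounded F -> bounded G -> bounded (fun K => F K *m G K).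
Proof.
move=> [b b0 Fb] [c c0 Gc]; exists (b * c); first exact: mulr_ge0.
by move=> K BK; apply: opbM; [exact: Fb|exact: Gc].
Qed.

Let boundedD p q (F G : gain R M N m -> 'M[R]_(p, q)) :
  bounded F -> bounded G -> bounded (fun K => F K + G K).
Proof.
move=> [b b0 Fb] [c c0 Gc]; exists (b + c); first exact: addr_ge0.
by move=> K BK; apply: opbD => //; [exact: Fb|exact: Gc].
Qed.

Let boundedN p q (F : gain R M N m -> 'M[R]_(p, q)) :
  bounded F -> bounded (fun K => - F K).
Proof. by move=> [b b0 Fb]; exists b => // K BK; apply: opbN; exact: Fb. Qed.

Let boundedT p q (F : gain R M N m -> 'M[R]_(p, q)) :
  bounded F -> bounded (fun K => (F K)^T).
Proof. by move=> [b b0 Fb]; exists b => // K BK; apply: opb_tr; exact: Fb. Qed.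

Let bounded_closed_loop t : bounded (fun K => closed_loop S K t).
Proof.
apply: boundedD; first exact: bounded_cst.
by apply/boundedN/boundedM; [exact: bounded_gain|exact: bounded_cst].
Qed.

Let bounded_transition s j : bounded (fun K => transition S K s j).
Proof.
elim: j => [|j IH]; first exact: bounded_cst.
by apply: boundedM; [exact: bounded_closed_loop|].
Qed.

Let bounded_est_coef t : bounded (fun K => est_coef S K t).
Proof.
elim: t => [|t IH]; first exact: bounded_cst.
apply: boundedD; first by apply: boundedM => //; exact: bounded_cst.
apply: boundedM; first exact: bounded_gain.
apply: boundedD; first exact: bounded_cst.
by apply/boundedN/boundedM => //; exact: bounded_cst.
Qed.

Let lin_bounded p q p' q' (F : gain R M N m -> 'M[R]_(p, q) -> 'M[R]_(p', q')) :=
  exists2 b, 0 <= b & forall K Z, ball K -> Num.sqrt (fn2 (F K Z)) <= b * Num.sqrt (fn2 Z).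

Let lin_bounded_sum I (s : seq I) p q p' q'
    (F : I -> gain R M N m -> 'M[R]_(p, q) -> 'M[R]_(p', q')) :
  (forall i, lin_bounded (F i)) -> lin_bounded (fun K Z => \sum_(i <- s) F i K Z).
Proof.
move=> Fb; elim: s => [|i s [b b0 IH]].
  by exists 0 => // K Z _; rewrite big_nil fip0r sqrtr0 mul0r.
have [c c0 Fc] := Fb i; exists (c + b); first exact: addr_ge0.
move=> K Z BK; rewrite big_cons mulrDl; apply: le_trans (sqrt_fn2D _ _) _.
by apply: lerD; [exact: Fc|exact: IH].
Qed.

Lemma moment_grad_bound t : exists2 b, 0 <= b & forall K Z,
  (forall t, opb (gain_at K t) r) ->
  Num.sqrt (fn2 (moment_grad S K t Z)) <= b * Num.sqrt (fn2 Z).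
Proof.
apply: lin_bounded_sum => i; apply: lin_bounded_sum => n.
have [b b0 Hb] : bounded (fun K => (transition S K t.+1 (i - t))^T *m
    (sysC S *m sysA S ^+ n)^T *m error_coef S K i n).
  apply: boundedM.
    by apply: boundedM; [apply: boundedT|exact: bounded_cst].
  apply: boundedD; first exact: bounded_cst.
  by apply/boundedN/boundedM => //; exact: bounded_cst.
have [c c0 Hc] : bounded (fun K => innov_coef S K t).
  apply: boundedD; first exact: bounded_cst.
  by apply/boundedN/boundedM => //; exact: bounded_cst.
exists (2 * (b * c)); first by rewrite !mulr_ge0.
move=> K Z BK; rewrite /grad_term !mulmxA.
rewrite -[leRHS]ger0_norm ?mulr_ge0 ?sqrtr_ge0// -sqrtr_sqr ler_wsqrtr//.
set X := _ *m error_coef _ _ _ _; set Y := innov_coef _ _ _.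
have h : fn2 (X *m Z *m Y^T) <= c ^+ 2 * (b ^+ 2 * fn2 Z).
  rewrite -fn2_tr trmx_mul trmxK; apply: le_trans (opb_mx _ (Hc K BK)) _.
  by rewrite fn2_tr ler_wpM2l ?sqr_ge0//; apply: opb_mx; exact: Hb.
rewrite fipZl fipZr mulrA mulrNN -expr2 !exprMn sqr_sqrtr ?fn2_ge0//.
by rewrite -mulrA ler_wpM2l ?sqr_ge0// (mulrC (b ^+ 2)) -mulrA.
Qed.

End GradientBound.

(** * Gaussian tails of the observations, uniformly in the realization *)

Section SubGaussian.
Variables (R : realType) (M N m : nat) (S : linear_system R N m).

(** [phi] is a recipe that applies on every sample space, and [l], [B] precede the quantifier over
    realizations, so the constants depend on [S] only. *)
Definition sub_gaussian (phi : forall T : Type, noise R T N m -> T -> R) : Prop :=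
  exists l B, 0 < l /\ forall d (T : measurableType d) (P : probability T R)
    (z : noise R T N m), realizes P S z ->
    measurable_fun setT (phi T z) /\
    (\int[P]_w (expR (l * phi T z w ^+ 2))%:E <= B%:E)%E.

Lemma ge0_integral_le d (T : measurableType d) (P : probability T R) (f g : T -> R) B :
  measurable_fun setT f -> measurable_fun setT g -> (forall w, 0 <= f w) ->
  (forall w, f w <= g w) -> (\int[P]_w (g w)%:E <= B)%E -> (\int[P]_w (f w)%:E <= B)%E.
Proof.
move=> mf mg f0 fg gB; apply: le_trans gB; apply: ge0_le_integral => //.
- by move=> w _; rewrite lee_fin.
- exact/measurable_EFinP.
- exact/measurable_EFinP.
- by move=> w _; rewrite lee_fin.
Qed.

Lemma measurable_exp_sqr d (T : measurableType d) (f : T -> R) l :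
  measurable_fun setT f -> measurable_fun setT (fun w => expR (l * f w ^+ 2)).
Proof.
move=> mf; apply: measurableT_comp => //; apply: measurable_funM => //.
exact: measurable_funX.
Qed.

Lemma sub_gaussianW l l' B d (T : measurableType d) (P : probability T R) (f : T -> R) :
  measurable_fun setT f -> l' <= l -> (\int[P]_w (expR (l * f w ^+ 2))%:E <= B)%E ->
  (\int[P]_w (expR (l' * f w ^+ 2))%:E <= B)%E.
Proof.
move=> mf ll; apply: ge0_integral_le => [||w|w].
- exact: measurable_exp_sqr.
- exact: measurable_exp_sqr.
- exact: expR_ge0.
- by rewrite ler_expR ler_wpM2r ?sqr_ge0.
Qed.

Lemma integral_exp_sum d (T : measurableType d) (P : probability T R) (f g : T -> R) B B' :
  measurable_fun setT f -> measurable_fun setT g ->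
  (\int[P]_w (expR (f w))%:E <= B%:E)%E -> (\int[P]_w (expR (g w))%:E <= B'%:E)%E ->
  (\int[P]_w (expR (f w) + expR (g w))%:E <= (B + B')%:E)%E.
Proof.
move=> mf mg fB gB; under eq_integral do rewrite EFinD.
have mE (h : T -> R) : measurable_fun setT h ->
    measurable_fun setT (fun w => (expR (h w))%:E).
  by move=> mh; apply/measurable_EFinP; exact: measurableT_comp.
have e0 (h : T -> R) w : setT w -> (0 <= (expR (h w))%:E)%E.
  by move=> _; rewrite lee_fin expR_ge0.
rewrite (ge0_integralD _ _ (e0 f) (mE f mf) (e0 g) (mE g mg))//.
by rewrite EFinD; exact: leeD.
Qed.

Lemma expR_half_le (a b : R) : expR ((a + b) / 2) <= expR a + expR b.
Proof.
have [ab|ba] := leP a b.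
  by apply: ler_wpDl; [exact: expR_ge0|rewrite ler_expR; lra].
by apply: ler_wpDr; [exact: expR_ge0|rewrite ler_expR; lra].
Qed.

Lemma sub_gaussian_ext phi psi : (forall T z w, phi T z w = psi T z w) ->
  sub_gaussian phi -> sub_gaussian psi.
Proof.
move=> E [l [B [l0 H]]]; exists l, B; split=> // d T P z rz.
have := H _ _ _ _ rz.
by rewrite (_ : phi T z = psi T z)//; apply/funext => w; exact: E.
Qed.

(** The summands may be dependent: (f + g)^2/2 <= f^2 + g^2 and exp ((a + b)/2) <= exp a + exp b,
    whence the factor k/4. *)
Lemma sub_gaussianD phi psi : sub_gaussian phi -> sub_gaussian psi ->
  sub_gaussian (fun T z w => phi T z w + psi T z w).
Proof.
move=> [l [B [l0 H]]] [l' [B' [l'0 H']]].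
pose k := Num.min l l'; have k0 : 0 < k by rewrite lt_min l0 l'0.
exists (k / 4), (B + B'); split; first by rewrite divr_gt0.
move=> d T P z rz; have [mf fB] := H _ _ _ _ rz; have [mg gB] := H' _ _ _ _ rz.
have {}fB := sub_gaussianW mf (_ : k <= l) fB.
have {}gB := sub_gaussianW mg (_ : k <= l') gB.
have kl : k <= l by rewrite ge_min lexx.
have kl' : k <= l' by rewrite ge_min lexx orbT.
split; first exact: measurable_funD.
have := integral_exp_sum (measurable_funM _ _) (measurable_funM _ _) (fB kl) (gB kl').
move=> /(_ (measurable_cst _) (measurable_funX _ mf) (measurable_cst _) (measurable_funX _ mg)).
apply: ge0_integral_le => [||w|w].
- exact/measurable_exp_sqr/measurable_funD.
- by apply: measurable_funD; exact: measurable_exp_sqr.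
- exact: expR_ge0.
apply: le_trans (expR_half_le _ _); rewrite ler_expR.
rewrite -mulrDr -subr_ge0.
have -> : k * (phi T z w ^+ 2 + psi T z w ^+ 2) / 2 -
  k / 4 * (phi T z w + psi T z w) ^+ 2 = k / 4 * (phi T z w - psi T z w) ^+ 2 by field.
by rewrite mulr_ge0 ?sqr_ge0// divr_ge0// ltW.
Qed.

Lemma sub_gaussianZ a phi : sub_gaussian phi ->
  sub_gaussian (fun T z w => a * phi T z w).
Proof.
move=> [l [B [l0 H]]]; have a0 : 0 < a ^+ 2 + 1 by rewrite ltr_wpDl ?sqr_ge0.
(* The added 1 covers the case [a = 0]. *)
exists (l / (a ^+ 2 + 1)), B; split; first by rewrite divr_gt0.
move=> d T P z rz; have [mf fB] := H _ _ _ _ rz.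
split; first exact: measurable_funM.
apply: ge0_integral_le fB => [||w|w].
- exact/measurable_exp_sqr/measurable_funM.
- exact: measurable_exp_sqr.
- exact: expR_ge0.
rewrite ler_expR mulrAC -mulrA ler_pM2l// ler_pdivrMr// exprMn mulrDr mulr1 mulrC.
by rewrite lerDl sqr_ge0.
Qed.

Lemma sub_gaussian_cst a : sub_gaussian (fun T z w => a).
Proof.
exists 1, (expR (1 * a ^+ 2)); split=> // d T P z rz; split; first exact: measurable_cst.
by rewrite integral_cst// [X in (_ * X)%E]probability_setT mule1.
Qed.

Lemma sub_gaussian_sum I (s : seq I) (phi : I -> forall T : Type, noise R T N m -> T -> R) :
  (forall i, sub_gaussian (phi i)) ->
  sub_gaussian (fun T z w => \sum_(i <- s) phi i T z w).
Proof.
move=> H; elim: s => [|i s IH].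
  by apply: sub_gaussian_ext (sub_gaussian_cst 0) => T z w; rewrite big_nil.
by apply: sub_gaussian_ext (sub_gaussianD (H i) IH) => T z w; rewrite big_cons.
Qed.

Lemma sub_gaussian_vector n (X : forall T : Type, noise R T N m -> T -> 'cV[R]_n) mu Sg :
  (forall d (T : measurableType d) (P : probability T R) (z : noise R T N m),
     realizes P S z -> gaussian_vector P (X T z) mu Sg) ->
  forall i, sub_gaussian (fun T z w => X T z w i 0).
Proof.
move=> gX i; pose a : 'cV[R]_n := delta_mx i 0; pose v := (a^T *m Sg *m a) 0 0.
have H : sub_gaussian (fun T z w => X T z w i 0 - mu i 0).
  (* A negative [v] leaves no realization, and any constants will do. *)
  have [v0|v0] := leP 0 v; last first.
    exists 1, 0; split=> // d T P z rz; have [[_ pS] _ _] := gX _ _ _ _ rz.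
    by move: v0; rewrite ltNge /v pS.
  exists (4 * (v + 1))^-1, 2; split; first by rewrite invr_gt0 mulr_gt0// ltr_wpDl.
  move=> d T P z rz; have [_ mX law] := gX _ _ _ _ rz.
  split; first exact: measurable_funB.
  apply: (gaussian_exp_sqr_bound (mX i) v0) => B mB.
  have := law a B mB; rewrite -/v /a !trmx_delta -!rowE [(row i mu) _ _]mxE => <-.
  by congr (P _); apply/seteqP; split=> w /=; rewrite -rowE mxE.
apply: sub_gaussian_ext (sub_gaussianD H (sub_gaussian_cst (mu i 0))) => T z w.
by rewrite subrK.
Qed.

Lemma sub_gaussian_mulmx p q (X : 'M[R]_(p, q)) (u : forall T : Type, noise R T N m -> T -> 'cV[R]_q) :
  (forall i, sub_gaussian (fun T z w => u T z w i 0)) ->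
  forall i, sub_gaussian (fun T z w => (X *m u T z w) i 0).
Proof.
move=> Hu i; apply: (@sub_gaussian_ext (fun T z w => \sum_j X i j * u T z w j 0)).
  by move=> T z w; rewrite mxE.
by apply: sub_gaussian_sum => j; exact: sub_gaussianZ.
Qed.

Lemma sub_gaussian_addv p (u v : forall T : Type, noise R T N m -> T -> 'cV[R]_p) :
  (forall i, sub_gaussian (fun T z w => u T z w i 0)) ->
  (forall i, sub_gaussian (fun T z w => v T z w i 0)) ->
  forall i, sub_gaussian (fun T z w => (u T z w + v T z w) i 0).
Proof.
move=> Hu Hv i; apply: (@sub_gaussian_ext (fun T z w => u T z w i 0 + v T z w i 0)).
  by move=> T z w; rewrite mxE.
exact: sub_gaussianD.
Qed.

Lemma sub_gaussian_init i :
  sub_gaussian (fun (T : Type) (z : noise R T N m) w => init_state z w i 0).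
Proof.
have H d (T : measurableType d) (P : probability T R) (z : noise R T N m) :
    realizes P S z -> gaussian_vector P (init_state z) (init_mean S) (init_cov S).
  by case=> g _ _ _; exact: g.
have Q := @sub_gaussian_vector N (fun T z => init_state z) (init_mean S) (init_cov S).
exact (Q H i).
Qed.

Lemma sub_gaussian_proc t i :
  sub_gaussian (fun (T : Type) (z : noise R T N m) w => proc_noise z t w i 0).
Proof.
have H d (T : measurableType d) (P : probability T R) (z : noise R T N m) :
    realizes P S z -> gaussian_vector P (proc_noise z t) 0 (procQ S t).
  by case=> _ g _ _; exact: g.
have Q := @sub_gaussian_vector N (fun T z => proc_noise z t) 0 (procQ S t).
exact (Q H i).
Qed.

Lemma sub_gaussian_meas t i :
  sub_gaussian (fun (T : Type) (z : noise R T N m) w => meas_noise z t w i 0).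
Proof.
have H d (T : measurableType d) (P : probability T R) (z : noise R T N m) :
    realizes P S z -> gaussian_vector P (meas_noise z t) 0 (measR S t).
  by case=> _ _ g _; exact: g.
have Q := @sub_gaussian_vector m (fun T z => meas_noise z t) 0 (measR S t).
exact (Q H i).
Qed.

Lemma sub_gaussian_state t i : sub_gaussian (fun T z w => state S z t w i 0).
Proof.
elim: t i => [|t IH] i; first exact: sub_gaussian_init.
have Ax := @sub_gaussian_mulmx _ _ (sysA S) (fun T z => state S z t) IH.
have Q := @sub_gaussian_addv N (fun T z w => sysA S *m state S z t w) (fun T z => proc_noise z t).
exact (Q Ax (sub_gaussian_proc t) i).
Qed.

Lemma sub_gaussian_observation t i : sub_gaussian (fun T z w => observation S z t w i 0).
Proof.
have Cx := @sub_gaussian_mulmx _ _ (sysC S) (fun T z => state S z t) (sub_gaussian_state t).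
have Q := @sub_gaussian_addv m (fun T z w => sysC S *m state S z t w) (fun T z => meas_noise z t).
exact (Q Cx (sub_gaussian_meas t) i).
Qed.

Lemma sub_gaussian_feature a :
  sub_gaussian (fun T z w => feature_val (M := M) (N := N) (fun s => observation S z s w) a).
Proof.
case: a => [[s q]|]; first exact: sub_gaussian_observation.
exact: sub_gaussian_cst.
Qed.

(** Since |f g| <= (f^2 + g^2)/2, Gaussian tails of the features give exponential tails of their
    products. As there are finitely many features, a minimum of the [l] and a sum of the [B] serve
    all pairs. *)
Lemma feature_product_exp : exists l B, 0 < l /\
  forall d (T : measurableType d) (P : probability T R) (z : noise R T N m),
  realizes P S z -> forall a b,
  (\int[P]_w (expR (l * `|feature_val (M := M) (N := N) (fun s => observation S z s w) a
      * feature_val (M := M) (N := N) (fun s => observation S z s w) b|))%:E <= B%:E)%E.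
Proof.
have /choice[lf Hl] := sub_gaussian_feature.
have /choice[Bf HB] := Hl.
pose l := \big[Num.min/1]_a lf a; pose B := \sum_a `|Bf a|.
have l0 : 0 < l.
  by rewrite /l; elim/big_ind: _ => // [x y x0 y0|a _]; [rewrite lt_min x0|have [] := HB a].
have ll a : l <= lf a by exact: bigmin_le.
have BB a : Bf a <= B.
  by apply: le_trans (ler_norm _) _; rewrite /B (bigD1 a)//= lerDl sumr_ge0.
exists l, (B + B); split=> // d T P z rz a b.
have [_ /(_ _ _ _ _ rz)[ma fa]] := HB a; have [_ /(_ _ _ _ _ rz)[mb fb]] := HB b.
set f := (fun w => feature_val _ a) in ma fa; set g := (fun w => feature_val _ b) in mb fb.
have {}fa := le_trans (sub_gaussianW ma (ll a) fa) (_ : (Bf a)%:E <= B%:E)%E.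
have {}fb := le_trans (sub_gaussianW mb (ll b) fb) (_ : (Bf b)%:E <= B%:E)%E.
have := integral_exp_sum (measurable_funM _ _) (measurable_funM _ _) (fa _) (fb _).
rewrite !lee_fin => /(_ (measurable_cst _) (measurable_funX _ ma) (measurable_cst _)
  (measurable_funX _ mb) (BB a) (BB b)).
apply: ge0_integral_le => [||w|w].
- apply: measurableT_comp => //; apply: measurable_funM => //.
  by apply: measurableT_comp => //; exact: measurable_funM.
- by apply: measurable_funD; exact: measurable_exp_sqr.
- exact: expR_ge0.
apply: le_trans (expR_half_le _ _); rewrite ler_expR -mulrDr -mulrA ler_pM2l//.
rewrite -/(f w) -/(g w); have := sqr_ge0 (f w - g w); have := sqr_ge0 (f w + g w).
by rewrite ler_norml !expr2; lra.
Qed.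

End SubGaussian.

(** * Concentration of the empirical second moments *)

Section FeatureConcentration.
Variable R : realType.

Lemma union_bound d (T : measurableType d) (P : probability T R) (I : eqType)
    (s : seq I) (A : I -> set T) (x : R) :
  (forall i, measurable (A i)) -> (forall i, P (A i) <= x%:E)%E ->
  exists B, [/\ measurable B, (P B <= ((size s)%:R * x)%:E)%E &
    forall i w, i \in s -> A i w -> B w].
Proof.
move=> mA PA; elim: s => [|i s [B [mB PB AB]]].
  by exists set0; split=> //; rewrite measure0 mul0r.
exists (A i `|` B); split; first exact: measurableU.
  apply: le_trans (measureU2 _ (mA i) mB) _.
  by rewrite /= -natr1 mulrDl mul1r addrC EFinD; exact: leeD.
move=> j w; rewrite inE => /orP[/eqP -> Aw|js Aw]; [by left|right; exact: AB Aw].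
Qed.

Lemma sqrt_fn2_le n (X : 'M[R]_n) s : 0 <= s -> (forall a b, `|X a b| <= s) ->
  Num.sqrt (fn2 X) <= n%:R * s.
Proof.
move=> s0 Xs; rewrite -[leRHS]ger0_norm ?mulr_ge0// -sqrtr_sqr ler_wsqrtr// fn2E.
apply: (@le_trans _ _ (\sum_(j < n) \sum_(i < n) s ^+ 2)).
  apply: ler_sum => j _; apply: ler_sum => i _.
  by rewrite -real_normK ?num_real// ler_pXn2r// nnegrE.
rewrite !sumr_const !card_ord.
by rewrite -[leLHS]mulr_natl -[s ^+ 2 *+ n]mulr_natl mulrA -expr2 exprMn.
Qed.

Variables (M N m : nat) (S : linear_system R N m).
Local Notation nf := #|{: option ('I_(M + N) * 'I_m)}|.
Local Notation feat z w := (feature M N (fun s => observation S z s w)).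

Lemma feature_concentration : exists2 k, 0 < k & exists2 D, 1 <= D &
  forall d (T : measurableType d) (P : probability T R) (L : nat)
    (zs : 'I_L -> noise R T N m), (0 < L)%N ->
  (forall l, realizes P S (zs l)) ->
  mutually_independent P (fun l => trajectory_sigma M S (zs l)) ->
  forall s, 0 < s -> s <= k ->
  exists A, [/\ measurable A, (P A <= (D * expR (- (k * L%:R * s ^+ 2)))%:E)%E &
    forall w, ~ A w ->
     Num.sqrt (fn2 (L%:R^-1 *: (\sum_l feat (zs l) w *m (feat (zs l) w)^T) -
       L%:R^-1 *: (\sum_l cross P (fun w => feat (zs l) w) (fun w => feat (zs l) w))))
     <= nf%:R * s].
Proof.
have [lam [B [l0 HB]]] := feature_product_exp M S.
have [k k0 Hk] := empirical_mean_dev B l0.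
(* Two tails for each pair of features; the maximum with 1 makes ln D nonnegative, as
   [sample_size_bigO] requires. *)
pose D : R := Num.max 1 ((size (enum {: 'I_nf * 'I_nf}))%:R * 2).
exists k => //; exists D; first by rewrite le_max lexx.
move=> d T P L zs L0 rz ind s s0 sk.
pose fv l a w := feature_val (M := M) (N := N) (fun s => observation S (zs l) s w) a.
have fvF l a : gmeas (fun (p : 'I_(M + N) * 'I_m) w => observation S (zs l) p.1.+1 w p.2 0)
    (fv l a).
  case: a => [[s' q]|]; last exact: gmeas_cst.
  exact: (@gmeas_gen _ _ _ _ (fun (p : 'I_(M + N) * 'I_m) w =>
    observation S (zs l) p.1.+1 w p.2 0) (s', q)).
have mF l A : trajectory_sigma M S (zs l) A -> measurable A.
  apply: generated_sigma_measurable => p.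
  by have [] := observation_L2 (rz l) p.1.+1 p.2.
pose Z (p : 'I_nf * 'I_nf) (l : 'I_L) w := fv l (enum_val p.1) w * fv l (enum_val p.2) w.
have /choice[A HA] (p : 'I_nf * 'I_nf) : exists A, [/\ measurable A,
    (P A <= (2 * expR (- (k * L%:R * s ^+ 2)))%:E)%E &
    forall w, ~ A w ->
     `|L%:R^-1 * \sum_i Z p i w - L%:R^-1 * \sum_i Ex P (Z p i)| <= s].
  have FZ i : gmeas (fun (p : 'I_(M + N) * 'I_m) w => observation S (zs i) p.1.+1 w p.2 0)
      (Z p i) by exact: (gmeas_mul (fvF i _) (fvF i _)).
  have Q := Hk d T P L (fun l => trajectory_sigma M S (zs l)) (Z p) s L0 ind mF FZ
    (fun i => HB _ _ _ _ (rz i) _ _) s0 sk.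
  exact: Q.
have [A' [mA' PA' AA']] := @union_bound _ _ P _ (enum {: 'I_nf * 'I_nf}) A _
  (fun p => let: And3 h _ _ := HA p in h) (fun p => let: And3 _ h _ := HA p in h).
exists A'; split=> //.
  apply: le_trans PA' _; rewrite lee_fin mulrA ler_wpM2r ?expR_ge0//.
  by rewrite /D le_max lexx orbT.
move=> w A'w; apply: sqrt_fn2_le => [|a b]; first exact: ltW.
have [_ _ /(_ w)] := HA (a, b); move=> h.
have {h} := h (fun Aw => A'w (AA' (a, b) w (mem_enum _ _) Aw)).
have mxZE n (c : R) (X : 'M[R]_n) i j : (c *: X) i j = c * X i j by rewrite mxE.
congr (`|_| <= _); rewrite mxE mxoppE.
rewrite !mxZE !summxE.
congr (_ * _ - _ * _); apply: eq_bigr => i _.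
  by rewrite mxE big_ord1 ![(_^T) _ _]mxE !mxE.
by rewrite mxE; congr (Ex P); apply/funext => w'; rewrite !mxE.
Qed.

End FeatureConcentration.

Lemma constants_eq (R : realType) (M N m : nat) (S : linear_system R N m)
    (f : gain R M N m -> R) (Ks Ks' : gain R M N m) : f Ks = f Ks' ->
  c1 S f Ks = c1 S f Ks'.
Proof. by rewrite /c1 /constB => ->. Qed.

(** * Sample size *)

Section SampleSize.
Variable R : realType.
Variables k D q : R.
Hypotheses (k0 : 0 < k) (D1 : 1 <= D) (q0 : 0 < q).

(** Accuracy of order epsilon, which yields the rate epsilon^-2; the truncation at 1 serves the
    thresholds that do not shrink with epsilon. *)
Definition precision epsilon := q * Num.min epsilon 1.

(** Solves D exp (- k L precision^2) <= delta for [L]; the successor rounds up and makes the sample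
    size positive. *)
Definition sample_size epsilon delta :=
  (Num.truncn (ln (D / delta) / (k * precision epsilon ^+ 2))).+1.

Lemma precision_gt0 epsilon : 0 < epsilon -> 0 < precision epsilon.
Proof. by move=> e0; rewrite mulr_gt0// lt_min e0 ltr01. Qed.

Lemma sample_size_tail epsilon delta L : 0 < epsilon -> 0 < delta ->
  (sample_size epsilon delta <= L)%N ->
  D * expR (- (k * L%:R * precision epsilon ^+ 2)) <= delta.
Proof.
move=> e0 d0 sL; have s0 := precision_gt0 e0; have D0 := lt_le_trans ltr01 D1.
have h : ln (D / delta) <= k * L%:R * precision epsilon ^+ 2.
  have : ln (D / delta) / (k * precision epsilon ^+ 2) <= L%:R.
    apply: le_trans (ltW (truncnS_gt _)) _.
    by rewrite ler_nat.
  rewrite ler_pdivrMr; last by rewrite mulr_gt0// exprn_gt0.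
  by move=> h; apply: le_trans h _; rewrite mulrA (mulrC L%:R).
rewrite -ler_pdivlMl//; apply: (@le_trans _ _ (expR (- ln (D / delta)))).
  by rewrite ler_expR lerN2.
rewrite expRN lnK ?posrE ?divr_gt0//.
by rewrite invf_div mulrC.
Qed.

Lemma sample_size_bigO :
  let F := filter_prod (0 : R)^'+ (0 : R)^'+ in
  (fun p : R * R => (sample_size p.1 p.2)%:R : R) =O_F
  (fun p : R * R => (p.1 ^+ 2)^-1 * ln (p.2^-1) : R).
Proof.
have D0 := lt_le_trans ltr01 D1; have lD : 0 <= ln D by exact: ln_ge0.
apply/eqOP/bigO_exP; pose c := (ln D + 1) / (k * q ^+ 2).
have c0 : 0 < c by rewrite divr_gt0 ?mulr_gt0 ?exprn_gt0// ltr_wpDl.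
exists (c + 1); first exact: addr_gt0.
(* In this range both factors of the comparison function are at least 1, which absorbs ln D and the
   rounding. *)
exists ([set x | 0 < x < 1], [set x | 0 < x < expR (-1)]).
  split; near=> x => /=; apply/andP; split.
  - by near: x; exact: nbhs_right_gt.
  - by near: x; exact: nbhs_right_lt.
  - by near: x; exact: nbhs_right_gt.
  - by near: x; apply: nbhs_right_lt; exact: expR_gt0.
move=> [e d] /= [/andP[e0 e1] /andP[d0 d1]].
have ld : 1 <= ln d^-1.
  rewrite lnV ?posrE// lerNr -[leRHS]expRK ler_ln ?posrE ?expR_gt0//.
  exact: ltW.
have e21 : 1 <= (e ^+ 2)^-1.
  by rewrite invr_ge1 ?unitfE ?gt_eqF ?exprn_gt0// expr_le1 ?(ltW e0)// ltW.
have y0 : 1 <= (e ^+ 2)^-1 * ln d^-1 by exact: mulr_ege1.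
rewrite ger0_norm// [X in _ * X]ger0_norm; last exact: le_trans ler01 y0.
have pe : precision e = q * e by rewrite /precision min_l// ltW.
rewrite /sample_size pe -addn1 natrD mulrDl mul1r lerD//.
have lnD : ln (D / d) = ln D + ln d^-1 by rewrite lnM ?posrE ?invr_gt0.
have x0 : 0 <= ln (D / d) / (k * (q * e) ^+ 2).
  rewrite divr_ge0//; first by rewrite lnD addr_ge0// (le_trans ler01).
  by rewrite mulr_ge0 ?sqr_ge0// ltW.
apply: (@le_trans _ _ (ln (D / d) / (k * (q * e) ^+ 2))); first by rewrite truncn_le.
have -> : ln (D / d) / (k * (q * e) ^+ 2) = (e ^+ 2)^-1 * (ln (D / d) / (k * q ^+ 2)).
  by rewrite exprMn mulrA invfM mulrA mulrC.
rewrite [leRHS]mulrCA ler_wpM2l ?invr_ge0 ?sqr_ge0// /c mulrAC ler_wpM2r//.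
  by rewrite invr_ge0 mulr_ge0 ?sqr_ge0// ltW.
by rewrite lnD mulrDl mul1r lerD2r ler_peMr.
Unshelve. all: by end_near.
Qed.

End SampleSize.

(** * Concentration of the sample gradient, uniformly in the gain *)

Section GradientConcentration.
Variables (R : realType) (M N m : nat) (S : linear_system R N m).
Local Notation nf := #|{: option ('I_(M + N) * 'I_m)}|.

(** The exceptional event [A] is chosen before [K], so the estimate holds at gains that depend on
    the samples. By linearity the error is [moment_grad] of the deviation of the moments, to which
    the bound on the ball applies. *)
Lemma gradient_concentration (r c : R) : 0 < c ->
  exists2 q, 0 < q & exists2 k, 0 < k & exists2 D, 1 <= D &
  forall d (T : measurableType d) (P : probability T R) (L : nat)
    (zs : 'I_L -> noise R T N m), (0 < L)%N ->
  (forall l, realizes P S (zs l)) ->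
  mutually_independent P (fun l => trajectory_sigma M S (zs l)) ->
  forall x, 0 < x -> x <= 1 ->
  exists A, [/\ measurable A, (P A <= (D * expR (- (k * L%:R * (q * x) ^+ 2)))%:E)%E &
    forall w, ~ A w -> forall (K : gain R M N m) (t : 'I_M),
      (forall t, opb (gain_at K t) r) ->
      Num.sqrt (fn2 (grad_estimate S (fun l s => observation S (zs l) s w) K t -
        policy_grad S K t)) <= c * x].
Proof.
move=> c0; have [k k0 [D D1 conc]] := feature_concentration M S.
have /choice[bt Hbt] (t : 'I_M) : exists b, 0 <= b /\ forall (K : gain R M N m) Z,
    (forall t, opb (gain_at K t) r) ->
    Num.sqrt (fn2 (moment_grad S K t Z)) <= b * Num.sqrt (fn2 Z).
  by have [b b0 Hb] := @moment_grad_bound R M N m S r t; exists b.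
have bt0 t := (Hbt t).1; have Hb t := (Hbt t).2.
pose b := \sum_t bt t; have b0 : 0 <= b by exact: sumr_ge0.
have btb t : bt t <= b.
  by rewrite /b (bigD1 t)//= lerDl sumr_ge0.
have bn0 : 0 < b * nf%:R + 1 by rewrite ltr_wpDl// mulr_ge0.
(* The first term keeps [q * x] in the range of the concentration inequality; the second brings [b]
   times the moment error, itself at most nf q x, below [c * x]. *)
pose q := Num.min k (c / (b * nf%:R + 1)).
have q0 : 0 < q by rewrite lt_min k0 divr_gt0.
exists q => //; exists k => //; exists D => //.
move=> d T P L zs L0 rz ind x x0 x1.
have s0 : 0 < q * x by exact: mulr_gt0.
have sk : q * x <= k.
  by rewrite -[leRHS]mulr1 ler_pM ?(ltW q0) ?(ltW x0)// ge_min lexx.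
have [A [mA PA Aw]] := conc d T P L zs L0 rz ind _ s0 sk.
exists A; split=> // w /Aw; set Zh := L%:R^-1 *: _; set Zb := L%:R^-1 *: _.
move=> hZ K t BK.
have -> : policy_grad S K t = moment_grad S K t Zb.
  rewrite /Zb moment_gradZ (_ : moment_grad _ _ _ _ = \sum_(l < L) policy_grad S K t).
    rewrite sumr_const card_ord -[X in _ *: X]scaler_nat scalerA mulVf ?scale1r//.
    by rewrite pnatr_eq0 -lt0n.
  rewrite (_ : moment_grad _ _ _ _ = \sum_(l < L) moment_grad S K t (cross P
    (fun w => feature M N (fun s => observation S (zs l) s w))
    (fun w => feature M N (fun s => observation S (zs l) s w)))).
    by apply: eq_bigr => l _; exact: moment_grad_mean (rz l) K t.
  apply: (big_morph (moment_grad S K t) (moment_gradD S K t)).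
  by rewrite -[X in moment_grad _ _ _ X](scale0r 0) moment_gradZ scale0r.
rewrite grad_estimate_moment -/Zh -[- moment_grad _ _ _ _]scaleN1r -moment_gradZ.
rewrite -moment_gradD scaleN1r.
apply: le_trans (Hb t K _ BK) _; apply: le_trans (ler_pM (bt0 t) (sqrtr_ge0 _) (btb t) hZ) _.
rewrite !mulrA ler_wpM2r ?(ltW x0)//.
apply: (@le_trans _ _ ((b * nf%:R + 1) * q)).
  by rewrite ler_wpM2r ?(ltW q0)// lerDl.
rewrite mulrC -ler_pdivlMr// ge_min.
by rewrite lexx orbT.
Qed.

End GradientConcentration.

(** * Sample size fixed ahead of the probability space *)

Lemma minimizer_eq (X : Type) (R : realType) (f : X -> R) x y :
  is_minimizer f x -> is_minimizer f y -> f x = f y.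
Proof. by move=> hx hy; apply: le_anti; rewrite hx hy. Qed.

Theorem theorem4 (R : realType) (M N m : nat)
    (hM : (0 < M)%N) (hN : (0 < N)%N) (hm : (0 < m)%N)
    (S : linear_system R N m)
    (hQ : forall t, posdef (procQ S t)) (hR : forall t, posdef (measR S t))
    (hobs : observable (sysC S) (sysA S)) (hA : sysA S \in unitmx)
    (K0 : gain R M N m) (b eta : R) (hb : 0 < b) (heta : 0 < eta) :
  exists L0 : R -> R -> nat,
    (let F := filter_prod (0 : R)^'+ (0 : R)^'+ in
     (fun p : R * R => (L0 p.1 p.2)%:R : R) =O_F
     (fun p : R * R => (p.1 ^+ 2)^-1 * ln (p.2^-1) : R)) /\
    forall (d : measure_display) (T : measurableType d) (P : probability T R)
      (z : noise R T N m) (Ks : gain R M N m),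
      let f := cost P S z in
      let P0 := init_error_cov P S z in
      realizes P S z ->
      is_minimizer f Ks ->
      (eta%:E <= Order.min (c3 S f P0 Ks K0 b) (c4 S f P0 K0)%:E)%E ->
      forall (epsilon delta : R), 0 < epsilon -> 0 < delta -> delta < 1 ->
      forall L : nat, (L0 epsilon delta <= L)%N ->
      forall (d' : measure_display) (T' : measurableType d')
        (P' : probability T' R) (zs : 'I_L -> noise R T' N m),
        (forall l, realizes P' S (zs l)) ->
        mutually_independent P' (fun l => trajectory_sigma M S (zs l)) ->
        with_prob_at_least P' (1 - delta)
          [set w | let Kseq :=
                     sgd S (fun l t => observation S (zs l) t w) eta K0 in
             forall k : nat,
               (forall j : nat, (j <= k)%N -> epsilon <= f (Kseq j) - f Ks) ->
               f (Kseq k) - f Ks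
                 <= (1 - eta / (8 * c1 S f Ks)) ^+ k * (f K0 - f Ks)].
Proof.
pose F := @riccati_cost R M N m S; pose P0 := init_cov S.
have psd d (T : measurableType d) (P : probability T R) z : realizes P S z ->
    possemidef (init_cov S) by case=> -[h _ _] _ _ _; exact: h.
have costF d (T : measurableType d) (P : probability T R) z : realizes P S z ->
    cost P S z = F :> (gain R M N m -> R).
  by move=> rz; apply/funext => K; exact: cost_eq rz K.
(* This alternative involves only [S], [K0], [b] and [eta], so it may be decided before the sample
   size is chosen; semidefiniteness of [init_cov S] belongs to it because it is known only through a
   realization. In the negative case any admissible realization has f(K0) <= f(Ks), the gap is below
   epsilon already at k = 0, and sample size 0 works with the full event. *)
case: (pselect (possemidef P0 /\ exists Ks1, [/\ is_minimizer F Ks1, F Ks1 < F K0 &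
    (eta%:E <= Order.min (c3 S F P0 Ks1 K0 b) (c4 S F P0 K0)%:E)%E])); last first.
  move=> nH; exists (fun _ _ => 0%N); split.
    by apply/eqOP/bigO0_subproof.
  move=> d T P z Ks f f0 rz; rewrite /f0 /f (costF _ _ _ _ rz) (init_error_cov_eq rz).
  move=> minKs step epsilon delta e0 d0 d1 L _ d' T' P' zs _ _.
  have F0 : F K0 <= F Ks.
    rewrite leNgt; apply/negP => lt0; apply: nH; split; first exact: psd rz.
    by exists Ks.
  exists setT; split=> //; last by rewrite probability_setT lee_fin gerBl ltW.
  move=> w _ k /(_ 0%N isT) /= h; exfalso.
  by have := lt_le_trans e0 h; rewrite subr_gt0 ltNge F0.
case=> pP0 [Ks1 [min1 lt1 step1]].
have [s1 s10 rate] := sgd_linear_rate hM hN hm pP0 hQ hR hobs hA min1 lt1 hb heta step1.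
(* With this [c] and x = min(epsilon, 1), both c x <= s1 and (c x)^2 <= s1 epsilon. *)
pose c := Num.min s1 1; have c0 : 0 < c by rewrite lt_min s10 ltr01.
have [cs1 c1'] : c <= s1 /\ c <= 1 by rewrite !ge_min !lexx orbT.
(* The radius [constC] at [K0] bounds every gain of the sublevel set. *)
have [q q0 [k k0 [D D1 conc]]] :=
  @gradient_concentration R M N m S (constC S F P0 Ks1 K0) c c0.
exists (sample_size k D q); split; first exact: sample_size_bigO.
move=> d T P z Ks f f0 rz; rewrite /f0 /f (costF _ _ _ _ rz) (init_error_cov_eq rz).
move=> minKs _ epsilon delta e0 d0 d1 L sL d' T' P' zs rzs ind.
(* The minimizer given with the realization may differ from [Ks1], but only its cost enters the
   claim. *)
have FKs : F Ks = F Ks1 := minimizer_eq minKs min1.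
rewrite (constants_eq S FKs) FKs.
pose x := Num.min epsilon 1; have x0 : 0 < x by rewrite lt_min e0 ltr01.
have [xe x1] : x <= epsilon /\ x <= 1 by rewrite !ge_min !lexx orbT.
have L0 : (0 < L)%N by exact: leq_trans sL.
have [B [mB PB HB]] := conc _ _ P' L zs L0 rzs ind x x0 x1.
(* Off [B] the gradient estimate holds along the whole random sequence, so the complement is the
   measurable event required. *)
exists (~` B); split; first exact: measurableC.
  move=> w Bw /=; set Kq := sgd _ _ _ _ => n hn.
  pose g j i := grad_estimate S (fun l s => observation S (zs l) s w) (Kq j) i -
    policy_grad S (Kq j) i.
  apply: (rate Kq g epsilon (c * x)) => //.
  - exact: mulr_ge0 (ltW c0) (ltW x0).
  - by rewrite -[leRHS]mulr1; apply: ler_pM => //; exact: ltW.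
  - rewrite exprMn; apply: ler_pM; rewrite ?sqr_ge0//.
      by apply: le_trans cs1; rewrite expr2 (ler_piMr (ltW c0) c1').
    by apply: le_trans xe; rewrite expr2 (ler_piMr (ltW x0) x1).
  - by move=> j; apply/funext => i; rewrite /g [policy_grad _ _ _ + _]addrC subrK.
  move=> j i Kj; apply: (HB w Bw) => t.
  have Kt := gain_opb hM hN hm pP0 hQ hR hobs hA (Kq j) t min1.
  apply: (opb_le _ _ Kt).
    exact: constC_ge0.
  exact: constC_le.
rewrite probability_setC// EFinB leeB//.
by apply: le_trans PB _; rewrite lee_fin; exact: sample_size_tail.
Qed.
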